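(* Let $f\colon[0,L]\times\mathbb{R}^+\to\mathbb{R}$ be an $L^1$-Carathéodory function satisfying: - $(f^* )$ $f(x,0)=0$ for a.e. $x\in I$; - $(f_0^-)$ there is $q_-\in L^1(I,\mathbb{R}^+)$ with $\liminf_{s\to0^+}f(x,s)/s\ge-q_-(x)$ uniformly a.e. $x\in I$; - $(f_0^+)$ there is $q_0\in L^1(I,\mathbb{R}^+)$, $q_0\not\equiv0$, with $\limsup_{s\to0^+}f(x,s)/s\le q_0(x)$ uniformly a.e. $x\in I$ and $\mu_1(q_0)>1$; - $(H)$ there exist $n\ge1$ closed, pairwise disjoint intervals $I_1,\dots,I_n\subseteq I$ such that $f(x,s)\ge0$ for a.e. $x\in\bigcup_{i=1}^nI_i$ and all $s\ge0$, and $f(x,s)\le0$ for a.e. $x\in I\setminus\bigcup_{i=1}^nI_i$ and all $s\ge0$; - $(f_\infty)$ for each $i=1,\dots,n$ there is $q_\infty^i\in L^1(I_i,\mathbb{R}^+)$, $q_\infty^i\not\equiv0$, with $\liminf_{s\to+\infty}f(x,s)/s\ge q_\infty^i(x)$ uniformly a.e. $x\in I_i$ and $\mu_1^{I_i}(q_\infty^i)<1$. Then there exists at least one positive solution of $$u''+f(x,u)=0,\qquad u(0)=u(L)=0.$$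
   Context: $\mathbb{R}^+=[0,+\infty)$, $I=[0,L]$ with $L>0$. $f$ is $L^1$-Carathéodory if $x\mapsto f(x,s)$ is measurable for each $s\in\mathbb{R}^+$, $s\mapsto f(x,s)$ is continuous for a.e. $x\in I$, and for each $\rho>0$ there is $\gamma_\rho\in L^1(I,\mathbb{R}^+)$ with $|f(x,s)|\le\gamma_\rho(x)$ for a.e. $x\in I$ and all $0\le s\le\rho$. A solution is an absolutely continuous $u\colon I\to\mathbb{R}^+$ with $u'$ absolutely continuous satisfying the equation a.e. and the boundary conditions; it is positive if $u>0$ on $(0,L)$. For a compact interval $J\subseteq I$ and $q\in L^1(J,\mathbb{R}^+)$, $q\not\equiv0$ (i.e. $q>0$ on a set of positive measure), $\mu_1^J(q)>0$ is the first eigenvalue of $\varphi''+\mu q(x)\varphi=0$, $\varphi|_{\partial J}=0$; $\mu_1(q):=\mu_1^I(q)$. ''$\liminf_{s\to s_0}f(x,s)/s\ge q(x)$ uniformly a.e. $x\in J$'' means: for each $\varepsilon>0$, $f(x,s)/s\ge q(x)-\varepsilon$ for a.e. $x\in J$ and all $s>0$ sufficiently close to $s_0$, uniformly in $x$ (sufficiently large if $s_0=+\infty$); similarly for $\limsup$. *)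

(* Defs.v *)
From HB Require Import structures.
From mathcomp Require Import all_boot all_order all_algebra.
From mathcomp Require Import all_classical all_reals all_analysis.

Set Implicit Arguments.
Unset Strict Implicit.
Unset Printing Implicit Defensive.

Import Order.TTheory GRing.Theory Num.Theory.
Import numFieldNormedType.Exports.

Local Open Scope classical_set_scope.
Local Open Scope ring_scope.

(* The library measure [lebesgue_measure] lives on the Borel sets only; the
   usual notions of measurable function and of L^1 are those of its
   completion, whose sigma-algebra is that of the Lebesgue measurable sets. *)
Notation leb := (@completed_lebesgue_measure _).

Definition lebesgue_measurable_fun (R : realType) (D : set R) (g : R -> R) :=
  @measurable_fun _ _
    (caratheodory_type ((@wlength R idfun)^*)%mu) (measurableTypeR R) D g.

Definition L1_nonneg (R : realType) (D : set R) (q : R -> R) :=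
  leb.-integrable D (EFin \o q) /\ (forall x, D x -> 0 <= q x).

Definition not_ae_zero (R : realType) (D : set R) (q : R -> R) : Prop :=
  (0 < leb (D `&` [set x | (0 < q x)%R]))%E.

(* Only the values of f on `[0, L] x `[0, +oo[ matter. *)
Definition L1_caratheodory (R : realType) (L : R) (f : R -> R -> R) :=
  [/\ forall s, 0 <= s -> lebesgue_measurable_fun `[0, L] (f ^~ s),
      {ae leb, forall x, x \in `[0, L] ->
         {within `[0, +oo[, continuous (f x)}} &
      forall rho, 0 < rho -> exists2 gam : R -> R, L1_nonneg `[0, L] gam &
        {ae leb, forall x, x \in `[0, L] ->
           forall s, 0 <= s <= rho -> `|f x s| <= gam x}].

Definition abs_continuous (R : realType) (a b : R) (g : R -> R) :=
  forall e : R, 0 < e -> exists2 d : R, 0 < d &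
    forall (n : nat) (l r : 'I_n -> R),
      (forall i, [/\ a <= l i, l i <= r i & r i <= b]) ->
      trivIset setT (fun i => [set` `]l i, r i[]) ->
      \sum_i (r i - l i) < d ->
      \sum_i `|g (r i) - g (l i)| < e.

(* u solves u'' + F(x, u) = 0, u(a) = u(b) = 0 in the Caratheodory sense, v
   being u'.  The identity u' = v is required on the open interval only: as u
   and v are continuous on `[a, b], it extends to the one-sided derivatives at
   the endpoints. *)
Definition dirichlet_solution (R : realType) (a b : R) (F : R -> R -> R)
    (u : R -> R) :=
  [/\ abs_continuous a b u,
      exists v : R -> R,
        [/\ abs_continuous a b v,
            forall x, x \in `]a, b[ -> is_derive x 1 u (v x) &
            {ae leb, forall x, x \in `]a, b[ ->
               derivable v x 1 /\ 'D_1 v x + F x (u x) = 0}],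
      u a = 0 & u b = 0].

Definition dirichlet_eigenvalue (R : realType) (a b : R) (q : R -> R)
    (mu : R) :=
  exists2 phi : R -> R,
    dirichlet_solution a b (fun x s => mu * q x * s) phi &
    exists2 x, x \in `[a, b] & phi x != 0.

(* mu = mu_1^J(q) for J = `[a, b] *)
Definition first_eigenvalue (R : realType) (a b : R) (q : R -> R) (mu : R) :=
  dirichlet_eigenvalue a b q mu /\
  forall nu, dirichlet_eigenvalue a b q nu -> mu <= nu.

(* liminf_{s -> F} f(x, s) / s >= q(x) and limsup_{s -> F} f(x, s) / s <= q(x),
   uniformly a.e. x in D: the neighborhood U of the limit point does not depend
   on x. *)
Definition unif_liminf_ge (R : realType) (F : set_system R) (D : set R)
    (f : R -> R -> R) (q : R -> R) :=
  forall e : R, 0 < e -> exists2 U : set R, F U &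
    {ae leb, forall x, D x -> forall s, U s -> q x - e <= f x s / s}.

Definition unif_limsup_le (R : realType) (F : set_system R) (D : set R)
    (f : R -> R -> R) (q : R -> R) :=
  forall e : R, 0 < e -> exists2 U : set R, F U &
    {ae leb, forall x, D x -> forall s, U s -> f x s / s <= q x + e}.

(* Main.v *)
(** The solution is found by shooting.  Replacing [f] by a nonlinearity [F] that
    is linear in [s] beyond a large constant [M], one gets [|F x s| <= g x * |s|]
    with [g] in L^1.  The initial value problem need not have unique solutions,
    so the shooting is done on a symplectic Euler scheme with [N] steps, whose
    solution is a continuous function of the slope [al] at [0].  If a
    discrete solution vanishes at an interior node, its values at the two
    neighbouring nodes are opposite, so a nonnegative nonzero one cannot touch 0
    inside.  Hence, when [al] increases from a value for which all the nodal
    values are positive to one for which some are negative, it goes through a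
    nonnegative discrete solution that vanishes at [L].

    Nonnegative discrete solutions converge along subsequences to solutions, and
    this turns statements on differential equations into statements on the
    scheme, uniformly in [N]. Small slopes give positive values because [mu_1
    q_0 > 1]: the solution of [y'' + q_0 y = 0], [y 0 = 0], [y' 0 = 1], is
    positive on ]0, L], and testing with it excludes small nonnegative solutions
    of the Dirichlet problem. Nonnegative discrete solutions are bounded, which
    excludes large slopes, because by [mu_1 q_oo < 1] on one [I_i], a
    nonnegative solution of the equation linearised at infinity vanishes on
    [I_i], hence identically.

    The limit satisfies [u <= M]: on each [I_i] by comparison with an
    eigenfunction, in the gaps by convexity.  So it solves the original problem;
    an interior zero would be a double zero and, by Gronwall, [u] would
    vanish. *)
Require Import Defs.
From HB Require Import structures.
From mathcomp Require Import all_boot all_order all_algebra.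
From mathcomp Require Import all_classical all_reals all_analysis.
From mathcomp Require Import measurable_realfun ring lra.

Set Implicit Arguments.
Unset Strict Implicit.
Unset Printing Implicit Defensive.

Import Order.TTheory GRing.Theory Num.Theory.
Import numFieldNormedType.Exports.

Local Open Scope classical_set_scope.
Local Open Scope ring_scope.

(** * Integration against the completed Lebesgue measure *)

(** The order in which constants are chosen avoids a circle. On each I_i the truncated nonlinearity
    satisfies [(q - eps) * s - S * q <= F x s] with [S] and [eps] independent of the level [M >= S];
    the a priori bound [K * S] is thus known before [M], which is taken above all these bounds. The
    weight [g] then depends on [M], the tolerance of the small-slope argument on [g], the radius on
    which f is compared with q_0 on that tolerance, and the initial slope comes last. Truncating
    linearly, rather than by a constant, serves the scaling argument: f has no linear growth bound
    at infinity, whereas [F x (t * s) / t] converges to [F x M / M * s]. Since f is only L^1 in x,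
    equations are handled in integral form and the scheme integrates over cells with s frozen. The
    eigenfunctions given by the hypotheses enter this setting through the fundamental theorem of
    calculus for absolutely continuous functions; the solution leaves it through Lebesgue
    differentiation. *)

Section generic_measure.
Context d (T : measurableType d) (R : realType) (mu : {measure set T -> \bar R}).
Variables (D : set T) (mD : measurable D).
Implicit Types (p q g : T -> R).

Lemma ae_dominated_integrable p g : mu.-integrable D (EFin \o g) ->
  measurable_fun D p -> {ae mu, forall x, D x -> `|p x| <= g x} ->
  mu.-integrable D (EFin \o p).
Proof.
move=> Lg mp H; apply/integrableP; split; first exact/measurable_EFinP.
have /integrableP[mg] := Lg; apply: le_lt_trans.
apply: ae_ge0_le_integral => //=.
- by apply/measurable_EFinP; apply: measurableT_comp.
- by apply/measurable_EFinP; apply: measurableT_comp => //; exact/measurable_EFinP.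
- apply: filterS H => x H xab; rewrite lee_fin.
  by apply: le_trans (ler_norm _); apply: H.
Qed.

Lemma integrableM_bounded p (u : T -> R) (B : R) : mu.-integrable D (EFin \o p) ->
  measurable_fun D u -> (forall x, D x -> `|u x| <= B) ->
  mu.-integrable D (EFin \o (fun x => p x * u x)).
Proof.
move=> Lp mu' uB; apply: (@ae_dominated_integrable _ (fun x => B * `|p x|)).
- exact: (integrableZl mD B (integrable_norm Lp)).
- apply: measurable_funM => //; have /integrableP[+ _] := Lp.
  by move=> /measurable_EFinP.
- by apply: aeW => x xab; rewrite normrM mulrC ler_wpM2r// uB.
Qed.

(** Meant for adjacent compact intervals, which share an endpoint. *)
Lemma Rintegral_setU0 (A B : set T) p : measurable A -> measurable B ->
  mu (A `&` B) = 0%E -> mu.-integrable (A `|` B) (EFin \o p) ->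
  \int[mu]_(x in A `|` B) p x = \int[mu]_(x in A) p x + \int[mu]_(x in B) p x.
Proof.
move=> mA mB AB0 ip; have mAB : measurable (A `|` B) by exact: measurableU.
have mBA : measurable (B `\` A) by exact: measurableD.
have E : A `|` B = A `|` (B `\` A).
  apply/seteqP; split=> x; last by case=> [|[]]; [left|right].
  by case=> [|Bx]; [left|case: (pselect (A x)) => Ax; [left|right]].
rewrite {1}E Rintegral_setU//; last 2 first.
- by rewrite -E.
- by rewrite disj_set2E setIDA setIC -setIDA setDv setI0.
congr (_ + _); rewrite /Rintegral; congr fine; symmetry.
rewrite (@negligible_integral _ _ _ mu B (A `&` B))//.
- by congr (integral _ _ _); rewrite setDIr setDv setU0.
- exact: measurableI.
- by apply: integrableS ip => //.
Qed.

Lemma Rintegral_bigsetU n (A : 'I_n -> set T) p :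
  (forall i, measurable (A i)) -> trivIset setT A ->
  mu.-integrable (\big[setU/set0]_(i < n) A i) (EFin \o p) ->
  \int[mu]_(x in \big[setU/set0]_(i < n) A i) p x =
  \sum_(i < n) \int[mu]_(x in A i) p x.
Proof.
move=> mA tA ip; rewrite /Rintegral integral_bigsetU_EFin//; last 3 first.
- exact: index_enum_uniq.
- exact: sub_trivIset tA.
- by have /integrableP[] := ip.
rewrite sum_fine// => i _; apply: integrable_fin_num => //.
apply: integrableS ip => //; first exact: bigsetU_measurable.
by rewrite (bigD1 i)//=; left.
Qed.

Lemma Rintegral_setD0 (N : set T) p : measurable N -> mu N = 0%E ->
  mu.-integrable D (EFin \o p) ->
  \int[mu]_(x in D `\` N) p x = \int[mu]_(x in D) p x.
Proof. by move=> mN N0 ip; rewrite /Rintegral -negligible_integral. Qed.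

Lemma ae_le_Rintegral p q : mu.-integrable D (EFin \o p) ->
  mu.-integrable D (EFin \o q) -> {ae mu, forall x, D x -> p x <= q x} ->
  \int[mu]_(x in D) p x <= \int[mu]_(x in D) q x.
Proof.
move=> ip iq H; rewrite -subr_ge0 -RintegralB// fine_ge0//.
have [m _] := integrableP _ _ _ (integrableB mD iq ip).
(* [integral_ge0] asks for a sign at every point, so [q - p] is replaced by its positive part, equal
   to it almost everywhere. *)
rewrite (@ae_eq_integral _ _ _ mu D (fun x => (Num.max (q x - p x) 0)%:E))//.
- by apply: integral_ge0 => x _; rewrite lee_fin le_max lexx orbT.
- apply/measurable_EFinP; apply: measurable_maxr => //.
  exact/measurable_EFinP.
- by apply: filterS H => x H /H pq; rewrite /= max_l// subr_ge0.
Qed.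

Lemma ae_eq_Rintegral p q : mu.-integrable D (EFin \o p) ->
  mu.-integrable D (EFin \o q) -> {ae mu, forall x, D x -> p x = q x} ->
  \int[mu]_(x in D) p x = \int[mu]_(x in D) q x.
Proof.
move=> ip iq H; apply/le_anti/andP; split; apply: ae_le_Rintegral => //.
  by apply: filterS H => x H /H ->.
by apply: filterS H => x H /H ->.
Qed.

Lemma Rintegral0_ae p : mu.-integrable D (EFin \o p) ->
  (forall x, D x -> 0 <= p x) -> \int[mu]_(x in D) p x <= 0 ->
  {ae mu, forall x, D x -> p x = 0}.
Proof.
move=> ip p0 i0.
have [m _] := integrableP _ _ _ ip.
have := (@ae_eq_integral_abs _ _ _ mu D mD _ m).1.
have -> : (\int[mu]_(x in D) `|(EFin \o p) x| = \int[mu]_(x in D) (p x)%:E)%E.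
  by apply: eq_integral => x /set_mem Dx; rewrite gee0_abs// lee_fin p0.
case.
  have fn := integrable_fin_num mD ip.
  rewrite -[LHS](fineK fn); congr EFin; apply/le_anti; rewrite i0/=.
  by apply: fine_ge0; apply: integral_ge0 => x Dx; rewrite lee_fin p0.
by move=> N H; exists N; case: H => ? ? sN; split => // x /= h; apply: sN => /= h2; apply: h => Dx; case: (h2 Dx).
Qed.

Lemma Rintegral_abs_continuous p (e : R) : mu.-integrable D (EFin \o p) ->
  0 < e -> exists2 r : R, 0 < r & forall A, measurable A -> A `<=` D ->
    (mu A < r%:E)%E -> \int[mu]_(x in A) `|p x| < e.
Proof.
move=> ip e0.
have ip' : mu.-integrable setT (EFin \o (p \_ D)).
  by rewrite -restrict_EFin; exact/(integrable_mkcond _ mD).1.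
have [r [r0 H]] := integral_normr_continuous ip' e0.
exists r => // A mA AD Ar; rewrite (le_lt_trans _ (H A mA Ar))//.
rewrite le_eqVlt; apply/orP; left; apply/eqP; apply: eq_Rintegral => x xA.
by rewrite patchE mem_set//; apply: AD; exact: set_mem.
Qed.

Lemma cvg_dominated_Rintegral (p_ : nat -> T -> R) p g :
  (forall k, measurable_fun D (p_ k)) -> measurable_fun D p ->
  {ae mu, forall x, D x -> p_ ^~ x @ \oo --> p x} ->
  mu.-integrable D (EFin \o g) ->
  {ae mu, forall x k, D x -> `|p_ k x| <= g x} ->
  (fun k => \int[mu]_(x in D) p_ k x) @ \oo --> \int[mu]_(x in D) p x.
Proof.
move=> mp_ mp cp ig dom.
have [] := @dominated_convergence _ _ _ mu D mD (fun k => EFin \o p_ k)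
  (EFin \o p) (EFin \o g).
- by move=> k; exact/measurable_EFinP.
- exact/measurable_EFinP.
- by apply: filterS cp => x cp /cp cpx; apply/fine_cvgP; split => //; exact: nearW.
- exact: ig.
- by apply: filterS dom => x dom k Dx; rewrite lee_fin; exact: dom.
- move=> ip _; rewrite /Rintegral -(fineK (integrable_fin_num mD ip)) /=.
  by case/fine_cvgP.
Qed.
End generic_measure.

Section integral_toolbox.
Context {R : realType}.
Implicit Types (p q g : R -> R) (a b c x y : R).

Definition L1 a b p := leb.-integrable `[a, b]%classic (EFin \o p).
(** Not oriented: the value is 0 when [b < a], hence the order hypotheses carried by the additivity
    lemmas. *)
Definition itg p a b : R := \int[leb]_(t in `[a, b]%classic) p t.
Local Notation lset A :=
  (@measurable _ (caratheodory_type ((@wlength R idfun)^*)%mu) A).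

Lemma lmeas (A : set R) : measurable A -> lset A.
Proof. by move=> mA; exact: sub_caratheodory. Qed.

Lemma lmeas_itv (i : interval R) : lset [set` i].
Proof. by apply: lmeas; exact: measurable_itv. Qed.

Lemma lmeas_fun (D : set R) (h : R -> R) : measurable D ->
  measurable_fun D h -> lebesgue_measurable_fun D h.
Proof. by move=> mD mh _ Y mY; apply: lmeas; exact: mh. Qed.

Lemma aeS (P Q : R -> Prop) : (forall x, P x -> Q x) ->
  {ae leb, forall x, P x} -> {ae leb, forall x, Q x}.
Proof.
by move=> PQ; apply: filterS => //; exact: (ae_filter_ringOfSetsType leb).
Qed.

Lemma aeS2 (P Q S : R -> Prop) : (forall x, P x -> Q x -> S x) ->
  {ae leb, forall x, P x} -> {ae leb, forall x, Q x} ->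
  {ae leb, forall x, S x}.
Proof.
by move=> PQ; apply: filterS2 => //; exact: (ae_filter_ringOfSetsType leb).
Qed.

Lemma aeT (P : R -> Prop) : (forall x, P x) -> {ae leb, forall x, P x}.
Proof. by move=> h; exists set0; split => // x /=; apply; exact: h. Qed.

Lemma lebE (A : set R) : leb A = lebesgue_measure A.
Proof. by []. Qed.

Lemma leb_itv a b : a <= b -> leb (`[a, b]%classic : set R) = (b - a)%:E.
Proof.
move=> ab; rewrite lebE lebesgue_measure_itv lte_fin; case: ltP => //= ba.
by have -> : a = b; [apply/le_anti; rewrite ab ba|rewrite subrr].
Qed.

Lemma leb_fin a b : (leb (`[a, b]%classic : set R) < +oo)%E.
Proof.
have [ab|ba] := leP a b; first by rewrite leb_itv// ltry.
by rewrite set_itv_ge ?lebE ?measure0// bnd_simp -ltNge.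
Qed.

Lemma L1_meas a b p : L1 a b p -> lebesgue_measurable_fun `[a, b] p.
Proof. by move=> /integrableP[/measurable_EFinP]. Qed.

Lemma L1S a b c d p : a <= c -> d <= b -> L1 a b p -> L1 c d p.
Proof.
move=> ac db; apply: integrableS; try exact: lmeas_itv.
move=> x /=; rewrite !in_itv/= => /andP[h1 h2].
by rewrite (le_trans ac)//= (le_trans h2).
Qed.

Lemma L1D a b p q : L1 a b p -> L1 a b q -> L1 a b (fun x => p x + q x).
Proof. by move=> Lp Lq; exact: (integrableD (lmeas_itv _) Lp Lq). Qed.

Lemma L1N a b p : L1 a b p -> L1 a b (fun x => - p x).
Proof. by move=> Lp; exact: (integrableN Lp). Qed.

Lemma L1B a b p q : L1 a b p -> L1 a b q -> L1 a b (fun x => p x - q x).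
Proof. by move=> Lp Lq; apply: L1D => //; apply: L1N. Qed.

Lemma L1Z a b c p : L1 a b p -> L1 a b (fun x => c * p x).
Proof. by move=> Lp; exact: (integrableZl (lmeas_itv _) c Lp). Qed.

Lemma L1_norm a b p : L1 a b p -> L1 a b (fun x => `|p x|).
Proof. by move=> Lp; exact: (integrable_norm Lp). Qed.

Lemma L1_cst a b (c : R) : L1 a b (fun=> c).
Proof.
have H : [bounded (fun=> c) x | x in `[a, b]%classic].
  by exists `|c|; split; [rewrite num_real|move=> M cM x _ /=; exact: ltW].
exact: (measurable_bounded_integrable (lmeas_itv _) (leb_fin a b) (measurable_cst c) H).
Qed.

Lemma L1_dom a b p g : L1 a b g -> lebesgue_measurable_fun `[a, b] p ->
  {ae leb, forall x, x \in `[a, b] -> `|p x| <= g x} -> L1 a b p.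
Proof. exact: (ae_dominated_integrable (lmeas_itv _)). Qed.

Lemma L1M a b p u (B : R) : L1 a b p -> lebesgue_measurable_fun `[a, b] u ->
  (forall x, x \in `[a, b] -> `|u x| <= B) -> L1 a b (fun x => p x * u x).
Proof. exact: (integrableM_bounded (lmeas_itv _)). Qed.

Lemma itg_splits a b c p : a <= b -> b <= c -> L1 a c p ->
  itg p a c = itg p a b + itg p b c.
Proof.
move=> ab bc.
have E : `[a, c]%classic = `[a, b]%classic `|` `[b, c]%classic :> set R.
  apply/seteqP; split=> x /=; rewrite !in_itv/=.
    by move=> /andP[-> ->]; rewrite ?andbT /=; case: (leP x b) => [|/ltW]; [left|right].
  by case=> /andP[h1 h2]; rewrite ?h1 ?h2 ?(le_trans ab)// (le_trans h2).
rewrite /L1 /itg E; apply: Rintegral_setU0; try exact: lmeas_itv.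
have -> : `[a, b]%classic `&` `[b, c]%classic = [set b] :> set R.
  apply/seteqP; split=> x /=; rewrite !in_itv/=.
    by move=> [/andP[_ h1] /andP[h2 _]]; apply/le_anti; rewrite h1 h2.
  by move=> ->; rewrite lexx ab bc.
exact: lebesgue_measure_set1.
Qed.

Lemma itgD a b p q : L1 a b p -> L1 a b q ->
  itg (fun x => p x + q x) a b = itg p a b + itg q a b.
Proof. by move=> Lp Lq; exact: (RintegralD (lmeas_itv _) Lp Lq). Qed.

Lemma itgB a b p q : L1 a b p -> L1 a b q ->
  itg (fun x => p x - q x) a b = itg p a b - itg q a b.
Proof. by move=> Lp Lq; exact: (RintegralB (lmeas_itv _) Lp Lq). Qed.

Lemma itgZ a b c p : L1 a b p -> itg (fun x => c * p x) a b = c * itg p a b.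
Proof.
by move=> Lp; rewrite /itg RintegralZl//; exact: lmeas_itv.
Qed.

Lemma itgN a b p : L1 a b p -> itg (fun x => - p x) a b = - itg p a b.
Proof.
move=> Lp; rewrite -mulN1r -itgZ//; congr (itg _ a b).
by apply/funext => x; rewrite mulN1r.
Qed.

Lemma itg_cst a b c : a <= b -> itg (fun=> c) a b = c * (b - a).
Proof.
move=> ab; rewrite /itg (Rintegral_cst _ (lmeas_itv _)).
by have := leb_itv ab => /= ->.
Qed.

Lemma itg_aa a p : L1 a a p -> itg p a a = 0.
Proof. by move=> /(itg_splits (lexx a) (lexx a)) H; lra. Qed.

Lemma le_itg a b p q : L1 a b p -> L1 a b q ->
  {ae leb, forall x, x \in `[a, b] -> p x <= q x} -> itg p a b <= itg q a b.
Proof. exact: (ae_le_Rintegral (lmeas_itv _)). Qed.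

Lemma eq_itg a b p q : L1 a b p -> L1 a b q ->
  {ae leb, forall x, x \in `[a, b] -> p x = q x} -> itg p a b = itg q a b.
Proof. exact: (ae_eq_Rintegral (lmeas_itv _)). Qed.

Lemma itg_ge0 a b p : {in `[a, b], forall x, 0 <= p x} -> 0 <= itg p a b.
Proof. by move=> p0; apply: Rintegral_ge0 => x; exact: p0. Qed.

Lemma le_norm_itg a b p : L1 a b p -> `|itg p a b| <= itg (fun x => `|p x|) a b.
Proof. exact: (le_normr_Rintegral (lmeas_itv _)). Qed.

Lemma int0_ae a b p : L1 a b p -> (forall x, x \in `[a, b] -> 0 <= p x) ->
  itg p a b <= 0 -> {ae leb, forall x, x \in `[a, b] -> p x = 0}.
Proof. exact: (Rintegral0_ae (lmeas_itv _)). Qed.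

Lemma itg_cvg a b (p_ : nat -> R -> R) p g :
  (forall k, lebesgue_measurable_fun `[a, b] (p_ k)) ->
  lebesgue_measurable_fun `[a, b] p ->
  {ae leb, forall x, x \in `[a, b] -> p_ ^~ x @ \oo --> p x} ->
  L1 a b g ->
  {ae leb, forall x k, x \in `[a, b] -> `|p_ k x| <= g x} ->
  (fun k => itg (p_ k) a b) @ \oo --> itg p a b.
Proof. exact: (cvg_dominated_Rintegral (lmeas_itv _)). Qed.

Lemma itg_abs_continuous a b p (e : R) : L1 a b p -> 0 < e ->
  exists2 r : R, 0 < r & forall A, lset A -> A `<=` `[a, b]%classic ->
    (leb A < r%:E)%E -> \int[leb]_(x in A) `|p x| < e.
Proof. exact: (Rintegral_abs_continuous (lmeas_itv _)). Qed.

Lemma itg_small a b p (e : R) : L1 a b p -> 0 < e ->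
  exists2 r : R, 0 < r & forall x y, a <= x -> x <= y -> y <= b -> y - x < r ->
    itg (fun t => `|p t|) x y < e.
Proof.
move=> Lp e0; have [r r0 H] := itg_abs_continuous Lp e0.
exists r => // x y ax xy yb yxr; apply: H; first exact: lmeas_itv.
  move=> z /=; rewrite !in_itv/= => /andP[h1 h2].
  by rewrite (le_trans ax)//= (le_trans h2).
by rewrite leb_itv// lte_fin.
Qed.

(* A Lebesgue measurable function agrees outside a Borel null set with a Borel
   one: every level set {p > r}, r rational, is a Borel set up to a null set. *)
Lemma borel_representative p : lebesgue_measurable_fun setT p ->
  exists (q : R -> R), measurable_fun [set: R] q /\
    exists Z : set R, [/\ measurable Z, lebesgue_measure Z = 0%E &
      forall x, ~ Z x -> p x = q x].
Proof.
move=> mp.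
have H (r : rat) : exists AZ : set R * set R, [/\ measurable AZ.1,
    measurable AZ.2, lebesgue_measure AZ.2 = 0%E &
    forall x, ~ AZ.2 x -> (ratr r < p x <-> AZ.1 x)].
  have : lset (p @^-1` `]ratr r, +oo[).
    by rewrite -(setTI (p @^-1` _)); exact: (mp (lmeas measurableT) _ (measurable_itv _)).
  rewrite -completed_caratheodory_measurable g_sigma_completed_algebra_genE.
  case=> A mA [N [Z [mZ Z0 NZ]] ANp]; exists (A, Z); split => //= x Zx.
  have : (A `|` N) x <-> (p @^-1` `]ratr r, +oo[) x by rewrite ANp.
  rewrite /= in_itv/= andbT => -[h1 h2]; split; last by move=> Ax; apply: h1; left.
  by move=> /h2[//|/NZ].
pose rt n : rat := odflt 0 (unpickle n).
pose AZ n := projT1 (cid (H (rt n))).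
have AZP n : [/\ measurable (AZ n).1,
    measurable (AZ n).2, lebesgue_measure (AZ n).2 = 0%E &
    forall x, ~ (AZ n).2 x -> (ratr (rt n) < p x <-> (AZ n).1 x)].
  exact: (projT2 (cid (H (rt n)))).
pose Z := \bigcup_n (AZ n).2.
have mZ : measurable Z by apply: bigcupT_measurable => n; have [] := AZP n.
have Z0 : lebesgue_measure Z = 0%E.
  apply: measure_negligible => //; apply: negligible_bigcup => n.
  by have [_ m0 z0 _] := AZP n; exists (AZ n).2; split.
exists (fun x => if x \in Z then 0 else p x); split; last first.
  by exists Z; split => // x Zx; rewrite memNset.
move=> _; apply: (measurability _ (RGenOInfty.measurableE R)) => // _ [_ [s ->] <-].
(* The modified function is 0 on [Z], so [Z] lies in the level set exactly when [s] is negative. *)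
pose Y : set R := if s < 0 then Z else set0.
have mY : measurable Y by rewrite /Y; case: ifP.
have -> : [set: R] `&` (fun x => if x \in Z then 0 else p x) @^-1` `]s, +oo[ =
  ((\bigcup_(n in [set n | s <= ratr (rt n)]) (AZ n).1) `\` Z) `|` Y.
  apply/seteqP; split => x /=.
    move=> [_]; case: ifPn; rewrite in_itv/= andbT => xZ.
      by move=> s0; right; rewrite /Y s0; exact: set_mem.
    move=> spx; left; split; last by move=> /mem_set; exact/negP.
    have [r] := rat_in_itvoo spx; rewrite inE/= => /andP[sr rp].
    have rE : rt (pickle r) = r by rewrite /rt pickleK.
    exists (pickle r) => /=; first by rewrite rE ltW.
    have [_ _ _ h] := AZP (pickle r); apply/h; last by rewrite rE.
    by move=> Zx; move/negP: xZ; apply; apply/mem_set; exists (pickle r).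
  case=> [[[n /= sn An] Zx]|Yx]; split => //.
    rewrite memNset// in_itv/= andbT (le_lt_trans sn)//.
    by have [_ _ _ h] := AZP n; apply/h => // Zn; apply: Zx; exists n.
  by move: Yx; rewrite /Y; case: ifP => // s0 Zx; rewrite mem_set// in_itv/= s0.
apply: measurableU => //; apply: measurableD => //.
by apply: bigcup_measurable => n _; have [] := AZP n.
Qed.

(** The identity is measurable from Lebesgue sets to Borel sets and pushes [leb] forward to
    [lebesgue_measure]; integrals of a Borel representative therefore agree for both measures, which
    prepares the use of [FTC1]. *)
Lemma itg_borel a b p q (Z : set R) : L1 a b p -> measurable_fun setT q ->
  measurable Z -> lebesgue_measure Z = 0%E ->
  (forall x, ~ Z x -> (p \_ `[a, b]) x = q x) ->
  lebesgue_measure.-integrable setT (EFin \o q) /\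
  forall x, a <= x -> x <= b ->
    itg p a x = \int[lebesgue_measure]_(t in `[a, x]) q t.
Proof.
move=> Lp mq mZ Z0 pq.
pose phi : caratheodory_type ((@wlength R idfun)^*)%mu -> measurableTypeR R := id.
have mphi : measurable_fun setT phi.
  by move=> _ Y mY; rewrite setTI; exact: lmeas.
have pushE (A : set R) : pushforward leb phi A = lebesgue_measure A by [].
have mqE : measurable_fun setT (EFin \o q) by exact/measurable_EFinP.
have mlq : lebesgue_measurable_fun setT q by exact: lmeas_fun.
have mD : lset `[a, b]%classic by exact: lmeas_itv.
have aeZ : {ae leb, forall x, ~ Z x}.
  by exists Z; split; [exact: lmeas|exact: Z0|move=> x /= /contrapT].
have ip1 : leb.-integrable setT (EFin \o (p \_ `[a, b])).
  by rewrite -restrict_EFin; exact: (integrable_mkcond _ mD).1.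
have iq : leb.-integrable setT (EFin \o q).
  apply: (ae_dominated_integrable (lmeas measurableT) (integrable_norm ip1) mlq).
  by apply: (aeS _ aeZ) => x Zx _ /=; rewrite pq.
split.
  have := @integrable_pushforward _ _ _ _ _ _ mphi leb setT _ mqE iq measurableT.
  exact.
move=> x ax xb.
have iqx : leb.-integrable `[a, x]%classic (EFin \o q).
  by apply: (integrableS (lmeas measurableT) (lmeas_itv _) _ iq).
have := @integral_pushforward _ _ _ _ _ _ mphi leb `[a, x]%classic _ mqE iqx (measurable_itv _).
move=> H.
transitivity (\int[leb]_(t in `[a, x]%classic) q t).
  apply: (ae_eq_Rintegral (lmeas_itv _)) => //; first exact: (L1S (lexx a) xb Lp).
  apply: (aeS _ aeZ) => t Zt /=; rewrite in_itv/= => /andP[a_t tx].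
  by rewrite -pq// patchE mem_set//= in_itv/= a_t (le_trans tx).
by rewrite /Rintegral; congr fine; exact: (esym H).
Qed.

Lemma ae_leb (P : set R) : {ae lebesgue_measure, forall x, P x} ->
  {ae leb, forall x, P x}.
Proof. by case=> Z [mZ Z0 sZ]; exists Z; split => //; exact: lmeas. Qed.

Lemma is_derive_itv (u w : R -> R) a b x (dx : R) : x \in `]a, b[ ->
  (forall y, y \in `]a, b[ -> u y = w y) -> derivable u x 1 -> derive1 u x = dx ->
  is_derive x 1 w dx.
Proof.
move=> xab uw du Du; apply: (@near_eq_is_derive _ _ _ u).
  by apply: (filterS _ (near_in_itvoo xab)).
by apply: DeriveDef => //; rewrite -derive1E.
Qed.

(** Lebesgue differentiation, applied to a Borel representative and carried back to [p] outside the
    null set [Z]. *)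
Lemma itg_derive a b p : L1 a b p ->
  {ae leb, forall x, x \in `]a, b[ -> is_derive x 1 (itg p a) (p x)}.
Proof.
move=> Lp; have mD : lset `[a, b]%classic by exact: lmeas_itv.
have mp1 : lebesgue_measurable_fun setT (p \_ `[a, b]).
  exact/(measurable_restrictT _ mD).1/L1_meas.
have [q [mq [Z [mZ Z0 pq]]]] := borel_representative mp1.
have [iq itgE] := itg_borel Lp mq mZ Z0 pq.
have locq : locally_integrable setT q.
  by apply: open_integrable_locally => //; exact: openT.
have iqy y : lebesgue_measure.-integrable [set` Interval (BLeft a) (BRight y)] (EFin \o q).
  by apply: integrableS iq.
have H1 := ae_leb (FTC1 iqy locq).
have aeZ : {ae leb, forall x, ~ Z x}.
  by exists Z; split; [exact: lmeas|exact: Z0|move=> x /= /contrapT].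
apply: (aeS2 _ aeZ H1) => x Zx + /[!in_itv]/= /andP[ax xb].
have axE : (BLeft a < BRight x)%E by rewrite /= lte_fin.
move=> /(_ axE)[dx Dx].
have -> : p x = q x by rewrite -pq// patchE mem_set//= in_itv/= !ltW.
have xab : x \in `]a, b[ by rewrite in_itv/= ax.
apply: (is_derive_itv xab _ dx Dx) => y.
by rewrite in_itv/= => /andP[/ltW ay /ltW yb]; rewrite itgE.
Qed.

End integral_toolbox.

(** * Uniform and absolute continuity *)

Section uniform_continuity.
Context {R : realType}.
Implicit Types (u v p g : R -> R) (a b c x y : R).

(** On a compact interval this amounts to continuity; the uniform [d] is what the subdivision
    arguments use, and restriction to subintervals is immediate. *)
Definition ucont a b u := forall e, 0 < e -> exists2 d, 0 < d &
  forall x y, x \in `[a, b] -> y \in `[a, b] -> `|x - y| < d ->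
    `|u x - u y| < e.

Lemma ucont_within a b u : ucont a b u -> {within `[a, b], continuous u}.
Proof.
move=> uu; apply/subspace_continuousP => x xab.
apply/cvgrPdist_lt => e /uu[d d0 H]; rewrite near_withinE.
apply/nbhs_ballP; exists d => // y /= xy yab.
exact: H.
Qed.

Lemma ucontS a b c d u : a <= c -> d <= b -> ucont a b u -> ucont c d u.
Proof.
move=> ac db uu e /uu[r r0 H]; exists r => // x y.
rewrite !in_itv/= => /andP[x1 x2] /andP[y1 y2]; apply: H; rewrite in_itv/=.
  by rewrite (le_trans ac) ?(le_trans x2).
by rewrite (le_trans ac) ?(le_trans y2).
Qed.

Lemma ucont_meas a b u : ucont a b u -> lebesgue_measurable_fun `[a, b] u.
Proof.
move=> /ucont_within uu; apply: lmeas_fun; first exact: measurable_itv.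
by apply: subspace_continuous_measurable_fun => //; exact: measurable_itv.
Qed.

Lemma ucont_cst a b c : ucont a b (fun=> c).
Proof. by move=> e e0; exists 1 => // x y _ _ _; rewrite subrr normr0. Qed.

Lemma ucontD a b u v : ucont a b u -> ucont a b v ->
  ucont a b (fun x => u x + v x).
Proof.
move=> uu uv e e0; have e20 : 0 < e / 2 by lra.
have [r r0 H] := uu _ e20; have [s s0 K] := uv _ e20.
exists (Num.min r s); first by rewrite lt_min r0.
move=> x y xab yab; rewrite lt_min => /andP[xr xs].
have := H _ _ xab yab xr; have := K _ _ xab yab xs.
move=> h1 h2; rewrite (_ : _ - _ = (u x - u y) + (v x - v y)); last by ring.
by apply: (le_lt_trans (ler_normD _ _)); lra.
Qed.

Lemma ucontN a b u : ucont a b u -> ucont a b (fun x => - u x).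
Proof.
move=> uu e /uu[r r0 H]; exists r => // x y xab yab xy.
by rewrite -opprD normrN; exact: H.
Qed.

Lemma ucont_norm a b u : ucont a b u -> ucont a b (fun x => `|u x|).
Proof.
move=> uu e /uu[r r0 H]; exists r => // x y xab yab xy.
exact: (le_lt_trans (ler_dist_dist _ _) (H _ _ xab yab xy)).
Qed.

Lemma ucont_lip a b u (k : R) :
  (forall x y, x \in `[a, b] -> y \in `[a, b] -> `|u x - u y| <= k * `|x - y|) ->
  ucont a b u.
Proof.
move=> H e e0; exists (e / (`|k| + 1)); first by rewrite divr_gt0// ltr_wpDl.
move=> x y xab yab; rewrite ltr_pdivlMr ?ltr_wpDl// => xy.
apply: (le_lt_trans (H _ _ xab yab)); apply: le_lt_trans xy.
rewrite mulrC ler_wpM2l// (le_trans (ler_norm _))// lerDl//.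
Qed.

Lemma ucont_max a b u : a <= b -> ucont a b u ->
  exists2 x, x \in `[a, b] & forall y, y \in `[a, b] -> u y <= u x.
Proof. by move=> ab /ucont_within cu; exact: EVT_max. Qed.

Lemma ucont_bound a b u : a <= b -> ucont a b u ->
  exists2 B : R, 0 <= B & forall x, x \in `[a, b] -> `|u x| <= B.
Proof.
move=> ab /ucont_norm/(ucont_max ab)[x _ H].
by exists `|u x| => // y; exact: H.
Qed.

Lemma ucontM a b u v : a <= b -> ucont a b u -> ucont a b v ->
  ucont a b (fun x => u x * v x).
Proof.
move=> ab uu uv; have [B B0 uB] := ucont_bound ab uu.
have [C C0 vC] := ucont_bound ab uv.
have C1 : 0 < 2 * (C + 1) by lra.
have B1 : 0 < 2 * (B + 1) by lra.
move=> e e0; have [r r0 H] := uu _ (divr_gt0 e0 C1).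
have [s s0 K] := uv _ (divr_gt0 e0 B1).
exists (Num.min r s); first by rewrite lt_min r0.
move=> x y xab yab; rewrite lt_min => /andP[xr xs].
have := H _ _ xab yab xr; have := K _ _ xab yab xs.
rewrite !ltr_pdivlMr// => h1 h2.
rewrite (_ : _ - _ = u x * (v x - v y) + (u x - u y) * v y); last by ring.
apply: (le_lt_trans (ler_normD _ _)); rewrite !normrM.
have h3 : `|u x| * `|v x - v y| <= B * `|v x - v y| by rewrite ler_wpM2r// uB.
have h4 : `|u x - u y| * `|v y| <= `|u x - u y| * C by rewrite ler_wpM2l// vC.
have := normr_ge0 (v x - v y); have := normr_ge0 (u x - u y).
by move=> n1 n2; nra.
Qed.

Lemma ucont_L1 a b u : a <= b -> ucont a b u -> L1 a b u.
Proof.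
move=> ab uu; have [B B0 uB] := ucont_bound ab uu.
by apply: (@L1_dom _ _ _ _ (fun=> B) (L1_cst _ _ _) (ucont_meas uu)); exact: aeT.
Qed.

Lemma L1Mu a b p u : a <= b -> L1 a b p -> ucont a b u ->
  L1 a b (fun x => p x * u x).
Proof.
move=> ab Lp uu; have [B B0 uB] := ucont_bound ab uu.
exact: (L1M Lp (ucont_meas uu) uB).
Qed.

Lemma itg_sub a b p x y : L1 a b p -> a <= x -> x <= y -> y <= b ->
  itg p a y - itg p a x = itg p x y.
Proof.
move=> Lp ax xy yb; rewrite (@itg_splits _ a x y)//; first by lra.
exact: (L1S (lexx a) yb Lp).
Qed.

Lemma ucont_itg a b p : L1 a b p -> ucont a b (itg p a).
Proof.
move=> Lp e e0; have [r r0 H] := itg_small Lp e0; exists r => // x y.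
wlog xy : x y / y <= x.
  move=> wl xab yab; have [yx|/ltW xy] := leP y x; first exact: wl.
  by rewrite distrC [in X in _ -> X]distrC; exact: wl.
rewrite !in_itv/= => /andP[ax xb] /andP[ay yb].
rewrite ger0_norm ?subr_ge0// => xyr; rewrite (itg_sub Lp)//.
apply: le_lt_trans (H _ _ ay xy xb xyr); apply: le_norm_itg.
exact: (L1S ay xb Lp).
Qed.

End uniform_continuity.

(** * The fundamental theorem of calculus for absolutely continuous functions *)

Section absolute_continuity.
Context {R : realType}.
Local Notation lset A :=
  (@measurable _ (caratheodory_type ((@wlength R idfun)^*)%mu) A).
Implicit Types (u v p g : R -> R) (a b c x y : R).

Lemma leb_pair a b : leb ([set a; b] : set R) = 0%E.
Proof.
exact: (countable_lebesgue_measure0 (finite_set_countable (finite_set2 a b))).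
Qed.

Lemma itg_itvoo a b p : L1 a b p -> \int[leb]_(t in `]a, b[%classic) p t = itg p a b.
Proof.
have mab : measurable ([set a] `|` [set b] : set R) by exact: measurableU.
have -> : `]a, b[%classic = `[a, b]%classic `\` ([set a] `|` [set b]) :> set R.
  apply/seteqP; split=> x /=; rewrite !in_itv/=.
    by move=> /andP[ax xb]; rewrite !ltW//; split => // -[] h; move: ax xb; rewrite h ltxx.
  move=> [/andP[]]; rewrite !le_eqVlt => /predU1P[->|ax] /predU1P[xb|xb].
  - by case; left.
  - by case; left.
  - by case; right.
  - by rewrite ax xb.
apply: (Rintegral_setD0 (lmeas_itv _)) => //; first exact: lmeas.
exact: leb_pair.
Qed.

Lemma itvoo_leb_sum n (l r : 'I_n -> R) : (forall i, l i <= r i) ->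
  trivIset setT (fun i => [set` `]l i, r i[]) ->
  leb (\big[setU/set0]_(i < n) [set` `]l i, r i[]) = (\sum_i (r i - l i))%:E.
Proof.
move=> lr tI; rewrite (@measure_bigsetU_ord _ _ _ leb n predT)//; last first.
  by move=> i; exact: lmeas_itv.
rewrite -sumEFin; apply: eq_bigr => i _.
rewrite -leb_itv//; apply/esym; rewrite !lebE.
rewrite [RHS](_ : _ = lebesgue_measure (`]l i, r i[%classic : set R))//.
by rewrite !lebesgue_measure_itv.
Qed.

Lemma itg_abs_cont a b p : L1 a b p -> abs_continuous a b (itg p a).
Proof.
move=> Lp e e0; have [d d0 H] := itg_abs_continuous Lp e0.
exists d => // n l r lr tI sd.
have lr' i : l i <= r i by have [] := lr i.
have mU : (@measurable _ (caratheodory_type ((@wlength R idfun)^*)%mu)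
    (\big[setU/set0]_(i < n) [set` `]l i, r i[])).
  by apply: bigsetU_measurable => i _; exact: lmeas_itv.
have UD : \big[setU/set0]_(i < n) [set` `]l i, r i[] `<=` `[a, b]%classic.
  apply: (big_ind (fun A : set R => A `<=` `[a, b]%classic)) => //.
    by move=> A B AD BD x [/AD|/BD].
  move=> i _ x /=; rewrite !in_itv/= => /andP[x1 x2]; have [h1 _ h2] := lr i.
  by rewrite (le_trans h1) ?(ltW x1)//= (le_trans (ltW x2)).
have ip : leb.-integrable (\big[setU/set0]_(i < n) [set` `]l i, r i[]) (EFin \o p).
  exact: (integrableS (lmeas_itv _) mU UD Lp).
have := H _ mU UD; rewrite itvoo_leb_sum// lte_fin => /(_ sd).
apply: le_lt_trans.
rewrite Rintegral_bigsetU//; last 2 first.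
- by move=> i; exact: lmeas_itv.
- exact: (integrable_norm ip).
apply: ler_sum => i _; have [h1 h2 h3] := lr i.
rewrite (itg_sub Lp)//.
apply: le_trans (le_norm_itg (L1S h1 h3 Lp)) _.
by rewrite le_eqVlt -(itg_itvoo (L1_norm (L1S h1 h3 Lp))) eqxx.
Qed.

Lemma abs_contB a b u v : abs_continuous a b u -> abs_continuous a b v ->
  abs_continuous a b (fun x => u x - v x).
Proof.
move=> au av e e0; have e20 : 0 < e / 2 by lra.
have [r r0 H] := au _ e20; have [s s0 K] := av _ e20.
exists (Num.min r s); first by rewrite lt_min r0.
move=> n x y xy tI; rewrite lt_min => /andP[/(H _ _ _ xy tI) h1 /(K _ _ _ xy tI) h2].
apply: (@le_lt_trans _ _ (\sum_i `|u (y i) - u (x i)| + \sum_i `|v (y i) - v (x i)|)).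
  rewrite -big_split/=; apply: ler_sum => i _.
  rewrite (_ : _ - _ = (u (y i) - u (x i)) - (v (y i) - v (x i))); last by ring.
  exact: ler_normB.
by lra.
Qed.

Lemma abs_contS a b c d u : a <= c -> d <= b -> abs_continuous a b u ->
  abs_continuous c d u.
Proof.
move=> ac db au e /au[r r0 H]; exists r => // n x y xy; apply: H => i.
have [h1 h2 h3] := xy i; split => //; first exact: le_trans h1.
exact: le_trans h3 _.
Qed.

Lemma abs_cont_ucont a b u : abs_continuous a b u -> ucont a b u.
Proof.
move=> au e /au[r r0 H]; exists r => // x y.
wlog xy : x y / x <= y.
  move=> wl xab yab; have [yx|/ltW xy] := leP x y; first exact: wl.
  by rewrite distrC [in X in _ -> X]distrC; exact: wl.
rewrite !in_itv/= => /andP[ax xb] /andP[ay yb].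
rewrite distrC [in X in _ -> X]distrC ger0_norm ?subr_ge0// => xyr.
have := H 1%N (fun=> x) (fun=> y); rewrite !big_ord1; apply => //.
by move=> i j _ _ _; rewrite !ord1.
Qed.

Lemma is_derive0_le u (e s : R) : is_derive s 1 u 0 -> 0 < e ->
  exists2 d : R, 0 < d & forall y, `|y - s| < d -> `|u y - u s| <= e * `|y - s|.
Proof.
move=> [du Du] e0.
have : (h^-1 *: ((u \o shift s) (h *: 1) - u s)) @[h --> 0^'] --> 'D_1 u s.
  exact: du.
rewrite Du.
move=> /cvgrPdist_lt/(_ _ e0) [d /= d0 K]; exists d => // y ys.
have [->|yns] := eqVneq y s; first by rewrite !subrr !normr0 mulr0.
have := K (y - s); rewrite /= sub0r normrN ys subr_eq0 => /(_ isT yns).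
rewrite sub0r normrN normrZ normfV [_%:A]mulr1 subrK mulrC ltr_pdivrMr ?normr_gt0 ?subr_eq0//.
exact: ltW.
Qed.

(** Listing the intervals from left to right yields disjointness and allows a new one to be appended
    at the right end. *)
Definition itv_family (O : set R) a x n (l r : nat -> R) :=
  (forall i, (i < n)%N -> [/\ a <= l i, l i <= r i, r i <= x &
     [set` `]l i, r i[] `<=` O]) /\
  (forall i j, (i < j < n)%N -> r i <= l j).

Lemma itv_family_triv (O : set R) a x n (l r : nat -> R) :
  itv_family O a x n l r -> trivIset setT (fun i : 'I_n => [set` `]l i, r i[]).
Proof.
move=> [H K] i j _ _ [z [/=]]; rewrite !in_itv/= => /andP[li zi] /andP[lj zj].
apply/val_inj; case: (ltngtP i j) => // ij.
  have := K i j; rewrite ij ltn_ord => /(_ isT) h.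
  by exfalso; clear -h zi lj; lra.
have := K j i; rewrite ij ltn_ord => /(_ isT) h.
by exfalso; clear -h zj li; lra.
Qed.

(* Real induction on [a, b], each point being tagged according to whether the
   derivative vanishes there or it lies in the small open set O. *)
Lemma cover_increment (O : set R) a b u (e : R) : a <= b -> 0 <= e -> open O ->
  (forall x, x \in `[a, b] -> O x \/ is_derive x 1 u 0) -> 0 < e ->
  exists n (l r : nat -> R), itv_family O a b n l r /\
   `|u b - u a| <= e * (b - a) + \sum_(i < n) `|u (r i) - u (l i)|.
Proof.
move=> ab _ oO H e0.
pose P x := exists n (l r : nat -> R), itv_family O a x n l r /\
   `|u x - u a| <= e * (x - a) + \sum_(i < n) `|u (r i) - u (l i)|.
have famS x y n l r : x <= y -> itv_family O a x n l r -> itv_family O a y n l r.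
  move=> xy [F1 F2]; split => // i /F1[h1 h2 h3 h4]; split => //.
  exact: le_trans xy.
have Pa : P a.
  exists 0%N, (fun=> 0), (fun=> 0); split; first by split=> // i j /andP[].
  by rewrite !subrr normr0 mulr0 big_ord0 addr0.
(* A stretch on which [u] varies slowly is charged to the term [e * (x - a)]. *)
have step1 x y : P x -> x <= y -> `|u y - u x| <= e * (y - x) -> P y.
  move=> [n [l [r [F E]]]] xy uxy; exists n, l, r; split; first exact: famS F.
  rewrite (_ : _ - _ = (u y - u x) + (u x - u a)); last by ring.
  apply: (le_trans (ler_normD _ _)); nra.
(* A stretch inside [O] is appended to the family. *)
have step2 x y : P x -> a <= x -> x <= y -> [set` `]x, y[] `<=` O -> P y.
  move=> [n [l [r [F E]]]] ax xy sO.
  exists n.+1, (fun i => if (i < n)%N then l i else x),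
    (fun i => if (i < n)%N then r i else y); split.
    have [F1 F2] := F; split=> [i _|i j /andP[ij jn]].
      case: ifPn => ni; last by split.
      by have [h1 h2 h3 h4] := F1 _ ni; split => //; exact: le_trans xy.
    have ni : (i < n)%N by rewrite (leq_trans ij)// -ltnS.
    rewrite ni; case: ifPn => nj; first by apply: F2; rewrite ij.
    by have [] := F1 _ ni.
  rewrite big_ord_recr/= ltnn (eq_bigr (fun i : 'I_n => `|u (r i) - u (l i)|)).
    rewrite (_ : u y - _ = (u y - u x) + (u x - u a)); last by ring.
    apply: (le_trans (ler_normD _ _)).
    have : 0 <= e * (y - x) by rewrite mulr_ge0 ?subr_ge0// ltW.
    by move: E; set A := `|_|; set B := \sum_i _; set C := `|_|; lra.
  by move=> i _; rewrite ltn_ord.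
have loc s : s \in `[a, b] -> exists2 d, 0 < d & forall x y, a <= x -> P x ->
    s - d < x -> x <= s -> s <= y -> y < s + d -> P y.
  move=> /H[Os|ds].
    have [d /= d0 dO] := (nbhs_ballP s O).1 (open_nbhs_nbhs (conj oO Os)).
    exists d => // x y ax Px x1 xs sy y1; apply: (step2 x) => //.
      exact: le_trans sy.
    move=> z /=; rewrite in_itv/= => /andP[xz zy]; apply: dO.
    by rewrite /ball/= ltr_distlC; apply/andP; split; lra.
  have [d d0 K] : exists2 d, 0 < d &
      forall y, `|y - s| < d -> `|u y - u s| <= e * `|y - s|.
    exact: is_derive0_le.
  exists d => // x y ax Px x1 xs sy y1; apply: (step1 s) => //.
    apply: (step1 x) => //; rewrite distrC (le_trans (K _ _))//.
      by rewrite ler0_norm ?subr_le0//; lra.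
    by rewrite ler0_norm ?subr_le0// opprB.
  apply: (le_trans (K _ _)); first by rewrite ger0_norm ?subr_ge0//; lra.
  by rewrite ger0_norm ?subr_ge0.
pose S := [set x | a <= x <= b /\ P x].
have Sa : S a by split => //; rewrite lexx.
have Sb : has_sup S.
  by split; [exists a|exists b => x [/andP[_]]].
have as_ : a <= sup S by apply: ub_le_sup => //; exact: Sb.2.
have sb : sup S <= b by apply: ge_sup => [|x [/andP[_]]//]; exact: Sb.1.
have [d d0 K] : exists2 d, 0 < d & forall x y, a <= x -> P x ->
    sup S - d < x -> x <= sup S -> sup S <= y -> y < sup S + d -> P y.
  by apply: loc; rewrite in_itv/= as_.
have [x [/andP[ax xb] Px] xd] := sup_adherent d0 Sb.
have xs : x <= sup S by apply: ub_le_sup; [exact: Sb.2|split => //; apply/andP].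
have [sltb|] := ltP (sup S) b; last first.
  move=> bs; have sE : sup S = b by apply/le_anti; rewrite sb.
  by apply: (K x b) => //; rewrite sE ?ltrDl.
pose y := Num.min b (sup S + d / 2).
have y1 : sup S < y by rewrite lt_min sltb ltrDl; lra.
have y2 : y <= b by rewrite ge_min lexx.
have y3 : y <= sup S + d / 2 by rewrite ge_min lexx orbT.
have Sy : S y.
  split; first by apply/andP; split; lra.
  by apply: (K x) => //; lra.
have := ub_le_sup Sb.2 Sy; lra.
Qed.

(** A null set of the completion is contained in a Borel null set, to which outer regularity
    applies. *)
Lemma null_open_cover (N : set R) (e : R) : leb.-negligible N -> 0 < e ->
  exists O : set R, [/\ open O, N `<=` O & (leb O < e%:E)%E].
Proof.
case=> A [mA A0 NA] e0.
have : lset A := mA.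
rewrite -completed_caratheodory_measurable g_sigma_completed_algebra_genE.
case=> B mB [M [Z [mZ Z0 MZ]] BMA].
have mBZ : measurable (B `|` Z) by exact: measurableU.
have BZ0 : lebesgue_measure (B `|` Z) = 0%E.
  apply: (measure_negligible mBZ); apply: negligibleU; last by exists Z; split.
  exists B; split => //; apply/eqP; rewrite -measure_le0 -A0 lebE.
  by apply: le_outer_measure; rewrite -BMA; exact: subsetUl.
have fBZ : (lebesgue_measure (B `|` Z) < +oo)%E by move: BZ0 => /= ->; exact: ltry.
have [U [oU BU U1]] := lebesgue_regularity_outer mBZ fBZ e0.
exists U; split => //.
  apply: (subset_trans NA); rewrite -BMA => x [Bx|/MZ Zx]; apply: BU; [left|right] => //.
rewrite lebE; apply: le_lt_trans U1.
have mU : measurable U by exact: open_measurable.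
rewrite (measureDI lebesgue_measure mU mBZ) -[leRHS]adde0 leeD2l//.
by rewrite -BZ0; apply: le_measure; rewrite ?inE//; exact: measurableI.
Qed.

(** The exceptional points, endpoints included, lie in an open set so small that absolute continuity
    bounds the increments over disjoint intervals inside it by [e]; by [cover_increment] the
    remaining increments add up to at most [e * (b - a)]. *)
Lemma abs_cont_derive0 a b u : a <= b -> abs_continuous a b u ->
  {ae leb, forall x, x \in `]a, b[ -> is_derive x 1 u 0} -> u a = u b.
Proof.
move=> ab au N.
suff H e : 0 < e -> `|u b - u a| <= e * (b - a + 1).
  apply/eqP; rewrite eq_sym -subr_eq0 -normr_le0.
  apply/ler_addgt0Pl => e e0; rewrite addr0.
  have h : 0 < b - a + 1 by lra.
  by apply: (le_trans (H _ (divr_gt0 e0 h))); rewrite divfK// gt_eqF.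
move=> e0; have [d d0 K] := au _ e0.
have nN : leb.-negligible (~` [set x | x \in `]a, b[ -> is_derive x 1 u 0] `|` ([set a] `|` [set b])).
  apply: negligibleU; first exact: N.
  exists [set a; b]; split => //; last exact: leb_pair.
  by apply: lmeas; exact: measurableU.
have [U [oU sNO Od]] := null_open_cover nN d0.
have [|n [l [r [F E]]]] := @cover_increment U a b u e ab (ltW e0) oU _ e0.
  move=> x; rewrite in_itv/= => /andP[]; rewrite !le_eqVlt.
  move=> /predU1P[<-|ax]; first by left; apply: sNO; right; left.
  move=> /predU1P[->|xb]; first by left; apply: sNO; right; right.
  have [|h] := pselect (is_derive x 1 u 0); first by right.
  by left; apply: sNO; left => /=; rewrite in_itv/= ax xb => /(_ isT).
have tI := itv_family_triv F; have [F1 _] := F.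
apply: (le_trans E); rewrite [e * (_ + 1)]mulrDr mulr1 lerD2l ltW//; apply: K => //.
  by move=> i; have [] := F1 i (ltn_ord i).
rewrite -lte_fin -itvoo_leb_sum//; last by move=> i; have [] := F1 i (ltn_ord i).
apply: le_lt_trans Od; rewrite !lebE; apply: le_measure; rewrite ?inE.
- by apply: bigsetU_measurable => i _; exact: measurable_itv.
- exact: open_measurable.
- apply: (big_ind (fun A : set R => A `<=` U)) => //.
    by move=> A B AD BD x [/AD|/BD].
  by move=> i _; have [] := F1 i (ltn_ord i).
Qed.

Lemma abs_cont_FTC a b u p x y : abs_continuous a b u -> L1 a b p ->
  {ae leb, forall x, x \in `]a, b[ -> is_derive x 1 u (p x)} ->
  a <= x -> x <= y -> y <= b -> u y - u x = itg p x y.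
Proof.
move=> au Lp du ax xy yb; rewrite -(itg_sub Lp ax xy yb).
have E : u x - itg p a x = u y - itg p a y.
  apply: (@abs_cont_derive0 x y (fun t => u t - itg p a t) xy).
    apply: (abs_contS ax yb); apply: abs_contB => //; exact: itg_abs_cont.
  apply: (aeS2 _ du (itg_derive Lp)) => t; rewrite !in_itv/=.
  move=> h1 h2 /andP[t1 t2].
  have tab : a < t < b by rewrite (le_lt_trans ax)//= (lt_le_trans t2).
  have {}h1 := h1 tab; have {}h2 := h2 tab.
  by rewrite -(subrr (p t)); apply: is_deriveB.
by clear -E; lra.
Qed.

End absolute_continuity.

(** * Linear differential equations with L^1 coefficients *)

Section integration_by_parts_L1.
Context {R : realType}.
Implicit Types (u v p g k : R -> R) (a b c x y : R).

(** The estimate adds up over adjacent intervals, so it is chained along steps of length [d / 2],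
    which meet the strict bound [< d]. *)
Lemma increment_le_of_small (Phi Psi : R -> R) a b (d : R) : 0 < d ->
  (forall x y, a <= x -> x <= y -> y <= b -> y - x < d ->
    `|Phi y - Phi x| <= Psi y - Psi x) ->
  a <= b -> `|Phi b - Phi a| <= Psi b - Psi a.
Proof.
move=> d0 H ab.
have K n : forall x y, a <= x -> x <= y -> y <= b -> y - x <= n%:R * (d / 2) ->
    `|Phi y - Phi x| <= Psi y - Psi x.
  elim: n => [|n IH] x y ax xy yb; first by rewrite mul0r => h; apply: H => //; lra.
  rewrite -natr1 mulrDl mul1r => h.
  pose z := Num.max x (y - d / 2).
  have xz : x <= z by rewrite le_max lexx.
  have yz : y - d / 2 <= z by rewrite le_max lexx orbT.
  have zy : z <= y by rewrite ge_max xy; lra.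
  have zx : z - x <= n%:R * (d / 2).
    rewrite lerBlDr ge_max; apply/andP; split; last lra.
    by rewrite lerDr mulr_ge0//; lra.
  have h1 := IH x z ax xz (le_trans zy yb) zx.
  have h2 : `|Phi y - Phi z| <= Psi y - Psi z by apply: H => //; lra.
  rewrite (_ : Phi y - _ = (Phi y - Phi z) + (Phi z - Phi x)); last by ring.
  by apply: (le_trans (ler_normD _ _)); lra.
have d2 : 0 < d / 2 by lra.
apply: (K (Num.truncn ((b - a) / (d / 2))).+1) => //.
rewrite -ler_pdivrMr//; apply/ltW.
have := truncn_itv (divr_ge0 (_ : 0 <= b - a) (ltW d2)).
by rewrite subr_ge0 => /(_ ab) /andP[].
Qed.

(** The equation u' = p in integral form: for integrable [p] it encodes absolute continuity and the
    a.e. derivative at once. *)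
Definition primitive a b u p := forall x y, a <= x -> x <= y -> y <= b ->
  u y - u x = itg p x y.

Lemma primitiveS a b c d u p : a <= c -> d <= b -> primitive a b u p ->
  primitive c d u p.
Proof.
move=> ac db H x y cx xy yd; apply: H => //; first exact: le_trans cx.
exact: le_trans db.
Qed.

Lemma primitive_ucont a b u p : L1 a b p -> primitive a b u p -> ucont a b u.
Proof.
move=> Lp up e e0; have [r r0 H] := itg_small Lp e0; exists r => // x y.
wlog xy : x y / y <= x.
  move=> wl xab yab; have [yx|/ltW xy] := leP y x; first exact: wl.
  by rewrite distrC [in X in _ -> X]distrC; exact: wl.
rewrite !in_itv/= => /andP[ax xb] /andP[ay yb].
rewrite ger0_norm ?subr_ge0// => xyr; rewrite up//.
apply: le_lt_trans (H _ _ ay xy xb xyr); apply: le_norm_itg.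
exact: (L1S ay xb Lp).
Qed.

(* The defect [D x y] between the increment of a product and the integral is
   additive in the interval, and bounded by [e * itg (|p| + |q|)] on intervals
   on which both functions oscillate by less than [e]. *)
Lemma primitiveM a b u v p q : L1 a b p -> L1 a b q -> primitive a b u p ->
  primitive a b v q ->
  primitive a b (fun x => u x * v x) (fun x => p x * v x + q x * u x).
Proof.
move=> Lp Lq up vq x y ax xy yb.
have {}Lp := L1S ax yb Lp; have {}Lq := L1S ax yb Lq.
have {}up := primitiveS ax yb up; have {}vq := primitiveS ax yb vq.
have uu := primitive_ucont Lp up; have uv := primitive_ucont Lq vq.
have Lpv := L1Mu xy Lp uv; have Lqu := L1Mu xy Lq uu.
have Lm := L1D Lpv Lqu.
have Ln := L1D (L1_norm Lp) (L1_norm Lq).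
set m := fun t => p t * v t + q t * u t.
set n := fun t => `|p t| + `|q t|.
apply/eqP; rewrite -subr_eq0 -normr_le0; apply/ler_addgt0Pl => e e0; rewrite addr0.
have K0 : 0 <= itg n x y by apply: itg_ge0 => t _; rewrite addr_ge0.
have [d [d0 hd]] : exists d : R, 0 < d /\ d * itg n x y <= e.
  exists (e / (itg n x y + 1)); have h : 0 < itg n x y + 1 by lra.
  split; first exact: divr_gt0.
  by rewrite mulrAC ler_pdivrMr// ler_wpM2l; lra.
have [r r0 H] := uu _ d0; have [s s0 K] := uv _ d0.
have rs0 : 0 < Num.min r s by rewrite lt_min r0.
apply: le_trans hd.
suff key : forall z w, x <= z -> z <= w -> w <= y -> w - z < Num.min r s ->
    `|(u w * v w - itg m x w) - (u z * v z - itg m x z)|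
      <= d * itg n x w - d * itg n x z.
  have := increment_le_of_small rs0 key xy.
  rewrite [itg m x x]itg_aa; last exact: L1S Lm.
  rewrite [itg n x x]itg_aa; last exact: L1S Ln.
  by rewrite subr0 mulr0 subr0 addrAC.
move=> z w xz zw wy; rewrite lt_min => /andP[zwr zws].
rewrite -mulrBr (itg_sub Ln)//.
rewrite (_ : _ - _ = u w * v w - u z * v z - (itg m x w - itg m x z)); last by ring.
rewrite (itg_sub Lm)//.
have {}Lp := L1S xz wy Lp; have {}Lq := L1S xz wy Lq.
have {}Lm := L1S xz wy Lm; have {}Ln := L1S xz wy Ln.
have {}Lpv := L1S xz wy Lpv; have {}Lqu := L1S xz wy Lqu.
(* Freezing [v] at the right end and [u] at the left end turns the increment of the product into an
   exact integral. *)
have E : u w * v w - u z * v z =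
    itg (fun t => v w * p t + u z * q t) z w.
  rewrite itgD ?itgZ//; [|exact: L1Z..].
  by rewrite -up// -vq//; ring.
have L2 : L1 z w (fun t => v w * p t + u z * q t) by apply: L1D; exact: L1Z.
rewrite E -itgB//; apply: (le_trans (le_norm_itg (L1B L2 Lm))).
rewrite -itgZ//; apply: le_itg; [exact/L1_norm/L1B|exact: L1Z|].
apply: aeT => t tzw.
have txy : t \in `[x, y].
  move: tzw; rewrite !in_itv/= => /andP[t1 t2].
  by rewrite (le_trans xz)//= (le_trans t2).
have wxy : w \in `[x, y] by rewrite in_itv/= (le_trans xz).
have zxy : z \in `[x, y] by rewrite in_itv/= xz (le_trans zw).
move: tzw; rewrite in_itv/= => /andP[zt tw].
have h1 : `|u z - u t| <= d.
  by apply/ltW/H => //; rewrite ler0_norm ?subr_le0//; lra.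
have h2 : `|v w - v t| <= d.
  by apply/ltW/K => //; rewrite ger0_norm ?subr_ge0//; lra.
rewrite /m /n (_ : _ - _ = (v w - v t) * p t + (u z - u t) * q t); last by ring.
apply: (le_trans (ler_normD _ _)); rewrite !normrM mulrDr lerD// ler_wpM2r//.
Qed.

End integration_by_parts_L1.

Section gronwall.
Context {R : realType}.
Implicit Types (u v p g k : R -> R) (a b c x y : R).

(** Where the integral of [k] is below 1/2, [E] oscillates by at most half its maximum, so its
    values agree within a factor 2. Chaining [N] such intervals gives [2 ^+ N], which depends on [k]
    alone and works in both directions. *)
Lemma gronwall a b k : a <= b -> L1 a b k -> (forall x, x \in `[a, b] -> 0 <= k x) ->
  exists2 C : R, 0 <= C & forall E, ucont a b E ->
    (forall x, x \in `[a, b] -> 0 <= E x) ->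
    (forall x y, a <= x -> x <= y -> y <= b ->
      `|E y - E x| <= itg (fun t => k t * E t) x y) ->
    forall x y, x \in `[a, b] -> y \in `[a, b] -> E x <= C * E y.
Proof.
move=> ab Lk k0; have h2 : (0 : R) < 1 / 2 by lra.
have [d d0 H] := itg_small Lk h2.
have d2 : 0 < d / 2 by lra.
pose N := (Num.truncn ((b - a) / (d / 2))).+1.
exists (2 ^+ N); first by rewrite exprn_ge0.
move=> E uE E0 EH.
have loc x y : a <= x -> x <= y -> y <= b -> y - x < d ->
    E x <= 2 * E y /\ E y <= 2 * E x.
  move=> ax xy yb xyd.
  have [z zxy zmax] := ucont_max xy (ucontS ax yb uE).
  have inab w : w \in `[x, y] -> w \in `[a, b].
    by rewrite !in_itv/= => /andP[? ?]; apply/andP; split; lra.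
  have Em0 : 0 <= E z by exact/E0/inab.
  have small w w' : w \in `[x, y] -> w' \in `[x, y] -> w <= w' ->
      `|E w' - E w| <= E z / 2.
    rewrite !in_itv/= => /andP[w1 w2] /andP[w3 w4] ww.
    have aw : a <= w by lra.
    have wb : w' <= b by lra.
    apply: (le_trans (EH _ _ aw ww wb)).
    have Lk' := L1S aw wb Lk.
    apply: (@le_trans _ _ (itg (fun t => E z * `|k t|) w w')).
      apply: le_itg; [|exact/L1Z/L1_norm|].
        exact: (L1Mu ww Lk' (ucontS aw wb uE)).
      apply: aeT => t; rewrite in_itv/= => /andP[t1 t2].
      have txy : t \in `[x, y] by rewrite in_itv/=; apply/andP; split; lra.
      rewrite ger0_norm ?k0 ?inab// mulrC ler_wpM2r ?k0 ?inab//.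
      exact: zmax.
    rewrite itgZ; last exact: L1_norm.
    rewrite ler_wpM2l// ltW//.
    have wd : w' - w < d by lra.
    by have := H _ _ aw ww wb wd; lra.
  have mx w : w \in `[x, y] -> E z <= 2 * E w.
    move=> wxy; have [zw|/ltW wz] := leP z w.
      by have := small _ _ zxy wxy zw; rewrite ler_norml => /andP[]; lra.
    by have := small _ _ wxy zxy wz; rewrite ler_norml => /andP[]; lra.
  have xin : x \in `[x, y] by rewrite in_itv/= lexx.
  have yin : y \in `[x, y] by rewrite in_itv/= lexx andbT.
  have := mx _ xin; have := mx _ yin; have := zmax _ xin; have := zmax _ yin.
  by split; lra.
have K n : forall x y, a <= x -> x <= y -> y <= b -> y - x <= n%:R * (d / 2) ->
    E x <= 2 ^+ n * E y /\ E y <= 2 ^+ n * E x.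
  elim: n => [|n IH] x y ax xy yb.
    rewrite mul0r expr0 !mul1r => h.
    by have -> : x = y by apply/le_anti; rewrite xy; lra.
  rewrite -natr1 mulrDl mul1r => h.
  pose z := Num.max x (y - d / 2).
  have xz : x <= z by rewrite le_max lexx.
  have yz : y - d / 2 <= z by rewrite le_max lexx orbT.
  have zy : z <= y by rewrite ge_max xy; lra.
  have zx : z - x <= n%:R * (d / 2).
    rewrite lerBlDr ge_max; apply/andP; split; last lra.
    by rewrite lerDr mulr_ge0//; lra.
  have [h1 h1'] := IH x z ax xz (le_trans zy yb) zx.
  have [|g1 g2] := loc z y (le_trans ax xz) zy yb; first lra.
  have n0 : (0 : R) <= 2 ^+ n by rewrite exprn_ge0.
  rewrite exprS; split; first by nra.
  by nra.
have hN x y : x \in `[a, b] -> y \in `[a, b] -> y - x <= N%:R * (d / 2).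
  rewrite !in_itv/= => /andP[x1 x2] /andP[y1 y2].
  apply: (@le_trans _ _ (b - a)); first lra.
  rewrite -ler_pdivrMr//; apply/ltW.
  have := truncn_itv (divr_ge0 (_ : 0 <= b - a) (ltW d2)).
  by rewrite subr_ge0 => /(_ ab) /andP[].
move=> x y xab yab; have h := hN _ _ xab yab; have h' := hN _ _ yab xab.
move: (xab) (yab); rewrite !in_itv/= => /andP[x1 x2] /andP[y1 y2].
have [xy|/ltW yx] := leP x y.
  by have [] := K N x y x1 xy y2 h.
by have [] := K N y x y1 yx x2 h'.
Qed.

End gronwall.

Section ode.
Context {R : realType}.
Implicit Types (u v p q g k : R -> R) (a b c d x y : R).

(** The system u' = v, v' = - p; [p] stands for the nonlinearity evaluated along [u]. *)
Definition ode a b u v p :=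
  [/\ L1 a b p, primitive a b u v & primitive a b v (fun x => - p x)].

Lemma odeS a b c d u v p : a <= c -> d <= b -> ode a b u v p -> ode c d u v p.
Proof.
move=> ac db [Lp uv vp]; split; [exact: L1S Lp|exact: primitiveS uv|].
exact: primitiveS vp.
Qed.

Lemma ode_ucontv a b u v p : ode a b u v p -> ucont a b v.
Proof. by case=> Lp _; exact/primitive_ucont/L1N. Qed.

Lemma ode_ucontu a b u v p : a <= b -> ode a b u v p -> ucont a b u.
Proof.
move=> ab H; have uv := ode_ucontv H; case: H => _ + _.
exact/primitive_ucont/ucont_L1.
Qed.

Lemma primitive_abs_cont a b u p : L1 a b p -> primitive a b u p ->
  abs_continuous a b u.
Proof.
move=> Lp up e e0; have [d d0 H] := itg_abs_cont Lp e0; exists d => // n l r lr tI ld.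
have := H n l r lr tI ld; congr (_ < _); apply: eq_bigr => i _.
by have [h1 h2 h3] := lr i; rewrite (itg_sub Lp)// up.
Qed.

Lemma is_derive_eps u x (du : R) :
  (forall e, 0 < e -> exists2 d : R, 0 < d & forall y, `|y - x| < d ->
    `|u y - u x - du * (y - x)| <= e * `|y - x|) -> is_derive x 1 u du.
Proof.
move=> H.
have C : (h^-1 *: ((u \o shift x) (h *: 1) - u x)) @[h --> 0^'] --> du.
  apply/cvgrPdist_le => e /H[d d0 K].
  exists d => //= h /=; rewrite sub0r normrN => hd h0.
  have := K (h + x); rewrite addrK => /(_ hd) => h1.
  rewrite [_%:A]mulr1 -(ler_pM2r (_ : 0 < `|h|)) ?normr_gt0// -normrM.
  rewrite mulrBl -[_ *: _ * _]/(h^-1 * _ * h) mulrAC mulVf// mul1r.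
  by rewrite distrC.
by apply: DeriveDef; [apply/cvg_ex; exists du|exact: cvg_lim C].
Qed.

Lemma primitive_derive a b u v x : primitive a b u v -> ucont a b v ->
  x \in `]a, b[ -> is_derive x 1 u (v x).
Proof.
move=> uv cv; rewrite in_itv/= => /andP[ax xb]; apply: is_derive_eps => e e0.
have ab : a <= b by lra.
have Lv := ucont_L1 ab cv.
have [d d0 H] := cv _ e0.
have m0 : 0 < Num.min d (Num.min (x - a) (b - x)).
  by rewrite !lt_min d0/=; apply/andP; split; lra.
exists (Num.min d (Num.min (x - a) (b - x))) => // y.
rewrite !lt_min => /and3P[yd ya yb].
have key s t : a <= s -> s <= t -> t <= b ->
    (forall w, s <= w -> w <= t -> `|v w - v x| <= e) ->
    `|u t - u s - v x * (t - s)| <= e * (t - s).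
  move=> as_ st tb K; rewrite uv//; have Lv' := L1S as_ tb Lv.
  rewrite -[v x * _]itg_cst// -[e * _]itg_cst// -itgB//; last exact: L1_cst.
  have L2 : L1 s t (fun w => v w - v x) by apply: L1B => //; exact: L1_cst.
  apply: (le_trans (le_norm_itg L2)); apply: le_itg; [exact: L1_norm|exact: L1_cst|].
  by apply: aeT => w; rewrite in_itv/= => /andP[]; exact: K.
have vx w : `|w - x| < d -> a <= w -> w <= b -> `|v w - v x| <= e.
  by move=> wd aw wb; apply/ltW/H => //; rewrite in_itv/= ?aw// !ltW.
have [xy|/ltW yx] := leP x y.
  move: yd yb; rewrite ger0_norm ?subr_ge0// => yd yb.
  apply: key; [lra|lra|lra|] => w xw wy; apply: vx; [|lra|lra].
  by rewrite ger0_norm ?subr_ge0//; lra.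
move: yd ya; rewrite ler0_norm ?subr_le0// => yd ya.
rewrite (_ : u y - u x - _ = - (u x - u y - v x * (x - y))); last by ring.
rewrite normrN opprB; apply: key; [lra|lra|lra|] => w yw wx; apply: vx; [|lra|lra].
by rewrite ler0_norm ?subr_le0//; lra.
Qed.

Lemma ode_dirichlet a b (F : R -> R -> R) u v p : a <= b -> ode a b u v p ->
  u a = 0 -> u b = 0 ->
  {ae leb, forall x, x \in `[a, b] -> p x = F x (u x)} ->
  dirichlet_solution a b F u.
Proof.
move=> ab H ua ub pF; have cv := ode_ucontv H; have Lv := ucont_L1 ab cv.
case: H => Lp uv vp; split => //; first exact: (primitive_abs_cont Lv uv).
exists v; split.
- exact: (primitive_abs_cont (L1N Lp) vp).
- by move=> x; exact: primitive_derive.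
- apply: (aeS2 _ pF (itg_derive (L1N Lp))) => x px + xab => /(_ xab) h.
  have xab' : x \in `[a, b] by move: xab; rewrite !in_itv/= => /andP[/ltW -> /ltW ->].
  have [dv Dv] : is_derive x 1 v (- p x).
    have [h1 h2] := h.
    have h3 : is_derive x 1 (fun x => v a + itg (fun x => - p x) a x) (0 + - p x).
      exact: is_deriveD.
    have [h4 h5] := h3.
    apply: (is_derive_itv xab _ h4); last by rewrite derive1E h5 add0r.
    move=> y; rewrite in_itv/= => /andP[/ltW ay /ltW yb].
    by rewrite -(vp a y)//; ring.
  by split => //; rewrite Dv px// addNr.
Qed.

Lemma dirichlet_ode a b (F : R -> R -> R) u : a <= b ->
  dirichlet_solution a b F u -> L1 a b (fun x => F x (u x)) ->
  exists v, ode a b u v (fun x => F x (u x)).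
Proof.
move=> ab [au [v [av du dv]] _ _] Lp; exists v.
have cv := abs_cont_ucont av; have Lv := ucont_L1 ab cv.
split => // x y ax xy yb.
  by apply: (abs_cont_FTC au Lv _ ax xy yb); exact: aeT.
apply: (abs_cont_FTC av (L1N Lp) _ ax xy yb).
apply: (aeS _ dv) => t h /h[d1 d2]; apply: DeriveDef => //.
by apply/eqP; rewrite -addr_eq0 d2.
Qed.

(* Gronwall for the pair (u, u') with E = |u| + |u'|. *)
Lemma ode_gronwall a b g : a <= b -> L1 a b g ->
  (forall x, x \in `[a, b] -> 0 <= g x) ->
  exists2 C : R, 0 <= C & forall u v p, ode a b u v p ->
    {ae leb, forall x, x \in `[a, b] -> `|p x| <= g x * `|u x|} ->
    forall x y, x \in `[a, b] -> y \in `[a, b] ->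
      `|u x| + `|v x| <= C * (`|u y| + `|v y|).
Proof.
move=> ab Lg g0.
have Lk : L1 a b (fun x => 1 + g x) by apply: L1D => //; exact: L1_cst.
have k0 x : x \in `[a, b] -> 0 <= 1 + g x by move=> /g0; lra.
have [C C0 HC] := gronwall ab Lk k0; exists C => // u v p H pg.
have cv := ode_ucontv H; have cu := ode_ucontu ab H.
have cE : ucont a b (fun x => `|u x| + `|v x|) by apply: ucontD; exact: ucont_norm.
apply: (HC (fun x => `|u x| + `|v x|)) => //.
move=> x y ax xy yb; case: H => Lp uv vp.
have {}Lp := L1S ax yb Lp; have {}Lk := L1S ax yb Lk.
have {}cE := ucontS ax yb cE; have {}cv := ucontS ax yb cv.
have {}cu := ucontS ax yb cu; have Lv := ucont_L1 xy cv.
have Lg' := L1S ax yb Lg.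
have h1 : `|u y - u x| <= itg (fun t => `|v t|) x y by rewrite uv//; exact: le_norm_itg.
have h2 : `|v y - v x| <= itg (fun t => g t * `|u t|) x y.
  rewrite vp//; apply: (le_trans (le_norm_itg (L1N Lp))).
  apply: le_itg; [exact/L1_norm/L1N|exact: (L1Mu xy Lg' (ucont_norm cu))|].
  apply: (aeS _ pg) => t h; rewrite in_itv/= => /andP[xt ty]; rewrite normrN.
  by apply: h; rewrite in_itv/=; apply/andP; split; lra.
apply: (@le_trans _ _ (`|u y - u x| + `|v y - v x|)).
  rewrite (_ : _ - _ = (`|u y| - `|u x|) + (`|v y| - `|v x|)); last by ring.
  by apply: (le_trans (ler_normD _ _)); rewrite lerD// ler_dist_dist.
apply: (le_trans (lerD h1 h2)).
have Lgu := L1Mu xy Lg' (ucont_norm cu).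
rewrite -itgD//; last exact: L1_norm.
apply: le_itg; [by apply: L1D => //; exact: L1_norm|exact: (L1Mu xy Lk cE)|].
apply: aeT => t; rewrite in_itv/= => /andP[xt ty].
have gt0 : 0 <= g t by apply: g0; rewrite in_itv/=; apply/andP; split; lra.
rewrite mulrDl mul1r mulrDr.
have := normr_ge0 (u t); have := mulr_ge0 gt0 (normr_ge0 (v t)); lra.
Qed.

(** A negative slope at [a] would stay below [v a / 2] for a while and push [u] under [u a]. *)
Lemma primitive_sign_l a b u v : a < b -> primitive a b u v -> ucont a b v ->
  (forall x, x \in `]a, b[ -> u a <= u x) -> 0 <= v a.
Proof.
move=> ab uv cv H; rewrite leNgt; apply/negP => va.
have va2 : 0 < - v a / 2 by lra.
have [d d0 K] := cv _ va2.
pose x := a + Num.min (d / 2) ((b - a) / 2).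
have m1 : Num.min (d / 2) ((b - a) / 2) <= d / 2 by rewrite ge_min lexx.
have m2 : Num.min (d / 2) ((b - a) / 2) <= (b - a) / 2 by rewrite ge_min lexx orbT.
have m3 : 0 < Num.min (d / 2) ((b - a) / 2) by rewrite lt_min; apply/andP; split; lra.
have ax : a < x by rewrite /x; lra.
have xb : x < b by rewrite /x; lra.
have xd : x < a + d by rewrite /x; lra.
have := H x; rewrite in_itv/= ax xb => /(_ isT).
have := uv _ _ (lexx a) (ltW ax) (ltW xb).
have : itg v a x <= itg (fun=> v a / 2) a x.
  have Lv := L1S (lexx a) (ltW xb) (ucont_L1 (ltW ab) cv).
  apply: le_itg => //; first exact: L1_cst.
  apply: aeT => t; rewrite in_itv/= => /andP[a_t tx].
  have := K t a; rewrite !in_itv/= lexx a_t/= (ltW ab) (le_trans tx (ltW xb)).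
  rewrite ger0_norm ?subr_ge0// => /(_ isT isT) h.
  have {}h : `|v t - v a| < - v a / 2 by apply: h; lra.
  by move: h; rewrite ltr_norml => /andP[]; lra.
rewrite itg_cst; last exact: ltW.
move=> h1 h2 h3.
have : v a * (x - a) < 0 by rewrite nmulr_rlt0 ?subr_gt0.
by lra.
Qed.

Lemma primitive_sign_r a b u v : a < b -> primitive a b u v -> ucont a b v ->
  (forall x, x \in `]a, b[ -> u b <= u x) -> v b <= 0.
Proof.
move=> ab uv cv H; rewrite leNgt; apply/negP => vb.
have vb2 : 0 < v b / 2 by lra.
have [d d0 K] := cv _ vb2.
pose x := b - Num.min (d / 2) ((b - a) / 2).
have m1 : Num.min (d / 2) ((b - a) / 2) <= d / 2 by rewrite ge_min lexx.
have m2 : Num.min (d / 2) ((b - a) / 2) <= (b - a) / 2 by rewrite ge_min lexx orbT.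
have m3 : 0 < Num.min (d / 2) ((b - a) / 2) by rewrite lt_min; apply/andP; split; lra.
have xb : x < b by rewrite /x; lra.
have ax : a < x by rewrite /x; lra.
have xd : b - d < x by rewrite /x; lra.
have := H x; rewrite in_itv/= ax xb => /(_ isT).
have := uv _ _ (ltW ax) (ltW xb) (lexx b).
have : itg (fun=> v b / 2) x b <= itg v x b.
  have Lv := L1S (ltW ax) (lexx b) (ucont_L1 (ltW ab) cv).
  apply: le_itg => //; first exact: L1_cst.
  apply: aeT => t; rewrite in_itv/= => /andP[xt tb].
  have := K t b; rewrite !in_itv/= lexx tb/= (ltW ab) (le_trans (ltW ax) xt).
  rewrite ler0_norm ?subr_le0// => /(_ isT isT) h.
  have {}h : `|v t - v b| < v b / 2 by apply: h; lra.
  by move: h; rewrite ltr_norml => /andP[]; lra.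
rewrite itg_cst; last exact: ltW.
move=> h1 h2 h3.
have : 0 < v b * (b - x) by rewrite pmulr_rgt0 ?subr_gt0.
by lra.
Qed.

(** Lagrange's identity: in the derivative of [v y - u z] the products [v z] cancel. *)
Lemma ode_green a b u v p (y z r : R -> R) : a <= b -> ode a b u v p -> ode a b y z r ->
  v b * y b - u b * z b - (v a * y a - u a * z a) =
  itg (fun t => r t * u t - p t * y t) a b.
Proof.
move=> ab H1 H2.
have cv := ode_ucontv H1; have cz := ode_ucontv H2.
have cu := ode_ucontu ab H1; have cy := ode_ucontu ab H2.
have Lv := ucont_L1 ab cv; have Lz := ucont_L1 ab cz.
case: H1 => Lp uv vp; case: H2 => Lr yz zr.
have E1 := primitiveM (L1N Lp) Lz vp yz (lexx a) ab (lexx b).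
have E2 := primitiveM Lv (L1N Lr) uv zr (lexx a) ab (lexx b).
rewrite (_ : _ - _ - _ = (v b * y b - v a * y a) - (u b * z b - u a * z a)); last by ring.
rewrite E1 E2 -itgB; last 2 first.
- by apply: L1D; [exact: L1Mu (L1N Lp) cy|exact: L1Mu Lz cv].
- by apply: L1D; [exact: L1Mu Lv cz|exact: L1Mu (L1N Lr) cu].
by congr (itg _ a b); apply/funext => t; ring.
Qed.

End ode.

(** * Comparison with eigenfunctions *)

Section comparison.
Context {R : realType}.
Implicit Types (u v p q g k phi psi : R -> R) (a b c d x y : R).

Lemma last_zero_before a b phi : a <= b -> ucont a b phi -> phi a <= 0 ->
  0 < phi b -> exists c, [/\ a <= c, c < b, phi c = 0 &
    forall x, c < x -> x <= b -> 0 < phi x].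
Proof.
move=> ab cp pa pb.
pose S := [set x | a <= x <= b /\ phi x <= 0].
have Sb : has_sup S.
  split; last by exists b => x [/andP[_]].
  by exists a; split => //; rewrite lexx.
have Sin x : a <= x -> x <= b -> phi x <= 0 -> x <= sup S.
  move=> ax xb px; apply: ub_le_sup; first exact: Sb.2.
  by split=> //; apply/andP.
have as_ : a <= sup S by exact: Sin.
have sb : sup S <= b by apply: ge_sup => [|x [/andP[_]]//]; exact: Sb.1.
have sin : sup S \in `[a, b] by rewrite in_itv/= as_.
have ps : phi (sup S) <= 0.
  rewrite leNgt; apply/negP => ps; have [d d0 K] := cp _ ps.
  have [x [/andP[ax xb] px] xd] := sup_adherent d0 Sb.
  have xs := Sin _ ax xb px.
  have := K (sup S) x sin; rewrite in_itv/= ax xb ger0_norm ?subr_ge0//.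
  move=> /(_ isT) h; have {}h : `|phi (sup S) - phi x| < phi (sup S) by apply: h; lra.
  by move: h; rewrite ltr_norml => /andP[]; lra.
have sltb : sup S < b.
  rewrite lt_neqAle sb andbT; apply/eqP => E; move: ps; rewrite E; lra.
have pos x : sup S < x -> x <= b -> 0 < phi x.
  move=> sx xb; rewrite ltNge; apply/negP => px.
  by have := Sin x (le_trans as_ (ltW sx)) xb px; lra.
exists (sup S); split => //; apply/le_anti; rewrite ps/= leNgt; apply/negP => ps'.
have Np : 0 < - phi (sup S) by lra.
have [d d0 K] := cp _ Np.
pose x := Num.min b (sup S + d / 2).
have x1 : sup S < x by rewrite lt_min sltb ltrDl; lra.
have x2 : x <= b by rewrite ge_min lexx.
have x3 : x <= sup S + d / 2 by rewrite ge_min lexx orbT.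
have := K x (sup S); rewrite !in_itv/= x2 as_ sb (le_trans as_ (ltW x1)).
rewrite ger0_norm ?subr_ge0 ?ltW// => /(_ isT isT) h.
have {}h : `|phi x - phi (sup S)| < - phi (sup S) by apply: h; lra.
by have := pos x x1 x2; move: h; rewrite ltr_norml => /andP[]; lra.
Qed.

Lemma first_zero_after a b phi : a <= b -> ucont a b phi -> 0 < phi a ->
  phi b <= 0 -> exists d, [/\ a < d, d <= b, phi d = 0 &
    forall x, a <= x -> x < d -> 0 < phi x].
Proof.
move=> ab cp pa pb.
have [|||| c [h1 h2 h3 h4]] := @last_zero_before (- b) (- a) (fun x => phi (- x)).
- by rewrite lerN2.
- move=> e /cp[d d0 K]; exists d => // x y; rewrite !in_itv/= => /andP[x1 x2] /andP[y1 y2] xy.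
  apply: K; rewrite ?in_itv/=; [apply/andP; split; lra..|].
  by rewrite -normrN opprB opprK addrC.
- by rewrite opprK.
- by rewrite opprK.
exists (- c); split => //; [lra|lra|] => x ax xc.
by rewrite -(opprK x); apply: h4; lra.
Qed.

(** The arc is the component of {phi > 0} around [x0]. The signs of [psi] at its ends are those that
    make the boundary terms of Green's identity nonnegative when tested against a nonnegative
    function. *)
Lemma positive_arc a b phi psi p x0 : a <= b -> ode a b phi psi p ->
  phi a <= 0 -> phi b <= 0 -> x0 \in `[a, b] -> 0 < phi x0 ->
  exists c d, [/\ [/\ a <= c, c < d & d <= b], [/\ phi c = 0 & phi d = 0],
    forall x, x \in `]c, d[ -> 0 < phi x, 0 <= psi c & psi d <= 0].
Proof.
move=> ab H pa pb; rewrite in_itv/= => /andP[ax0 x0b] p0.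
have cp := ode_ucontu ab H; have cs := ode_ucontv H.
have [c [c1 c2 c3 c4]] := last_zero_before ax0 (ucontS (lexx a) x0b cp) pa p0.
have [d [d1 d2 d3 d4]] := first_zero_after x0b (ucontS ax0 (lexx b) cp) p0 pb.
have cd : c < d by exact: lt_trans d1.
have pos x : x \in `]c, d[ -> 0 < phi x.
  rewrite in_itv/= => /andP[cx xd]; have [xx|/ltW xx] := leP x x0; first exact: c4.
  exact: d4.
have [_ Hp _] := odeS c1 d2 H.
exists c, d; split => //.
- by apply: (primitive_sign_l cd Hp (ucontS c1 d2 cs)) => x /pos/ltW; rewrite c3.
- by apply: (primitive_sign_r cd Hp (ucontS c1 d2 cs)) => x /pos/ltW; rewrite d3.
Qed.

(** Since [p >= 0], [u] is concave and lies above the triangle with apex at [x1]. The parabola below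
    that triangle is used instead because its shape does not depend on [x1]. *)
Lemma concave_bump a b u v p x1 x : a < b -> ode a b u v p ->
  (forall x, x \in `[a, b] -> 0 <= u x) ->
  {ae leb, forall x, x \in `[a, b] -> 0 <= p x} ->
  x1 \in `[a, b] -> x \in `[a, b] ->
  u x1 * ((x - a) * (b - x)) <= u x * (b - a) ^+ 2.
Proof.
move=> ab H u0 p0.
have cv := ode_ucontv H; have [Lp uv vp] := H.
have vd s t : a <= s -> s <= t -> t <= b -> v t <= v s.
  move=> as_ st tb; rewrite -subr_le0 vp//.
  rewrite (_ : 0 = itg (fun=> 0) s t); last by rewrite itg_cst// mul0r.
  apply: le_itg; [exact/L1N/(L1S as_ tb)|exact: L1_cst|].
  apply: (aeS _ p0) => w h; rewrite in_itv/= => /andP[sw wt]; rewrite oppr_le0.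
  by apply: h; rewrite in_itv/=; apply/andP; split; lra.
have concave s t w : a <= s -> s <= t -> t <= w -> w <= b ->
    u s * (w - t) + u w * (t - s) <= u t * (w - s).
  move=> as_ st tw wb.
  have h1 : v t * (t - s) <= u t - u s.
    rewrite uv//; last by lra.
    rewrite -itg_cst//; apply: le_itg; [exact: L1_cst| |].
      by apply: ucont_L1 => //; apply: ucontS cv; lra.
    by apply: aeT => z; rewrite in_itv/= => /andP[sz zt]; apply: vd; lra.
  have h2 : u w - u t <= v t * (w - t).
    rewrite uv//; last by lra.
    rewrite -itg_cst//; apply: le_itg; [|exact: L1_cst|].
      by apply: ucont_L1 => //; apply: ucontS cv; lra.
    by apply: aeT => z; rewrite in_itv/= => /andP[sz zt]; apply: vd; lra.
  have g1 : v t * (t - s) * (w - t) <= (u t - u s) * (w - t).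
    by rewrite ler_wpM2r//; lra.
  have g2 : (u w - u t) * (t - s) <= v t * (w - t) * (t - s).
    by rewrite ler_wpM2r//; lra.
  by nra.
rewrite !in_itv/= => /andP[ax1 x1b] /andP[ax xb].
have ua : 0 <= u a by apply: u0; rewrite in_itv/= lexx ltW.
have ub : 0 <= u b by apply: u0; rewrite in_itv/= lexx ltW.
have ux : 0 <= u x by apply: u0; rewrite in_itv/= ax.
have ux1 : 0 <= u x1 by apply: u0; rewrite in_itv/= ax1.
have [xx|/ltW xx] := leP x x1.
  have h := concave _ _ _ (lexx a) ax xx x1b.
  have h1 : 0 <= u a * (x1 - x) by rewrite mulr_ge0//; lra.
  have h2 : u x1 * (x - a) <= u x * (b - a).
    by apply: (@le_trans _ _ (u x * (x1 - a))); [lra|rewrite ler_wpM2l//; lra].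
  have h3 : u x1 * (x - a) * (b - x) <= u x * (b - a) * (b - x).
    by rewrite ler_wpM2r//; lra.
  have h4 : u x * (b - a) * (b - x) <= u x * (b - a) * (b - a).
    by rewrite ler_wpM2l ?mulr_ge0//; lra.
  by rewrite expr2 !mulrA; lra.
have h := concave _ _ _ ax1 xx xb (lexx b).
have h1 : 0 <= u b * (x - x1) by rewrite mulr_ge0//; lra.
have h2 : u x1 * (b - x) <= u x * (b - a).
  by apply: (@le_trans _ _ (u x * (b - x1))); [lra|rewrite ler_wpM2l//; lra].
have h3 : u x1 * (b - x) * (x - a) <= u x * (b - a) * (x - a).
  by rewrite ler_wpM2r//; lra.
have h4 : u x * (b - a) * (x - a) <= u x * (b - a) * (b - a).
  by rewrite ler_wpM2l ?mulr_ge0//; lra.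
by rewrite expr2 [(x - a) * _]mulrC !mulrA; lra.
Qed.

Lemma arc_ge0 c d phi : phi c = 0 -> phi d = 0 ->
  (forall x, x \in `]c, d[ -> 0 < phi x) ->
  forall x, x \in `[c, d] -> 0 <= phi x.
Proof.
move=> pc pd p0 x; rewrite in_itv/= => /andP[cx xd].
have [->|xc] := eqVneq x c; first by rewrite pc.
have [->|xnd] := eqVneq x d; first by rewrite pd.
by apply/ltW/p0; rewrite in_itv/= !lt_neqAle cx xd xnd eq_sym xc.
Qed.

(** If the integral vanished, [q * phi] would be 0 a.e. on the arc, so [phi] would be affine; being
    0 at both ends, it would be 0 throughout. *)
Lemma eigen_weight_gt0 c d phi psi q (rho : R -> R) (mu : R) : c < d ->
  ode c d phi psi (fun x => mu * q x * phi x) -> phi c = 0 -> phi d = 0 ->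
  L1 c d q -> (forall x, x \in `[c, d] -> 0 <= q x) ->
  (forall x, x \in `]c, d[ -> 0 < phi x) ->
  ucont c d rho -> (forall x, x \in `[c, d] -> 0 <= rho x) ->
  (forall x, x \in `]c, d[ -> 0 < rho x) ->
  0 < itg (fun x => q x * (phi x * rho x)) c d.
Proof.
move=> cd H pc pd Lq q0 p0 cr r0 r0'.
have cp := ode_ucontu (ltW cd) H.
have Lw : L1 c d (fun x => q x * (phi x * rho x)).
  exact: (L1Mu (ltW cd) Lq (ucontM (ltW cd) cp cr)).
have phi0 := arc_ge0 pc pd p0.
rewrite ltNge; apply/negP => le0.
have /(int0_ae Lw)/(_ le0) qz : forall x, x \in `[c, d] -> 0 <= q x * (phi x * rho x).
  by move=> x xcd; rewrite mulr_ge0 ?q0// mulr_ge0 ?phi0 ?r0.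
have [Lp ps sp] := H.
have pz : {ae leb, forall x, x \in `[c, d] -> - (mu * q x * phi x) = 0}.
  apply: (aeS _ qz) => x h xcd; move/eqP: (h xcd); rewrite mulf_eq0.
  have [->|qx] := eqVneq (q x) 0; first by rewrite mulr0 mul0r oppr0.
  have [->|px] := eqVneq (phi x) 0; first by rewrite mulr0 oppr0.
  rewrite mulf_eq0 (negbTE px)/= => /eqP rx; exfalso.
  move: xcd; rewrite in_itv/= => /andP[]; rewrite !le_eqVlt.
  move=> /predU1P[cx|cx]; first by move: px; rewrite -cx pc eqxx.
  move=> /predU1P[xd|xd]; first by move: px; rewrite xd pd eqxx.
  by have := r0' x; rewrite in_itv/= cx xd rx ltxx => /(_ isT).
have sc x : x \in `[c, d] -> psi x = psi c.
  rewrite in_itv/= => /andP[cx xd]; apply/eqP; rewrite -subr_eq0 sp//.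
  rewrite (@eq_itg _ _ _ _ (fun=> 0)) ?itg_cst ?mul0r//.
  - exact/L1N/(L1S (lexx c) xd).
  - exact: L1_cst.
  - apply: (aeS _ pz) => t h; rewrite in_itv/= => /andP[ct tx]; apply: h.
    by rewrite in_itv/= ct (le_trans tx).
have E x : x \in `[c, d] -> phi x = psi c * (x - c).
  rewrite in_itv/= => /andP[cx xd].
  rewrite -[LHS]subr0 -pc ps// -itg_cst//; apply: eq_itg; [|exact: L1_cst|].
    by apply: ucont_L1 => //; apply: ucontS (ode_ucontv H).
  apply: aeT => t; rewrite in_itv/= => /andP[ct tx].
  by apply: sc; rewrite in_itv/= ct (le_trans tx).
have := E d; rewrite in_itv/= lexx ltW// pd => /(_ isT)/esym/eqP.
rewrite mulf_eq0 subr_eq0 (gt_eqF cd) orbF => /eqP sc0.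
pose m := (c + d) / 2.
have := p0 m; rewrite in_itv/=.
have cm : c < m by rewrite /m; lra.
have md : m < d by rewrite /m; lra.
rewrite cm md => /(_ isT); rewrite E ?sc0 ?mul0r ?ltxx//.
by rewrite in_itv/= !ltW.
Qed.

(* Green's identity against an eigenfunction, on an arc where the latter is
   positive, forces [u] to be small: the arc need not be all of [a, b]. *)
Lemma superlinear_bound a b q (mu : R) : a < b -> L1 a b q ->
  (forall x, x \in `[a, b] -> 0 <= q x) -> dirichlet_eigenvalue a b q mu ->
  mu < 1 ->
  exists2 eps : R, 0 < eps & exists2 K : R, 0 <= K & forall (S : R) u v p, 0 <= S ->
    ode a b u v p -> (forall x, x \in `[a, b] -> 0 <= u x) ->
    {ae leb, forall x, x \in `[a, b] -> 0 <= p x} ->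
    {ae leb, forall x, x \in `[a, b] -> (q x - eps) * u x - S * q x <= p x} ->
    forall x, x \in `[a, b] -> u x <= K * S.
Proof.
move=> ab Lq q0 [phi0 dphi [x0 x0ab nz]] mu1.
have abw := ltW ab.
have [au _ fa fb] := dphi.
have cphi0 := abs_cont_ucont au.
have Lqp : L1 a b (fun x => mu * q x * phi0 x) by exact: L1Mu (L1Z _ Lq) cphi0.
have [psi0 H0] := dirichlet_ode abw dphi Lqp.
(* The opposite of an eigenfunction is one too; the one positive at [x0] is kept. *)
have [phi [psi [H pa pb px0]]] : exists phi psi,
    [/\ ode a b phi psi (fun x => mu * q x * phi x), phi a = 0, phi b = 0 & 0 < phi x0].
  have [p0|p0] := ltP 0 (phi0 x0); first by exists phi0, psi0.
  exists (fun x => - phi0 x), (fun x => - psi0 x); split; rewrite ?fa ?fb ?oppr0//; last first.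
    by rewrite oppr_gt0 lt_neqAle nz p0.
  have [h1 h2 h3] := H0; split.
  - by have := L1N h1; congr (L1 a b _); apply/funext => x; ring.
  - move=> x y ax xy yb; rewrite -opprD (h2 x y)//.
    have Ls : L1 x y psi0 by apply: ucont_L1 => //; exact: ucontS (ode_ucontv H0).
    by rewrite -mulN1r -itgZ//; congr (itg _ x y); apply/funext => t; ring.
  - move=> x y ax xy yb; rewrite -opprD (h3 x y)//.
    rewrite -mulN1r -itgZ; last exact/L1N/(L1S ax yb).
    by congr (itg _ x y); apply/funext => t; ring.
have pa' : phi a <= 0 by rewrite pa.
have pb' : phi b <= 0 by rewrite pb.
have [c [d [[ac cd db] [pc pd] pos sc sd]]] := positive_arc abw H pa' pb' x0ab px0.
have cdw := ltW cd.
have sub x : x \in `[c, d] -> x \in `[a, b].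
  by rewrite !in_itv/= => /andP[? ?]; apply/andP; split; lra.
have Hcd := odeS ac db H.
have cphi := ode_ucontu cdw Hcd.
have Lq' := L1S ac db Lq.
have phi_ge0 := arc_ge0 pc pd pos.
(* By [concave_bump], every [u] under consideration is at least [m * rho / (b - a) ^+ 2], with [m]
   its maximum. *)
pose rho x := (x - a) * (b - x).
have cid : ucont c d (fun x => x).
  by apply: (@ucont_lip _ _ _ _ 1) => x y _ _; rewrite mul1r.
have crho : ucont c d rho.
  apply: ucontM => //; first exact: (ucontD cid (ucont_cst _ _ _)).
  exact: (ucontD (ucont_cst _ _ _) (ucontN cid)).
have rho0 x : x \in `[c, d] -> 0 <= rho x.
  by rewrite in_itv/= => /andP[? ?]; rewrite mulr_ge0//; lra.
have rho0' x : x \in `]c, d[ -> 0 < rho x.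
  by rewrite in_itv/= => /andP[? ?]; rewrite mulr_gt0//; lra.
have q0' x : x \in `[c, d] -> 0 <= q x by move=> /sub; exact: q0.
have W0 := @eigen_weight_gt0 c d phi psi q rho mu cd Hcd pc pd Lq' q0' pos crho rho0 rho0'.
have Lw : L1 c d (fun x => q x * (phi x * rho x)) by exact: L1Mu Lq' (ucontM cdw cphi crho).
set W := itg _ c d in W0.
pose I := itg phi c d; pose J := itg (fun x => q x * phi x) c d.
have I0 : 0 <= I by apply: itg_ge0 => x; exact: phi_ge0.
have J0 : 0 <= J by apply: itg_ge0 => x xcd; rewrite mulr_ge0 ?q0' ?phi_ge0.
have ba0 : 0 < (b - a) ^+ 2 by rewrite exprn_gt0// subr_gt0.
(* Testing with [phi], the gap [1 - mu] gains at least [m * kap], and [eps] is chosen so that the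
   error term costs at most half of it. What remains is [m * kap / 2 <= S * J], whence the constant
   [K]. *)
pose kap := (1 - mu) * W / (b - a) ^+ 2.
have kap0 : 0 < kap by rewrite divr_gt0// mulr_gt0// subr_gt0.
have I2 : 0 < 2 * (I + 1) by move: I0; clear; lra.
have eps0 := divr_gt0 kap0 I2.
exists (kap / (2 * (I + 1))) => //.
set eps := kap / _ in eps0 *.
have epsI : eps * I <= kap / 2.
  by rewrite /eps mulrAC ler_pdivrMr//; move: kap0 I0; clear; nra.
exists (2 * J / kap); first by apply: divr_ge0; [exact: mulr_ge0|exact: ltW].
move=> S u v p S0 Hu u0 p0 pq.
have cu := ode_ucontu abw Hu.
have [x1 x1ab xmax] := ucont_max abw cu.
have m0 := u0 _ x1ab; set m := u x1 in xmax m0 *.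
suff : m <= 2 * J / kap * S by move=> h x /xmax /le_trans; apply.
have Hu' := odeS ac db Hu; have cu' := ode_ucontu cdw Hu'.
have [Lp _ _] := Hu'; have [Lr _ _] := Hcd.
have G := ode_green cdw Hu' Hcd; rewrite pc pd !mulr0 !sub0r in G.
have uc0 : 0 <= u c by apply/u0/sub; rewrite in_itv/= lexx.
have ud0 : 0 <= u d by apply/u0/sub; rewrite in_itv/= lexx andbT.
have G0 : 0 <= itg (fun t => mu * q t * phi t * u t - p t * phi t) c d.
  rewrite -G; have := mulr_ge0 uc0 sc; have : 0 <= u d * - psi d.
    by rewrite mulr_ge0// oppr_ge0.
  by rewrite mulrN; clear; lra.
have Lqphi : L1 c d (fun x => q x * phi x) by exact: L1Mu Lq' cphi.
have Lphi := ucont_L1 cdw cphi.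
have : itg (fun t => mu * q t * phi t * u t - p t * phi t) c d <=
    itg (fun t => m * eps * phi t + (S * (q t * phi t) +
       (- ((1 - mu) * m / (b - a) ^+ 2)) * (q t * (phi t * rho t)))) c d.
  apply: le_itg.
  - by apply: L1B; [exact: L1Mu Lr cu'|exact: L1Mu Lp cphi].
  - by apply: L1D; [exact: L1Z|apply: L1D; exact: L1Z].
  apply: (aeS2 _ p0 pq) => t hp hpq tcd.
  have tab := sub _ tcd; have {}hp := hp tab; have {}hpq := hpq tab.
  have f0 := phi_ge0 _ tcd; have qt0 := q0' _ tcd.
  have um := xmax _ tab.
  have cb := concave_bump ab Hu u0 p0 x1ab tab.
  have h1 : ((q t - eps) * u t - S * q t) * phi t <= p t * phi t by rewrite ler_wpM2r.
  have h2 : eps * u t * phi t <= m * eps * phi t.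
    by rewrite ler_wpM2r// [m * _]mulrC ler_wpM2l// ltW.
  have h3 : m / (b - a) ^+ 2 * rho t <= u t.
    by rewrite mulrAC ler_pdivrMr.
  have h4 : (1 - mu) * (q t * phi t) * (m / (b - a) ^+ 2 * rho t) <=
      (1 - mu) * (q t * phi t) * u t.
    by rewrite ler_wpM2l// mulr_ge0 ?mulr_ge0// subr_ge0 ltW.
  rewrite (_ : - _ * _ = - ((1 - mu) * (q t * phi t) * (m / (b - a) ^+ 2 * rho t))); last first.
    by ring.
  by clear -h1 h2 h4; nra.
have e1 : L1 c d (fun t => m * eps * phi t) by exact: L1Z.
have e2 : L1 c d (fun t => S * (q t * phi t)) by exact: L1Z.
have e3 : L1 c d (fun t => - ((1 - mu) * m / (b - a) ^+ 2) * (q t * (phi t * rho t))).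
  exact: L1Z.
rewrite (itgD e1 (L1D e2 e3)) (itgD e2 e3).
rewrite (itgZ _ Lphi) (itgZ _ Lqphi) (itgZ _ Lw) -/W -/I -/J => le2.
rewrite mulrAC ler_pdivlMr//.
have -> : m * kap = (1 - mu) * m / (b - a) ^+ 2 * W by rewrite /kap; ring.
have : m * eps * I <= m * (kap / 2) by rewrite -mulrA ler_wpM2l.
have -> : m * (kap / 2) = ((1 - mu) * m / (b - a) ^+ 2 * W) / 2 by rewrite /kap; ring.
move: le2 G0; rewrite mulNr; clear.
set A := itg _ c d; set B := (1 - mu) * m / _ * W; set D := _ * I.
set E := S * J; rewrite -/E => h1 h2 h3.
have : 2 * J * S = 2 * E by rewrite /E; ring.
by move: h1 h2 h3; clear; lra.
Qed.

End comparison.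
Section small_solutions.
Context {R : realType}.
Implicit Types (u v p q g k phi psi y z : R -> R) (a b c d x : R).

(* Testing with [y] gives [- u' b * y b <= eps * itg (u * y)], while Gronwall's
   lemma started at [b] bounds [u] by a multiple of [- u' b]. *)
Lemma sublinear_trivial a b q g y z : a < b ->
  ode a b y z (fun x => q x * y x) ->
  (forall x, x \in `[a, b] -> 0 <= y x) -> y a = 0 -> 0 < y b ->
  L1 a b g -> (forall x, x \in `[a, b] -> 0 <= g x) -> L1 a b q ->
  exists2 eps : R, 0 < eps & forall u v p, ode a b u v p ->
    (forall x, x \in `[a, b] -> 0 <= u x) -> u a = 0 -> u b = 0 ->
    {ae leb, forall x, x \in `[a, b] -> `|p x| <= g x * u x} ->
    {ae leb, forall x, x \in `[a, b] -> p x <= (q x + eps) * u x} ->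
    forall x, x \in `[a, b] -> u x = 0 /\ v x = 0.
Proof.
move=> ab Hy y0 ya yb Lg g0 Lq; have abw := ltW ab.
have [C C0 HC] := ode_gronwall abw Lg g0.
have cy := ode_ucontu abw Hy; have Ly := ucont_L1 abw cy.
pose I := itg y a b; have I0 : 0 <= I by exact: itg_ge0.
have CI : 0 <= C * I by rewrite mulr_ge0.
(* The two estimates will give [y b * - v b <= eps * (C * I) * - v b]; any [eps] with
   [eps * (C * I) < y b] then excludes [v b < 0]. *)
have I2 : 0 < 2 * (C * I + 1) by move: CI; clear; lra.
have eps_gt0 := divr_gt0 yb I2.
exists (y b / (2 * (C * I + 1))) => //.
set eps := y b / _ in eps_gt0 *; have eps0 := ltW eps_gt0.
have epsI : eps * (C * I) < y b.
  by rewrite /eps mulrAC ltr_pdivrMr//; move: CI yb; clear; nra.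
move=> u v p Hu u0 ua ub pg pq.
have bab : b \in `[a, b] by rewrite in_itv/= lexx andbT.
have G0 : forall x, x \in `[a, b] -> `|u x| + `|v x| <= C * `|v b|.
  move=> x xab; have := HC u v p Hu _ x b xab bab; rewrite ub normr0 add0r.
  by apply; apply: (aeS _ pg) => t h tab; rewrite [`|u t|]ger0_norm ?u0//; exact: h.
have cu := ode_ucontu abw Hu; have [Lp uv _] := Hu.
have vb : v b <= 0.
  apply: (primitive_sign_r ab uv (ode_ucontv Hu)) => x; rewrite in_itv/= => /andP[ax xb].
  by rewrite ub u0// in_itv/= !ltW.
suff vb0 : v b = 0.
  move=> x /G0; rewrite vb0 normr0 mulr0 => h.
  have := normr_ge0 (u x); have := normr_ge0 (v x) => h1 h2.
  by split; apply/eqP; rewrite -normr_le0; move: h h1 h2; clear; lra.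
apply/eqP; rewrite eq_le vb/= leNgt; apply/negP => vb0.
rewrite (ler0_norm vb) in G0.
have G := ode_green abw Hu Hy; rewrite ya ua ub !mulr0 mul0r !subr0 in G.
have [Lr _ _] := Hy.
have : itg (fun t => - (eps * C * - v b) * y t) a b <=
   itg (fun t => q t * y t * u t - p t * y t) a b.
  apply: le_itg; [exact: L1Z|by apply: L1B; [exact: L1Mu Lr cu|exact: L1Mu Lp cy]|].
  apply: (aeS _ pq) => t h tab; have {}h := h tab; have yt := y0 _ tab.
  have h1 : u t <= C * - v b.
    rewrite -(ger0_norm (u0 _ tab)); apply: le_trans (G0 _ tab).
    by rewrite lerDl.
  have h2 : p t * y t <= (q t + eps) * u t * y t by rewrite ler_wpM2r.
  have h3 : eps * u t * y t <= eps * (C * - v b) * y t.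
    by rewrite ler_wpM2r// ler_wpM2l.
  by clear -h2 h3; lra.
rewrite -G itgZ// -/I => h.
have : eps * (C * I) * - v b < y b * - v b by rewrite ltr_pM2r// oppr_gt0.
by move: h; clear; lra.
Qed.

End small_solutions.

(** * Euler scheme *)

Section compactness.
Context {R : realType}.

Lemma filter_forall_seq (I : eqType) (X : Type) (G : set_system X)
    (FG : Filter G) (P : I -> X -> Prop) (s : seq I) :
  (forall i, G (P i)) -> G [set h | forall i, i \in s -> P i h].
Proof.
move=> GP; elim: s => [|i s IH]; first by apply: filterS filterT => h _ i.
apply: filterS2 IH (GP i) => h h1 h2 j; rewrite in_cons => /predU1P[->//|].
exact: h1.
Qed.

(** Tychonoff's theorem gives a cluster point in a product of segments. As [I] may be uncountable,
    this yields approximation on finite sets of indices, not a subsequence converging at every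
    index. *)
Lemma cluster_subsequence (I : eqType) (B : R) (f : nat -> I -> R) :
  (forall k i, `|f k i| <= B) ->
  exists g : I -> R, forall (s : seq I) (e : R) k0, 0 < e ->
    exists2 k, (k0 <= k)%N & forall i, i \in s -> `|g i - f k i| < e.
Proof.
move=> fB.
pose A (i : I) : set R := `[- B, B]%classic.
have cA := @tychonoff I (fun=> R) A (fun i => @segment_compact R (- B) B).
pose FF : set_system (prod_topology (fun _ : I => R)) := f @ \oo.
have PF : ProperFilter FF by exact: fmap_proper_filter.
have FA : FF [set h : forall i : I, R | forall i, A i (h i)].
  exists 0%N => // k _ i; rewrite /A /= in_itv/=.
  by have := fB k i; rewrite ler_norml.
have [g [gA clg]] := cA _ PF FA.
exists g => s e k0 e0.
pose U : set (prod_topology (fun _ : I => R)) := [set h | forall i, i \in s -> `|g i - h i| < e].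
have nU : nbhs (g : prod_topology (fun _ : I => R)) U.
  have Gi i : nbhs g [set h : forall i : I, R | `|g i - h i| < e].
    have H : nbhs (g i) (ball (g i) e) := nbhsx_ballx (g i) e e0.
    exact: (@proj_continuous I (fun=> R) i g _ H).
  exact: (@filter_forall_seq I _ (nbhs g) (nbhs_filter g)
    (fun i h => `|g i - h i| < e) s Gi).
have FV : FF [set h | exists2 k, (k0 <= k)%N & h = f k].
  by exists k0 => // k /= k0k; exists k.
by have [h [[k k0k ->] hU]] := clg _ _ FV nU; exists k.
Qed.

(* The two real parameters are carried as additional coordinates. *)
Lemma quasi_lipschitz_compactness (L B K : R) (w : nat -> R -> R)
    (h al la : nat -> R) :
  0 < L -> 0 <= K ->
  (forall k, `|al k| <= B) -> (forall k, `|la k| <= B) ->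
  (forall k x, x \in `[0, L] -> `|w k x| <= B) ->
  (forall k x y, x \in `[0, L] -> y \in `[0, L] ->
    `|w k x - w k y| <= K * (`|x - y| + h k)) ->
  (forall e, 0 < e -> exists k0, forall k, (k0 <= k)%N -> h k < e) ->
  exists u a l, forall (e : R) k0, 0 < e -> exists2 k, (k0 <= k)%N &
    [/\ `|a - al k| < e, `|l - la k| < e &
      forall x, x \in `[0, L] -> `|u x - w k x| < e].
Proof.
move=> L0 K0 alB laB wB wK h0.
pose f k (i : R + bool) : R := match i with
  | inl x => if x \in `[0, L] then w k x else 0
  | inr true => al k
  | inr false => la k end.
have B0 : 0 <= B by exact: le_trans (alB 0%N).
have fB k i : `|f k i| <= B.
  by case: i => [x|[]] //=; case: ifPn => [/wB//|_]; rewrite normr0.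
have [g gP] := cluster_subsequence fB.
have uK x y : x \in `[0, L] -> y \in `[0, L] ->
    `|g (inl x) - g (inl y)| <= K * `|x - y|.
  move=> xL yL; apply/ler_addgt0Pr => e e0.
  have K3 : 0 < e / (2 + K) by rewrite divr_gt0//; lra.
  have [k0 hk0] := h0 _ K3.
  have [k k0k gk] := gP [:: inl x; inl y] _ k0 K3.
  have := gk (inl x); rewrite inE eqxx /= xL => /(_ isT) h1.
  have := gk (inl y); rewrite !inE eqxx orbT /= yL => /(_ isT) h2.
  have h3 := wK k _ _ xL yL; have h4 := hk0 _ k0k.
  have -> : e = e / (2 + K) * 2 + K * (e / (2 + K)).
    by field; apply/eqP => E; move: K0; rewrite (_ : K = -2); lra.
  have h5 : K * h k <= K * (e / (2 + K)) by rewrite ler_wpM2l// ltW.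
  rewrite (_ : _ - _ = (g (inl x) - w k x) - (g (inl y) - w k y) + (w k x - w k y)); last by ring.
  apply: (le_trans (ler_normD _ _)).
  have := ler_normB (g (inl x) - w k x) (g (inl y) - w k y).
  by move: h1 h2 h3 h5; rewrite mulrDr; clear; lra.
exists (fun x => g (inl x)), (g (inr true)), (g (inr false)) => e k0 e0.
(* The cluster point is approximated on finite sets only, so a grid of spacing [L / M] is used; the
   quasi-Lipschitz bound covers the points in between. *)
pose M := (Num.truncn (4 * K * L / e)).+1.
have M0 : (0 : R) < M%:R by rewrite ltr0n.
have KM : K * (L / M%:R) < e / 4.
  have := truncn_itv (_ : 0 <= 4 * K * L / e).
  rewrite divr_ge0 ?mulr_ge0 ?(ltW e0) ?(ltW L0)// => /(_ isT) /andP[_].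
  rewrite ltr_pdivrMr// -/M => h1.
  by rewrite mulrA ltr_pdivrMr//; move: h1; clear; lra.
pose z i : R := i%:R * (L / M%:R).
have zin i : (i <= M)%N -> z i \in `[0, L].
  move=> iM; have LM1 : 0 <= L / M%:R by rewrite divr_ge0 ?ltW.
  rewrite in_itv/= mulr_ge0//= (@le_trans _ _ (M%:R * (L / M%:R)))//.
    by rewrite ler_wpM2r// ler_nat.
  by rewrite mulrC divfK// gt_eqF.
have e4 : 0 < e / 4 by lra.
have K3 : 0 < e / 4 / (K + 1) by rewrite divr_gt0//; lra.
have [k1 hk1] := h0 _ K3.
have [k kk gk] := gP (inr true :: inr false :: [seq inl (z i) | i <- iota 0 M.+1]) _ (maxn k0 k1) e4.
exists k; first by apply: leq_trans kk; rewrite leq_maxl.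
have {}k1k : (k1 <= k)%N by apply: leq_trans kk; rewrite leq_maxr.
split.
- have := gk (inr true); rewrite !inE eqxx => /(_ isT) /= h1; lra.
- have := gk (inr false); rewrite !inE eqxx orbT => /(_ isT) /= h1; lra.
move=> x xL; have := xL; rewrite in_itv/= => /andP[x0 x1].
pose i := Num.truncn (x / (L / M%:R)).
have LM0 : 0 < L / M%:R by rewrite divr_gt0.
have := truncn_itv (_ : 0 <= x / (L / M%:R)).
rewrite divr_ge0 ?(ltW LM0)// => /(_ isT) /andP[]; rewrite -/i.
rewrite ler_pdivlMr// ltr_pdivrMr// -/(z i) => zx xz.
have iM : (i <= M)%N.
  rewrite -(ler_nat R) -(ler_pM2r LM0) -/(z i) (le_trans zx)// (le_trans x1)//.
  by rewrite mulrC divfK// gt_eqF.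
have zi := zin _ iM.
have zs : (inl (z i) : (R + bool)%type) \in
    inr true :: inr false :: [seq inl (z j) | j <- iota 0 M.+1].
  rewrite 2!in_cons; apply/orP; right; apply/orP; right; apply/mapP.
  by exists i => //; rewrite mem_iota add0n ltnS.
have := gk _ zs; rewrite /= zi => h1.
have xzi : `|x - z i| <= L / M%:R.
  by rewrite ger0_norm ?subr_ge0//; move: xz; rewrite -natr1 mulrDl mul1r -/(z i); clear; lra.
have h2 := uK _ _ xL zi; have h3 := wK k _ _ zi xL.
have h4 : K * `|x - z i| <= K * (L / M%:R) by rewrite ler_wpM2l.
have h5 : K * h k <= e / 4.
  have h5 := ltW (hk1 _ k1k); rewrite (@le_trans _ _ (K * (e / 4 / (K + 1))))//.
    by rewrite ler_wpM2l.
  rewrite mulrA ler_pdivrMr; last by move: K0; clear; lra.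
  by move: e0 K0; clear; nra.
rewrite (_ : _ - _ = (g (inl x) - g (inl (z i))) + (g (inl (z i)) - w k (z i)) + (w k (z i) - w k x)); last by ring.
apply: (le_lt_trans (ler_normD _ _)).
have h6 := ler_normD (g (inl x) - g (inl (z i))) (g (inl (z i)) - w k (z i)).
move: h1 h2 h3 h4 h5 h6 KM; rewrite (distrC (z i) x) mulrDr; clear; lra.
Qed.

End compactness.

(** While the slopes are at most [al * E i], [u] stays below [L * (al * E i)] because [i * h <= L];
    one step thus multiplies the slope bound by at most [1 + L * c]. *)
Lemma gronwall_seq {R : realType} (u v c E : nat -> R) (al L h : R) N :
  0 <= al -> 0 <= h -> N%:R * h <= L -> u 0 = 0 -> `|v 0| <= al * E 0 ->
  (forall i, 0 < E i) -> (forall i, u i.+1 = u i + h * v i) ->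
  (forall i, (i.+1 < N)%N -> `|v i.+1| <= `|v i| + c i.+1 * `|u i.+1|) ->
  (forall i, (i.+1 < N)%N -> 0 <= c i.+1) ->
  (forall i, (i.+1 < N)%N -> E i * (1 + L * c i.+1) <= E i.+1) ->
  forall i, (i < N)%N ->
    `|v i| <= al * E i /\ `|u i| <= i%:R * h * (al * E i).
Proof.
move=> al0 h0 hL u0 v0 E0 uS vS c0 ES.
have L0 : 0 <= L by apply: le_trans hL; exact: mulr_ge0.
elim=> [|i IH] iN; first by rewrite u0 normr0 !mul0r.
have [h1 h2] := IH (ltnW iN); have aE : 0 <= al * E i by rewrite mulr_ge0// ltW.
have h3 : `|u i.+1| <= i.+1%:R * h * (al * E i).
  rewrite uS -natr1 !mulrDl mul1r; apply: (le_trans (ler_normD _ _)).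
  by apply: lerD => //; rewrite normrM (ger0_norm h0) ler_wpM2l.
have hN : i.+1%:R * h <= L.
  by apply: le_trans hL; rewrite ler_wpM2r// ler_nat ltnW.
have h4 : al * (E i * (1 + L * c i.+1)) <= al * E i.+1 by rewrite ler_wpM2l// ES.
have h5 : `|u i.+1| <= L * (al * E i) by apply: (le_trans h3); rewrite ler_wpM2r.
have h6 : c i.+1 * `|u i.+1| <= c i.+1 * (L * (al * E i)) by rewrite ler_wpM2l ?c0.
have h7 : 0 <= L * c i.+1 * (al * E i) by rewrite mulr_ge0// mulr_ge0// c0.
split; first by have := vS _ iN; move: h1 h4 h6; clear; lra.
apply: (le_trans h3); rewrite ler_wpM2l ?mulr_ge0//.
by move: h4 h7; clear; lra.
Qed.

Section euler_scheme.
Context {R : realType} (L : R) (L_gt0 : 0 < L).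
Implicit Types (F : R -> R -> R) (g : R -> R) (N j : nat) (al : R).

(** All real [s] are allowed because discrete solutions may become negative during the shooting. The
    linear bound forces [F x 0 = 0] and, with the same [g], survives multiplication by [0, 1] and
    the rescalings [t^-1 * F x (t * s)]. *)
Definition admissible F g :=
  [/\ forall s, lebesgue_measurable_fun `[0, L] (F ^~ s),
      forall x, x \in `[0, L] -> continuous (F x) &
      forall x s, x \in `[0, L] -> `|F x s| <= g x * `|s|].

Definition mesh N : R := L / N%:R.
Definition node N j : R := j%:R * mesh N.
(** [F] is only integrable in [x], so the scheme averages it over a cell instead of evaluating it at
    a node. *)
Definition cell_itg F N j s := itg (F ^~ s) (node N j) (node N j.+1).

(* Symplectic Euler: [eu] at the node [j.+1] uses the slope [ev] of the cell
   [j], so that [eu] satisfies the explicit second difference equation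
   [eu j.+2 - 2 eu j.+1 + eu j = - mesh * cell_itg j.+1 (eu j.+1)]. *)
Fixpoint euler F N al j : R * R :=
  if j is i.+1 then
    let: (u, v) := euler F N al i in
    let u' := u + mesh N * v in (u', v - cell_itg F N i.+1 u')
  else (0, al).

Definition eu F N al j := (euler F N al j).1.
Definition ev F N al j := (euler F N al j).2.

Lemma eu0 F N al : eu F N al 0 = 0. Proof. by []. Qed.
Lemma ev0 F N al : ev F N al 0 = al. Proof. by []. Qed.

Lemma euS F N al j : eu F N al j.+1 = eu F N al j + mesh N * ev F N al j.
Proof. by rewrite /eu /ev /=; case: (euler F N al j). Qed.

Lemma evS F N al j : ev F N al j.+1 =
  ev F N al j - cell_itg F N j.+1 (eu F N al j.+1).
Proof. by rewrite /eu /ev /=; case: (euler F N al j). Qed.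

Lemma mesh_gt0 N : (0 < N)%N -> 0 < mesh N.
Proof. by move=> N0; rewrite divr_gt0// ltr0n. Qed.

Lemma node0 N : node N 0 = 0. Proof. by rewrite /node mul0r. Qed.

Lemma nodeS N j : node N j.+1 = node N j + mesh N.
Proof. by rewrite /node -natr1 mulrDl mul1r. Qed.

Lemma nodeN N : (0 < N)%N -> node N N = L.
Proof. by move=> N0; rewrite /node /mesh mulrC divfK// pnatr_eq0 -lt0n. Qed.

Lemma node_le N i j : (0 < N)%N -> (i <= j)%N -> node N i <= node N j.
Proof. by move=> N0 ij; rewrite ler_wpM2r ?ler_nat// ltW// mesh_gt0. Qed.

Lemma node_ge0 N j : (0 < N)%N -> 0 <= node N j.
Proof. by move=> N0; rewrite mulr_ge0// ltW// mesh_gt0. Qed.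

Lemma node_leL N j : (0 < N)%N -> (j <= N)%N -> node N j <= L.
Proof. by move=> N0 jN; rewrite -[leRHS](nodeN N0) node_le. Qed.

Lemma node_in N j : (0 < N)%N -> (j <= N)%N -> node N j \in `[0, L].
Proof. by move=> N0 jN; rewrite in_itv/= node_ge0// node_leL. Qed.

(** At [x = L] the index is [N], one past the last cell, so that reading [eu] there gives the
    terminal value. *)
Definition cell N x := Num.truncn (x / mesh N).

Lemma cellP N x : (0 < N)%N -> 0 <= x ->
  node N (cell N x) <= x < node N (cell N x).+1.
Proof.
move=> N0 x0; have m0 := mesh_gt0 N0.
have := truncn_itv (divr_ge0 x0 (ltW m0)).
by rewrite ler_pdivlMr// ltr_pdivrMr.
Qed.

Lemma cell_eq N x j : (0 < N)%N -> node N j <= x < node N j.+1 -> cell N x = j.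
Proof.
move=> N0 /andP[h1 h2]; apply: truncn_def.
by rewrite ler_pdivlMr ?mesh_gt0// ltr_pdivrMr ?mesh_gt0// h1.
Qed.

Lemma cell_node N j : (0 < N)%N -> cell N (node N j) = j.
Proof. by move=> N0; apply: cell_eq => //; rewrite lexx nodeS ltrDl mesh_gt0. Qed.

Lemma cell_le N x : (0 < N)%N -> x \in `[0, L] -> (cell N x <= N)%N.
Proof.
move=> N0; rewrite in_itv/= => /andP[x0 xL].
have /andP[h _] := cellP N0 x0.
by rewrite -(ler_nat R) -(ler_pM2r (mesh_gt0 N0)) (le_trans h)// -[leRHS]/(node N N) nodeN.
Qed.

Lemma cell_measurable N (G : nat -> R -> R) : (0 < N)%N ->
  (forall j, lebesgue_measurable_fun `[0, L] (G j)) ->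
  lebesgue_measurable_fun `[0, L] (fun x => G (cell N x) x).
Proof.
move=> N0 mG mD Y mY.
have -> : `[0, L]%classic `&` (fun x => G (cell N x) x) @^-1` Y =
    \bigcup_j ((`[0, L]%classic `&` (G j) @^-1` Y) `&` [set` `[node N j, node N j.+1[]).
  apply/seteqP; split => x /=.
    move=> [xL Gx]; have x0 : 0 <= x by move: xL; rewrite in_itv/= => /andP[].
    by exists (cell N x) => //=; split; [split|rewrite in_itv/= cellP].
  move=> [j _ [[xL Gx]]] /=; rewrite in_itv/= => xj; split => //=.
  by rewrite (cell_eq N0 xj).
apply: bigcupT_measurable => j; apply: measurableI; last exact: lmeas_itv.
exact: mG.
Qed.

Section bounds.
Variables (F : R -> R -> R) (g : R -> R) (N : nat) (al : R).
Hypotheses (N0 : (0 < N)%N) (AF : admissible F g) (Lg : L1 0 L g)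
  (g0 : forall x, x \in `[0, L] -> 0 <= g x).

Lemma admissible_L1 s : L1 0 L (F ^~ s).
Proof.
case: AF => mF _ gF; apply: (L1_dom (L1Z `|s| Lg) (mF s)).
by apply: aeT => x xL; rewrite mulrC; exact: gF.
Qed.

Lemma admissible0 x : x \in `[0, L] -> F x 0 = 0.
Proof.
case: AF => _ _ gF xL; apply/eqP; rewrite -normr_le0.
by rewrite (le_trans (gF _ _ xL))// normr0 mulr0.
Qed.

Lemma cell_int0 j : (j < N)%N -> cell_itg F N j 0 = 0.
Proof.
move=> jN; rewrite /cell_itg (@eq_itg _ _ _ _ (fun=> 0)).
- by rewrite itg_cst ?mul0r// node_le.
- by apply: (L1S _ _ (admissible_L1 0)); [exact: node_ge0|exact: node_leL].
- exact: L1_cst.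
- apply: aeT => x; rewrite in_itv/= => /andP[h1 h2]; apply: admissible0.
  by rewrite in_itv/= (le_trans (node_ge0 j N0))//= (le_trans h2)// node_leL.
Qed.

Lemma cell_itg_le j s : (j < N)%N ->
  `|cell_itg F N j s| <= itg g (node N j) (node N j.+1) * `|s|.
Proof.
move=> jN; have h0 := node_ge0 j N0; have h1 := node_leL N0 jN.
have LF := L1S h0 h1 (admissible_L1 s); have Lg' := L1S h0 h1 Lg.
rewrite mulrC -itgZ//; apply: (le_trans (le_norm_itg LF)).
apply: le_itg; [exact: L1_norm|exact: L1Z|apply: aeT => x].
rewrite in_itv/= => /andP[x0 x1]; case: AF => _ _ gF; rewrite mulrC; apply: gF.
by rewrite in_itv/= (le_trans h0)//= (le_trans x1).
Qed.

Definition euler_rhs x := F x (eu F N al (cell N x)).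

Lemma euler_rhs_meas : lebesgue_measurable_fun `[0, L] euler_rhs.
Proof.
case: AF => mF _ _.
exact: (@cell_measurable N (fun j x => F x (eu F N al j)) N0 (fun j => mF _)).
Qed.

(** Because [F x 0 = 0], the slope does not change at a node where [eu] vanishes. This replaces
    uniqueness for the Cauchy problem. *)
Lemma euler_zero j : (0 < j < N)%N -> eu F N al j = 0 ->
  eu F N al j.+1 = - eu F N al j.-1.
Proof.
case: j => // j /= jN uj; rewrite euS evS uj add0r cell_int0// subr0.
by move: uj; rewrite euS => /eqP; rewrite addr_eq0 => /eqP ->; rewrite opprK.
Qed.

Lemma euler_positive j : (forall i, (i <= N)%N -> 0 <= eu F N al i) -> 0 < al ->
  (0 < j < N)%N -> 0 < eu F N al j.
Proof.
move=> u0 al0; elim: j => [|j IH] // /andP[_ jN].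
have [->|j0] := posnP j.
  by rewrite euS eu0 ev0 add0r mulr_gt0// mesh_gt0.
rewrite lt_neqAle u0 ?(ltnW jN)// andbT eq_sym; apply/eqP => uj.
have := @euler_zero j.+1 jN uj; rewrite /= => E.
have := u0 j.+2 jN; rewrite E oppr_ge0 leNgt IH//.
by rewrite j0 (ltn_trans _ jN).
Qed.

Lemma euler_gronwall j : 0 <= al -> (j <= N)%N ->
  `|eu F N al j| <= al * (L * expR (L * itg g 0 L)).
Proof.
move=> al0.
(* Integrating up to the end of cell [j] absorbs one factor [1 + L * c] per step, by
   [1 + t <= expR t]. *)
pose E j := expR (L * itg g 0 (node N j.+1)).
have E0 i : 0 < E i by exact: expR_gt0.
have intg a b : 0 <= a -> a <= b -> b <= L -> 0 <= itg g a b.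
  move=> a0 ab bL; apply: itg_ge0 => x; rewrite in_itv/= => /andP[ax xb].
  by apply: g0; rewrite in_itv/= (le_trans a0)//= (le_trans xb).
have ES i : (i.+1 < N)%N -> E i * (1 + L * itg g (node N i.+1) (node N i.+2)) <= E i.+1.
  move=> iN; rewrite /E (@itg_splits _ 0 (node N i.+1) (node N i.+2)); last 3 first.
  - exact: node_ge0.
  - exact: node_le.
  - exact: (L1S (lexx 0) (node_leL N0 iN) Lg).
  by rewrite [L * (_ + _)]mulrDr expRD ler_wpM2l ?expR_ge0// expR_ge1Dx.
have EL i : (i < N)%N -> E i <= expR (L * itg g 0 L).
  move=> iN; rewrite ler_expR ler_wpM2l ?(ltW L_gt0)//.
  rewrite (@itg_splits _ 0 (node N i.+1) L)//; last 2 first.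
  - exact: node_ge0.
  - exact: node_leL.
  by rewrite lerDl intg// ?node_ge0// node_leL.
have key i : (i < N)%N -> `|ev F N al i| <= al * E i /\
    `|eu F N al i| <= i%:R * mesh N * (al * E i).
  apply: (@gronwall_seq _ (eu F N al) (ev F N al)
    (fun i => itg g (node N i) (node N i.+1)) E al L (mesh N) N) => //.
  - exact: ltW (mesh_gt0 N0).
  - by rewrite -/(node N N) nodeN.
  - rewrite ev0 ger0_norm// ler_peMr// /E -[leLHS]expR0 ler_expR.
    by rewrite mulr_ge0 ?(ltW L_gt0)// intg// ?node_ge0// node_leL.
  - by move=> k; exact: euS.
  - move=> k kN; rewrite evS; apply: (le_trans (ler_normB _ _)).
    by rewrite lerD2l; exact: cell_itg_le.
  - by move=> k kN; rewrite intg ?node_ge0 ?node_le// node_leL.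
(* [key] stops before [N], where the slope would involve a cell beyond [L]; the value at the last
   node needs one more Euler step. *)
case: j => [|j] jN; first by rewrite eu0 normr0 !mulr_ge0 ?expR_ge0// ltW.
have [h1 h2] := key _ jN.
have h3 := EL _ jN; have h4 := ltW (E0 j); have hj := node_leL N0 jN.
have m0 := ltW (mesh_gt0 N0); rewrite euS; rewrite nodeS in hj.
move: h1 h2 h3 h4 hj m0; rewrite -/(node N j).
move: (E j) (expR _) (node N j) (mesh N) (eu _ _ _ _) (ev _ _ _ _) => e X n m u v.
move=> h1 h2 h3 h4 hj m0.
have h5 : `|u + m * v| <= (n + m) * (al * e).
  apply: (le_trans (ler_normD _ _)); rewrite mulrDl lerD//.
  by rewrite normrM (ger0_norm m0) ler_wpM2l.
have ae : 0 <= al * e by rewrite mulr_ge0.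
apply: (le_trans h5); apply: (@le_trans _ _ (L * (al * e))).
  by rewrite ler_wpM2r.
by rewrite [leRHS]mulrCA ler_wpM2l ?(ltW L_gt0)// ler_wpM2l.
Qed.

Section bounded.
Variables (B : R).
Hypothesis uB : forall j, (j <= N)%N -> `|eu F N al j| <= B.

Lemma euler_rhs_le x : x \in `[0, L] -> `|euler_rhs x| <= g x * B.
Proof.
move=> xL; case: AF => _ _ gF; apply: (le_trans (gF _ _ xL)).
by rewrite ler_wpM2l ?g0// uB// cell_le.
Qed.

Lemma euler_rhs_L1 : L1 0 L euler_rhs.
Proof.
apply: (L1_dom (L1Z B Lg) euler_rhs_meas); apply: aeT => x xL.
by rewrite mulrC; exact: euler_rhs_le.
Qed.

Lemma itg_euler_rhs_cell j : (j < N)%N ->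
  itg euler_rhs (node N j) (node N j.+1) = cell_itg F N j (eu F N al j).
Proof.
move=> jN; have h0 := node_ge0 j N0; have h1 := node_leL N0 jN.
apply: eq_itg; [exact: (L1S h0 h1 euler_rhs_L1)|exact: (L1S h0 h1 (admissible_L1 _))|].
(* On the closed cell, [cell] takes another value only at the right end. *)
exists [set node N j.+1; node N j.+1]; split.
- by apply: lmeas; exact: measurableU.
- exact: leb_pair.
- move=> x /= /not_implyP[]; rewrite in_itv/= => /andP[x0 x1] nE; left.
  apply/eqP; rewrite eq_le x1/= leNgt; apply/negP => x2; apply: nE.
  by rewrite /euler_rhs (@cell_eq _ _ j)// x0.
Qed.

(** The scheme never subtracts the integral over cell 0, but that integral vanishes since [eu]
    starts at 0. *)
Lemma ev_itg j : (j < N)%N -> ev F N al j = al - itg euler_rhs 0 (node N j.+1).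
Proof.
elim: j => [|j IH] jN.
  rewrite ev0 -[in itg _ _ _](node0 N) itg_euler_rhs_cell// eu0 cell_int0//.
  by rewrite subr0.
rewrite evS IH; last exact: ltnW.
rewrite (@itg_splits _ 0 (node N j.+1) (node N j.+2)); last 3 first.
- exact: node_ge0.
- exact: node_le.
- exact: (L1S (lexx 0) (node_leL N0 jN) euler_rhs_L1).
by rewrite itg_euler_rhs_cell// opprD addrA.
Qed.

Lemma itg_euler_rhs_le x y : 0 <= x -> x <= y -> y <= L ->
  `|itg euler_rhs x y| <= itg g x y * B.
Proof.
move=> x0 xy yL; have Lr := L1S x0 yL euler_rhs_L1; have Lg' := L1S x0 yL Lg.
apply: (le_trans (le_norm_itg Lr)); rewrite mulrC -itgZ//.
apply: le_itg; [exact: L1_norm|exact: L1Z|apply: aeT => t].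
rewrite in_itv/= => /andP[t0 t1]; rewrite mulrC; apply: euler_rhs_le.
by rewrite in_itv/= (le_trans x0)//= (le_trans t1).
Qed.

Lemma itg_g_le x y : 0 <= x -> x <= y -> y <= L -> 0 <= itg g x y <= itg g 0 L.
Proof.
move=> x0 xy yL.
have p a b : 0 <= a -> b <= L -> 0 <= itg g a b.
  move=> a0 bL; apply: itg_ge0 => t; rewrite in_itv/= => /andP[t1 t2].
  by apply: g0; rewrite in_itv/= (le_trans a0)//= (le_trans t2).
rewrite p//= (@itg_splits _ 0 x L)//; last by rewrite (le_trans xy).
rewrite (@itg_splits _ x y L)//; last exact: (L1S x0 (lexx L) Lg).
have y0 := le_trans x0 xy; have xL := le_trans xy yL.
by rewrite addrCA lerDl addr_ge0// p.
Qed.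

Lemma ev_le j : (j < N)%N -> `|ev F N al j| <= `|al| + itg g 0 L * B.
Proof.
have B0 : 0 <= B by exact: le_trans (uB (leq0n N)).
move=> jN; rewrite ev_itg//; apply: (le_trans (ler_normB _ _)); rewrite lerD2l.
have h0 := node_ge0 j.+1 N0; have h1 := node_leL N0 jN.
apply: (le_trans (itg_euler_rhs_le (lexx 0) h0 h1)); rewrite ler_wpM2r//.
by have /andP[] := itg_g_le (lexx 0) h0 h1.
Qed.

Lemma eu_ge j : (j <= N)%N -> node N j * (al - itg g 0 L * B) <= eu F N al j.
Proof.
have B0 : 0 <= B by exact: le_trans (uB (leq0n N)).
elim: j => [|j IH] jN; first by rewrite node0 mul0r eu0.
rewrite nodeS mulrDl euS lerD//; first exact: IH (ltnW jN).
rewrite ler_wpM2l ?(ltW (mesh_gt0 N0))// ev_itg// lerD2l lerN2.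
have h0 := node_ge0 j.+1 N0; have h1 := node_leL N0 jN.
apply: (le_trans (ler_norm _)).
apply: (le_trans (itg_euler_rhs_le (lexx 0) h0 h1)); rewrite ler_wpM2r//.
by have /andP[] := itg_g_le (lexx 0) h0 h1.
Qed.

(** All slopes are at least [al - itg g 0 L * B], so a larger [al] would push the value at [L] above
    [B]. *)
Lemma al_le : al <= B / L + itg g 0 L * B.
Proof.
have := le_trans (eu_ge (leqnn N)) (le_trans (ler_norm _) (uB (leqnn N))).
by rewrite nodeN// mulrC -ler_pdivlMr// lerBlDr.
Qed.

Lemma eu_lip i j : (i <= j <= N)%N ->
  `|eu F N al j - eu F N al i| <=
  (`|al| + itg g 0 L * B) * (node N j - node N i).
Proof.
move=> /andP[]; elim: j => [|j IH].
  by rewrite leqn0 => /eqP -> _; rewrite !subrr normr0 mulr0.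
rewrite leq_eqVlt => /predU1P[->|]; first by rewrite !subrr normr0 mulr0.
rewrite ltnS => ij jN; have h := IH ij (ltnW jN).
rewrite euS nodeS (addrAC (eu _ _ _ j)) (addrAC (node N j)) mulrDr.
apply: (le_trans (ler_normD _ _)); apply: lerD => //.
rewrite normrM gtr0_norm ?mesh_gt0// mulrC ler_wpM2r ?(ltW (mesh_gt0 N0))//.
exact: ev_le.
Qed.

(** The jumps of the step function cost the extra [mesh N]; this is the form that
    [quasi_lipschitz_compactness] expects. *)
Lemma step_lip x y : x \in `[0, L] -> y \in `[0, L] ->
  `|eu F N al (cell N x) - eu F N al (cell N y)| <=
  (`|al| + itg g 0 L * B) * (`|x - y| + mesh N).
Proof.
have B0 : 0 <= B by exact: le_trans (uB (leq0n N)).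
have K0 : 0 <= `|al| + itg g 0 L * B.
  rewrite addr_ge0// mulr_ge0//.
  by have /andP[] := itg_g_le (lexx 0) (ltW L_gt0) (lexx L).
wlog xy : x y / (cell N y <= cell N x)%N.
  move=> wl xL yL; have [|] := leqP (cell N y) (cell N x); first by move=> h; exact: wl.
  by move=> /ltnW h; rewrite distrC [in leRHS]distrC; exact: wl.
move=> xL yL; have cx := cell_le N0 xL.
apply: (le_trans (eu_lip _)); first by rewrite xy cx.
rewrite ler_wpM2l//.
have x0 : 0 <= x by move: xL; rewrite in_itv/= => /andP[].
have y0 : 0 <= y by move: yL; rewrite in_itv/= => /andP[].
have /andP[h1 h2] := cellP N0 x0; have /andP[h3 h4] := cellP N0 y0.
rewrite nodeS in h4; have := ler_norm (x - y).
lra.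
Qed.

(* The piecewise linear interpolation of the scheme is the primitive of the
   step function of slopes, which is close to [al - itg euler_rhs 0 t]. *)
Lemma eu_primitive (eta : R) j :
  (forall x y, 0 <= x -> x <= y -> y <= L -> y - x <= mesh N -> itg g x y <= eta) ->
  (j <= N)%N ->
  `|eu F N al j - itg (fun t => al - itg euler_rhs 0 t) 0 (node N j)| <=
  node N j * (eta * B).
Proof.
move=> He; have B0 : 0 <= B by exact: le_trans (uB (leq0n N)).
have cV : ucont 0 L (fun t => al - itg euler_rhs 0 t).
  by apply: ucontD; [exact: ucont_cst|exact/ucontN/ucont_itg/euler_rhs_L1].
have LV := ucont_L1 (ltW L_gt0) cV.
elim: j => [|j IH] jN.
  rewrite node0 itg_aa ?eu0 ?subrr ?normr0 ?mul0r//.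
  exact: (L1S (lexx 0) (ltW L_gt0) LV).
have h0 := node_ge0 j N0; have h1 := node_leL N0 jN.
have h01 := node_le N0 (leqnSn j).
rewrite (@itg_splits _ 0 (node N j) (node N j.+1))//; last first.
  exact: (L1S (lexx 0) h1 LV).
rewrite euS nodeS mulrDl opprD addrACA; apply: (le_trans (ler_normD _ _)).
apply: lerD; first exact: IH (ltnW jN).
rewrite -nodeS.
have -> : mesh N * ev F N al j = itg (fun=> ev F N al j) (node N j) (node N j.+1).
  by rewrite itg_cst// mulrC nodeS addrAC subrr add0r.
have LV' := L1S h0 h1 LV.
rewrite -itgB//; last exact: L1_cst.
apply: (le_trans (le_norm_itg (L1B (L1_cst _ _ _) LV'))).
rewrite mulrC [X in _ * X](_ : _ = node N j.+1 - node N j); last first.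
  by rewrite nodeS addrAC subrr add0r.
rewrite -itg_cst//; apply: le_itg; [exact/L1_norm/(L1B (L1_cst _ _ _) LV')|exact: L1_cst|].
apply: aeT => t; rewrite in_itv/= => /andP[t0 t1].
have t00 := le_trans h0 t0.
rewrite ev_itg// opprB addrC addrA subrK -normrN opprB (itg_sub euler_rhs_L1)//.
apply: (le_trans (itg_euler_rhs_le t00 t1 h1)); rewrite ler_wpM2r// He//.
by rewrite nodeS in t1 *; lra.
Qed.

End bounded.
End bounds.

End euler_scheme.

(** * Continuous dependence of the scheme on a parameter, and discrete shooting *)

Section euler_parameter.
Context {R : realType} (L : R) (L_gt0 : 0 < L).
Implicit Types (F : R -> R -> R) (g : R -> R) (N j : nat).

Lemma cell_itg_continuous F g N j : (j < N)%N -> admissible L F g -> L1 0 L g ->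
  (forall x, x \in `[0, L] -> 0 <= g x) ->
  continuous (cell_itg L F N j).
Proof.
move=> jN AF Lg g0 s; have N0 : (0 < N)%N by exact: leq_ltn_trans jN.
have h0 := node_ge0 L_gt0 j N0; have h1 := node_leL L_gt0 N0 jN.
have sub x : x \in `[node L N j, node L N j.+1] -> x \in `[0, L].
  by rewrite !in_itv/= => /andP[x0 x1]; rewrite (le_trans h0)//= (le_trans x1).
have [mF cF gF] := AF.
have LFs r : L1 (node L N j) (node L N j.+1) (F ^~ r).
  exact: (L1S h0 h1 (admissible_L1 AF Lg r)).
have Lg' := L1Z (`|s| + 1) (L1S h0 h1 Lg).
have := @continuity_under_integral R _ _ leb (fun s x => F x s)
   `[node L N j, node L N j.+1]%classic (lmeas_itv _) (s - 1) (s + 1)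
   (fun r _ => LFs r) _ _ Lg' _ s.
apply.
- by apply: aeT => x /sub xL r _; exact: cF.
- move=> r /=; rewrite in_itv/= => /andP[r0 r1]; apply: aeT => x /sub xL.
  apply: (le_trans (gF _ _ xL)); rewrite mulrC ler_wpM2r ?g0//.
  rewrite (_ : r = s + (r - s)); last by ring.
  apply: (le_trans (ler_normD _ _)); rewrite lerD2l ler_norml.
  by apply/andP; split; lra.
- by apply/mem_set; rewrite /= in_itv/=; apply/andP; split; lra.
Qed.

Variables (F : R -> R -> R) (g : R -> R) (N : nat) (lam alp : R -> R).
Hypotheses (N0 : (0 < N)%N) (AF : admissible L F g) (Lg : L1 0 L g)
  (g0 : forall x, x \in `[0, L] -> 0 <= g x)
  (clam : continuous lam) (calp : continuous alp).

(** Serves two deformations: [lam] the identity and [alp] constant bring [F] to 0, [lam] constant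
    and [alp] the identity vary the initial slope. *)
Let FF t := fun x s => lam t * F x s.

Lemma cell_itgZ j s t : (j < N)%N ->
  cell_itg L (FF t) N j s = lam t * cell_itg L F N j s.
Proof.
move=> jN; rewrite /cell_itg /FF itgZ//.
apply: (L1S _ _ (admissible_L1 AF Lg s)); first exact: node_ge0.
exact: node_leL.
Qed.

Lemma eu_succ_continuous j :
  continuous (fun t => eu L (FF t) N (alp t) j) ->
  continuous (fun t => ev L (FF t) N (alp t) j) ->
  continuous (fun t => eu L (FF t) N (alp t) j.+1).
Proof.
move=> cu cv; rewrite (_ : (fun t => _) = (fun t => eu L (FF t) N (alp t) j +
  mesh L N * ev L (FF t) N (alp t) j)); last by apply/funext => t; exact: euS.
by move=> t; apply: cvgD; [exact: cu|apply: cvgM; [exact: cvg_cst|exact: cv]].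
Qed.

Lemma euler_continuous j : (j < N)%N ->
  continuous (fun t => eu L (FF t) N (alp t) j) /\
  continuous (fun t => ev L (FF t) N (alp t) j).
Proof.
elim: j => [|j IH] jN; first by split => t; [exact: cvg_cst|exact: calp].
have [cu cv] := IH (ltnW jN).
have cu' : continuous (fun t => eu L (FF t) N (alp t) j.+1).
  exact: eu_succ_continuous.
split => //.
rewrite (_ : (fun t => _) = (fun t => ev L (FF t) N (alp t) j -
  lam t * cell_itg L F N j.+1 (eu L (FF t) N (alp t) j.+1))); last first.
  by apply/funext => t; rewrite evS cell_itgZ.
move=> t; apply: cvgB; first exact: cv.
apply: cvgM; first exact: clam.
apply: (@continuous_comp _ _ _ (fun t => eu L (FF t) N (alp t) j.+1)); first exact: cu'.
exact: (cell_itg_continuous jN AF Lg g0).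
Qed.

Lemma eu_continuous j : (j <= N)%N ->
  continuous (fun t => eu L (FF t) N (alp t) j).
Proof.
case: j => [|j] jN; first by move=> t; exact: cvg_cst.
have [cu cv] := euler_continuous jN; exact: eu_succ_continuous.
Qed.

(** Node 0, where every discrete solution vanishes, is left out; [eu_min N.-1] covers the nodes from
    1 to [N]. *)
Fixpoint eu_min n t : R :=
  if n is k.+1 then Num.min (eu_min k t) (eu L (FF t) N (alp t) k.+2)
  else eu L (FF t) N (alp t) 1.

Lemma eu_min_continuous n : (n < N)%N -> continuous (eu_min n).
Proof.
elim: n => [|n IH] nN /=; first exact: eu_continuous.
move=> t; apply: continuous_min; first exact: IH (ltnW nN) t.
exact: eu_continuous.
Qed.

Lemma eu_min_ge n t c : (c <= eu_min n t) =
  [forall j : 'I_n.+1, c <= eu L (FF t) N (alp t) j.+1].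
Proof.
elim: n => [|n IH] /=.
  by apply/idP/forallP => [h j|/(_ ord0)//]; rewrite ord1.
rewrite le_min IH; apply/andP/forallP => [[/forallP h1 h2] j|h].
  have [jn|jn] := ltnP j n.+1; first exact: (h1 (Ordinal jn)).
  by have -> : nat_of_ord j = n.+1 by apply/eqP; rewrite eqn_leq jn -ltnS ltn_ord.
by split; [apply/forallP => j; exact: (h (widen_ord (leqnSn _) j))|exact: (h ord_max)].
Qed.

Lemma eu_min_gt n t c : (c < eu_min n t) =
  [forall j : 'I_n.+1, c < eu L (FF t) N (alp t) j.+1].
Proof.
elim: n => [|n IH] /=.
  by apply/idP/forallP => [h j|/(_ ord0)//]; rewrite ord1.
rewrite lt_min IH; apply/andP/forallP => [[/forallP h1 h2] j|h].
  have [jn|jn] := ltnP j n.+1; first exact: (h1 (Ordinal jn)).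
  by have -> : nat_of_ord j = n.+1 by apply/eqP; rewrite eqn_leq jn -ltnS ltn_ord.
by split; [apply/forallP => j; exact: (h (widen_ord (leqnSn _) j))|exact: (h ord_max)].
Qed.

(* The minimum over the nodes vanishes somewhere between the parameters; an
   interior zero is excluded by [euler_zero], which propagates it to the left. *)
Lemma discrete_shooting t0 t1 : t0 <= t1 ->
  (forall t, t \in `[t0, t1] -> 0 < alp t) ->
  (forall j, (0 < j <= N)%N -> 0 < eu L (FF t0) N (alp t0) j) ->
  (exists2 j, (0 < j <= N)%N & eu L (FF t1) N (alp t1) j <= 0) ->
  exists2 t, t \in `[t0, t1] &
    (forall j, (j <= N)%N -> 0 <= eu L (FF t) N (alp t) j) /\
    eu L (FF t) N (alp t) N = 0.
Proof.
move=> t01 al0 u0 [j1 /andP[j10 j1N] u1].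
have N1 : (N.-1 < N)%N by rewrite prednK.
have ordN (j : 'I_N.-1.+1) : (j < N)%N by exact: leq_trans (ltn_ord j) N1.
have cm : {within `[t0, t1], continuous (eu_min N.-1)}.
  exact/continuous_subspaceT/eu_min_continuous.
have m0 : 0 < eu_min N.-1 t0.
  by rewrite eu_min_gt; apply/forallP => j; apply: u0; exact: ordN.
have m1 : eu_min N.-1 t1 <= 0.
  rewrite leNgt eu_min_gt; apply/negP => /forallP h.
  have jN : (j1.-1 < N.-1.+1)%N by rewrite !prednK.
  by have := h (Ordinal jN); rewrite /= prednK// ltNge u1.
have [|t tin mt] := IVT t01 cm (v := 0).
  by rewrite ge_min le_max m1 (ltW m0) orbT.
exists t => //.
have uge j : (j <= N)%N -> 0 <= eu L (FF t) N (alp t) j.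
  case: j => [|j] jN; first by rewrite eu0.
  have jN' : (j < N.-1.+1)%N by rewrite prednK.
  have : 0 <= eu_min N.-1 t by rewrite mt.
  by rewrite eu_min_ge => /forallP/(_ (Ordinal jN')).
split => //; apply/eqP; rewrite eq_le uge// andbT leNgt; apply/negP => uN.
have : 0 < eu_min N.-1 t; last by rewrite mt ltxx.
rewrite eu_min_gt; apply/forallP => j.
have jN := ordN j.
have [->|jN'] := eqVneq (j : nat).+1 N; first exact: uN.
have AFF : admissible L (FF t) (fun x => `|lam t| * g x).
  case: AF => mF cF gF; split => [s|x xL s|x s xL].
  - exact: (measurable_funM (measurable_cst _) (mF s)).
  - by apply: continuousM; [exact: cst_continuous|exact: cF].
  - by rewrite normrM -mulrA ler_wpM2l// gF.
apply: (euler_positive L_gt0 N0 AFF (L1Z _ Lg) uge (al0 _ tin)).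
by rewrite /= ltn_neqAle jN' jN.
Qed.

End euler_parameter.

(** * Passage to the limit in the scheme *)

Section euler_limit.
Context {R : realType} (L : R) (L_gt0 : 0 < L).
Variables (g : R -> R) (B : R) (N : nat -> nat) (F : nat -> R -> R -> R)
  (Finf : R -> R -> R -> R) (al la : nat -> R).
(** [kN] makes the mesh tend to 0. [cF] is continuous convergence of the nonlinearities; it covers a
    fixed [F], the family [t * F] with [la] as its parameter, and the rescalings of [F]. *)
Hypotheses (Lg : L1 0 L g) (g0 : forall x, x \in `[0, L] -> 0 <= g x)
  (kN : forall k, (k < N k)%N) (AF : forall k, admissible L (F k) g)
  (al0 : forall k, 0 <= al k) (laB : forall k, `|la k| <= B)
  (uB : forall k j, (j <= N k)%N -> 0 <= eu L (F k) (N k) (al k) j <= B)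
  (cF : forall l x s e, x \in `[0, L] -> 0 <= s -> 0 < e ->
    exists2 d : R, 0 < d & exists K, forall k s', (K <= k)%N -> 0 <= s' ->
      `|l - la k| < d -> `|s - s'| < d -> `|Finf l x s - F k x s'| < e).

Let N0 k : (0 < N k)%N. Proof. exact: leq_ltn_trans (kN k). Qed.
Let B0 : 0 <= B. Proof. exact: le_trans (laB 0%N). Qed.
Let G := itg g 0 L.
Let G0 : 0 <= G. Proof. exact: itg_ge0. Qed.
(** The bound of [al_le] on the initial slopes; [K] is the resulting bound on all slopes. *)
Let A := B / L + G * B.
Let A0 : 0 <= A. Proof. by rewrite addr_ge0// ?divr_ge0 ?mulr_ge0// ltW. Qed.
Let K := A + G * B.
Let K0 : 0 <= K. Proof. by rewrite addr_ge0// mulr_ge0. Qed.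

Let w k x := eu L (F k) (N k) (al k) (cell L (N k) x).

Let uB' k j : (j <= N k)%N -> `|eu L (F k) (N k) (al k) j| <= B.
Proof. by move=> /uB /andP[h1 h2]; rewrite ger0_norm. Qed.

Let alA k : al k <= A.
Proof. exact: (al_le L_gt0 (N0 k) (AF k) Lg g0 (uB' (k := k))). Qed.

Let alK k : `|al k| + G * B <= K.
Proof. by rewrite lerD2r ger0_norm. Qed.

Let mesh_small e : 0 < e -> exists k0, forall k, (k0 <= k)%N -> mesh L (N k) < e.
Proof.
move=> e0; exists (Num.truncn (L / e)) => k kk.
rewrite ltr_pdivrMr ?ltr0n// mulrC -ltr_pdivrMr//.
have := truncn_itv (divr_ge0 (ltW L_gt0) (ltW e0)) => /andP[_ h].
by apply: (lt_le_trans h); rewrite ler_nat (leq_trans _ (kN k)).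
Qed.

Lemma euler_cluster : exists u a l, forall (e : R) k0, 0 < e ->
  exists2 k, (k0 <= k)%N & [/\ `|a - al k| < e, `|l - la k| < e &
    forall x, x \in `[0, L] -> `|u x - w k x| < e].
Proof.
apply: (@quasi_lipschitz_compactness R L (A + B) K w (fun k => mesh L (N k)) al la) => //.
- by move=> k; rewrite ger0_norm// (le_trans (alA k))// lerDl.
- by move=> k; rewrite (le_trans (laB k))// lerDr.
- move=> k x xL; apply: (le_trans (uB' (cell_le L_gt0 (N0 k) xL))).
  by rewrite lerDr.
- move=> k x y xL yL.
  apply: (le_trans (step_lip L_gt0 (N0 k) (AF k) Lg g0 (uB' (k := k)) xL yL)).
  by rewrite ler_wpM2r ?alK// addr_ge0// ltW// mesh_gt0.
Qed.

Section subsequence.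
Variables (u : R -> R) (a l : R) (phi : nat -> nat).
Hypotheses (phi_ge : forall m, (m <= phi m)%N)
  (aP : forall m, `|a - al (phi m)| < m.+1%:R^-1)
  (lP : forall m, `|l - la (phi m)| < m.+1%:R^-1)
  (uP : forall m x, x \in `[0, L] -> `|u x - w (phi m) x| < m.+1%:R^-1).

Let inv_small (e : R) : 0 < e -> \forall m \near \oo, m.+1%:R^-1 < e.
Proof. by move=> e0; exact: (near_infty_natSinv_lt (PosNum e0)). Qed.

Let u_cvg x : x \in `[0, L] -> (fun m => w (phi m) x) @ \oo --> u x.
Proof.
move=> xL; apply/cvgrPdist_lt => e e0; near=> m.
by apply: lt_trans (uP m xL) _; near: m; exact: inv_small.
Unshelve. all: by end_near. Qed.

Let w_ge0 k x : x \in `[0, L] -> 0 <= w k x.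
Proof. by move=> xL; have /andP[] := uB (cell_le L_gt0 (N0 k) xL). Qed.

Let u_bound x : x \in `[0, L] -> 0 <= u x <= B.
Proof.
move=> xL; apply/andP; split.
  by apply: (cvgr_to_ge (u_cvg xL)); apply: nearW => m; exact: w_ge0.
apply: (cvgr_to_le (u_cvg xL)).
by apply: nearW => m; have /andP[] := uB (cell_le L_gt0 (N0 (phi m)) xL).
Qed.

Let P m := euler_rhs L (F (phi m)) (N (phi m)) (al (phi m)).
Let p x := Finf l x (u x).

Let P_cvg x : x \in `[0, L] -> P ^~ x @ \oo --> p x.
Proof.
move=> xL; apply/cvgrPdist_lt => e e0.
have /andP[u0 _] := u_bound xL.
have [d d0 [k0 H]] := cF l xL u0 e0; near=> m; apply: H.
- by apply: leq_trans (phi_ge m); near: m; exists k0.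
- exact: w_ge0.
- by apply: lt_trans (lP m) _; near: m; exact: inv_small.
- by apply: lt_trans (uP m xL) _; near: m; exact: inv_small.
Unshelve. all: by end_near. Qed.

Let P_meas m : lebesgue_measurable_fun `[0, L] (P m).
Proof. exact: (euler_rhs_meas L_gt0 _ (N0 (phi m)) (AF (phi m))). Qed.

Let p_meas : lebesgue_measurable_fun `[0, L] p.
Proof. by apply: (measurable_fun_cvg P_meas) => x xL; exact: P_cvg. Qed.

Let P_le m x : x \in `[0, L] -> `|P m x| <= g x * B.
Proof. exact: (euler_rhs_le L_gt0 (N0 (phi m)) (AF (phi m)) g0 (uB' (k := phi m))). Qed.

Let P_L1 m : L1 0 L (P m).
Proof. exact: (euler_rhs_L1 L_gt0 (N0 (phi m)) (AF (phi m)) Lg g0 (uB' (k := phi m))). Qed.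

Let p_L1 : L1 0 L p.
Proof.
apply: (L1_dom (L1Z B Lg) p_meas); apply: aeT => x xL; rewrite mulrC.
have /cvg_norm h := P_cvg xL.
by apply: (cvgr_to_le h); apply: nearW => m; exact: P_le.
Qed.

Let v x := a - itg p 0 x.
Let V m x := al (phi m) - itg (P m) 0 x.

Let V_cvg x : x \in `[0, L] -> V ^~ x @ \oo --> v x.
Proof.
rewrite in_itv/= => /andP[x0 xL]; apply: cvgB.
  apply/cvgrPdist_lt => e e0; near=> m.
  by apply: lt_trans (aP m) _; near: m; exact: inv_small.
have sub t : t \in `[0, x] -> t \in `[0, L].
  by rewrite !in_itv/= => /andP[-> tx]; rewrite (le_trans tx).
have S q : lebesgue_measurable_fun `[0, L] q -> lebesgue_measurable_fun `[0, x] q.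
  by apply: measurable_funS; [exact: lmeas_itv|exact: sub].
apply: (itg_cvg _ _ _ (L1Z B (L1S (lexx 0) xL Lg))).
- by move=> m; exact: S.
- exact: S.
- by apply: aeT => t /sub tL; exact: P_cvg.
- by apply: aeT => t m /sub tL; rewrite mulrC; exact: P_le.
Unshelve. all: by end_near. Qed.

Let V_ucont m : ucont 0 L (V m).
Proof. exact: (ucontD (ucont_cst _ _ _) (ucontN (ucont_itg (P_L1 m)))). Qed.

Let v_ucont : ucont 0 L v.
Proof. exact: (ucontD (ucont_cst _ _ _) (ucontN (ucont_itg p_L1))). Qed.

Let V_le m x : x \in `[0, L] -> `|V m x| <= K.
Proof.
rewrite in_itv/= => /andP[x0 xL]; apply: le_trans (alK (phi m)).
apply: (le_trans (ler_normB _ _)); rewrite lerD2l.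
apply: (le_trans (itg_euler_rhs_le L_gt0 (N0 (phi m)) (AF (phi m)) Lg g0 (uB' (k := phi m)) (lexx 0) x0 xL)).
by rewrite ler_wpM2r//; have /andP[] := itg_g_le Lg g0 (lexx 0) x0 xL.
Qed.

Let itgV_cvg x : x \in `[0, L] -> (fun m => itg (V m) 0 x) @ \oo --> itg v 0 x.
Proof.
rewrite in_itv/= => /andP[x0 xL].
have sub t : t \in `[0, x] -> t \in `[0, L].
  by rewrite !in_itv/= => /andP[-> tx]; rewrite (le_trans tx).
apply: (itg_cvg _ _ _ (L1_cst 0 x K)).
- by move=> m; exact: (ucont_meas (ucontS (lexx 0) xL (V_ucont m))).
- exact: (ucont_meas (ucontS (lexx 0) xL v_ucont)).
- by apply: aeT => t /sub tL; exact: V_cvg.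
- by apply: aeT => t m /sub tL; exact: V_le.
Qed.

(** [eu_primitive] handles the interval up to the node on the left of [x], with error at most
    [L * (eta * B)]; the rest is shorter than a mesh and contributes at most [K * eta]. *)
Let w_itgV x : x \in `[0, L] ->
  (fun m => w (phi m) x - itg (V m) 0 x) @ \oo --> (0 : R).
Proof.
move=> xL; apply/cvgrPdist_le => e e0.
have C0 : 0 < L * B + K + 1.
  by apply: ltr_wpDl => //; rewrite addr_ge0// mulr_ge0// ltW.
have e1 := divr_gt0 e0 C0; set eta := e / _ in e1.
have [d d0 Hd] := itg_small Lg e1.
have m0 : 0 < Num.min d eta by rewrite lt_min d0.
have [k0 Hk] := mesh_small m0.
near=> m; rewrite sub0r normrN.
have mk : (k0 <= phi m)%N by apply: leq_trans (phi_ge m); near: m; exists k0.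
have := Hk _ mk.
rewrite lt_min => /andP[md me].
have x0 : 0 <= x by move: xL; rewrite in_itv/= => /andP[].
have xL' : x <= L by move: xL; rewrite in_itv/= => /andP[].
have cN := cell_le L_gt0 (N0 (phi m)) xL.
have /andP[n1 n2] := cellP L_gt0 (N0 (phi m)) x0.
have n0 := node_ge0 L_gt0 (cell L (N (phi m)) x) (N0 (phi m)).
have nL := node_leL L_gt0 (N0 (phi m)) cN.
rewrite (@itg_splits _ 0 (node L (N (phi m)) (cell L (N (phi m)) x)) x)//; last first.
  exact: (L1S (lexx 0) xL' (ucont_L1 (ltW L_gt0) (V_ucont m))).
rewrite opprD addrA; apply: (le_trans (ler_normB _ _)).
have h1 : `|w (phi m) x - itg (V m) 0 (node L (N (phi m)) (cell L (N (phi m)) x))| <=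
    node L (N (phi m)) (cell L (N (phi m)) x) * (eta * B).
  apply: (eu_primitive L_gt0 (N0 (phi m)) (AF (phi m)) Lg g0 (uB' (k := phi m))) => //.
  move=> y z y0 yz zL yzm; have Lg' := L1S y0 zL Lg.
  apply: (@le_trans _ _ (itg (fun t => `|g t|) y z)).
    by apply: le_itg => //; [exact: L1_norm|apply: aeT => t _; exact: ler_norm].
  by apply/ltW/Hd => //; exact: le_lt_trans md.
have h2 : `|itg (V m) (node L (N (phi m)) (cell L (N (phi m)) x)) x| <= K * mesh L (N (phi m)).
  have LV := L1S n0 xL' (ucont_L1 (ltW L_gt0) (V_ucont m)).
  apply: (le_trans (le_norm_itg LV)).
  apply: (@le_trans _ _ (itg (fun=> K) (node L (N (phi m)) (cell L (N (phi m)) x)) x)).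
    apply: le_itg; [exact: L1_norm|exact: L1_cst|apply: aeT => t].
    rewrite in_itv/= => /andP[t1 t2]; apply: V_le.
    by rewrite in_itv/= (le_trans n0)//= (le_trans t2).
  rewrite itg_cst// ler_wpM2l//; move: n2; rewrite nodeS.
  by rewrite lerBlDr addrC => /ltW.
have h3 : node L (N (phi m)) (cell L (N (phi m)) x) * (eta * B) <= L * (eta * B).
  by rewrite ler_wpM2r// mulr_ge0// ltW.
have h4 : K * mesh L (N (phi m)) <= K * eta by rewrite ler_wpM2l// ltW.
have h5 : e = eta * (L * B + K + 1) by rewrite /eta divfK// gt_eqF.
apply: (le_trans (lerD (le_trans h1 h3) (le_trans h2 h4))).
rewrite [leRHS]h5.
by rewrite [L * (eta * B)]mulrCA [K * eta]mulrC -mulrDr ler_pM2l// lerDl ler01.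
Unshelve. all: by end_near. Qed.

Let u_itg x : x \in `[0, L] -> u x = itg v 0 x.
Proof.
move=> xL; have h := cvgD (w_itgV xL) (itgV_cvg xL).
have E : (fun m => w (phi m) x) =
    (fun m => w (phi m) x - itg (V m) 0 x) \+ (fun m => itg (V m) 0 x).
  by apply/funext => m /=; rewrite subrK.
have h' := u_cvg xL; rewrite E in h'; rewrite add0r in h.
exact: (@cvg_unique R (@Rhausdorff R) _ _ _ _ h' (h _)).
Qed.

Lemma euler_limit_ode :
  [/\ ode 0 L u v p, u 0 = 0, v 0 = a & forall x, x \in `[0, L] -> 0 <= u x <= B].
Proof.
have Lv := ucont_L1 (ltW L_gt0) v_ucont.
have z0 : (0 : R) \in `[0, L] by rewrite in_itv/= lexx ltW.
split => //.
- split; [exact: p_L1| |] => x y x0 xy yL.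
    rewrite !u_itg ?(itg_sub Lv)// in_itv/= ?x0 ?(le_trans x0)//.
    by rewrite (le_trans xy).
  rewrite (itgN (L1S x0 yL p_L1)) -(itg_sub p_L1 x0 xy yL) /v.
  by move: (itg p 0 y) (itg p 0 x) => I1 I2; ring.
- by rewrite u_itg// itg_aa//; exact: (L1S (lexx 0) (ltW L_gt0) Lv).
- by rewrite /v itg_aa ?subr0//; exact: (L1S (lexx 0) (ltW L_gt0) p_L1).
Qed.

End subsequence.

(** The approximation is kept next to the equation: from it one identifies [a], [l] and [u L], and
    transfers to [u] the estimates on the scheme. *)
Lemma euler_limit : exists u v l a,
  [/\ ode 0 L u v (fun x => Finf l x (u x)), u 0 = 0, v 0 = a &
    forall x, x \in `[0, L] -> 0 <= u x <= B] /\
  forall (e : R) k0, 0 < e -> exists2 k, (k0 <= k)%N &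
    [/\ `|a - al k| < e, `|l - la k| < e & forall x, x \in `[0, L] ->
      `|u x - eu L (F k) (N k) (al k) (cell L (N k) x)| < e].
Proof.
have [u [a [l H]]] := euler_cluster.
have H' (m : nat) : exists k, (m <= k)%N /\ [/\ `|a - al k| < m.+1%:R^-1,
    `|l - la k| < m.+1%:R^-1 &
    forall x, x \in `[0, L] -> `|u x - w k x| < m.+1%:R^-1].
  have [|k h1 h2] := H m.+1%:R^-1 m; first by rewrite invr_gt0.
  by exists k.
have [phi phiP] := choice H'.
have S := @euler_limit_ode u a l phi (fun m => (phiP m).1)
  (fun m => let: And3 h _ _ := (phiP m).2 in h)
  (fun m => let: And3 _ h _ := (phiP m).2 in h)
  (fun m => let: And3 _ _ h := (phiP m).2 in h).
by exists u, (fun x => a - itg (fun x => Finf l x (u x)) 0 x), l, a; split.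
Qed.

End euler_limit.

(** * Shooting *)

Section small_slopes.
Context {R : realType}.
Implicit Types (u v p q g : R -> R) (F : R -> R -> R) (a b c x y L : R).

Lemma eq_eps a b : (forall e : R, 0 < e -> `|a - b| < e) -> a = b.
Proof.
move=> H; apply/eqP; rewrite -subr_eq0 -normr_le0 leNgt; apply/negP => h.
by have := H _ h; rewrite ltxx.
Qed.

Lemma primitiveN a b u v : L1 a b v -> primitive a b u v ->
  primitive a b (fun x => - u x) (fun x => - v x).
Proof.
by move=> Lv Hu x y ax xy yb; rewrite (itgN (L1S ax yb Lv)) -Hu// opprB opprK addrC.
Qed.

Lemma interior_min a b u v c : primitive a b u v -> ucont a b v ->
  c \in `]a, b[ -> (forall x, x \in `[a, b] -> u c <= u x) -> v c = 0.
Proof.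
rewrite in_itv/= => Hu Hv /andP[ac cb] H.
have acw := ltW ac; have cbw := ltW cb.
apply/eqP; rewrite eq_le; apply/andP; split.
  apply: (primitive_sign_r ac (primitiveS (lexx a) cbw Hu) (ucontS (lexx a) cbw Hv)).
  move=> x; rewrite in_itv/= => /andP[/ltW ax /ltW xc]; apply: H.
  by rewrite in_itv/= ax (le_trans xc).
apply: (primitive_sign_l cb (primitiveS acw (lexx b) Hu) (ucontS acw (lexx b) Hv)).
move=> x; rewrite in_itv/= => /andP[/ltW cx /ltW xb]; apply: H.
by rewrite in_itv/= xb (le_trans acw).
Qed.

Lemma interior_max a b u v c : primitive a b u v -> ucont a b v ->
  c \in `]a, b[ -> (forall x, x \in `[a, b] -> u x <= u c) -> v c = 0.
Proof.
move=> Hu Hv cab H.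
have ab : a <= b.
  by move: cab; rewrite in_itv/= => /andP[/ltW ac /ltW]; exact: le_trans.
apply/eqP; rewrite -oppr_eq0; apply/eqP.
apply: (interior_min (primitiveN (ucont_L1 ab Hv) Hu) (ucontN Hv) cab).
by move=> x /H; rewrite lerN2.
Qed.

Lemma primitive_eq0 a b u v : a < b -> primitive a b u v -> ucont a b v ->
  (forall x, x \in `[a, b] -> u x = 0) -> v a = 0.
Proof.
move=> ab Hu Hv H; have abw := ltW ab.
have ua : u a = 0 by apply: H; rewrite in_itv/= lexx abw.
have H' x : x \in `]a, b[ -> u x = 0.
  by rewrite in_itv/= => /andP[/ltW ax /ltW xb]; apply: H; rewrite in_itv/= ax.
apply/eqP; rewrite eq_le -[v a <= 0]oppr_ge0; apply/andP; split.
  apply: (primitive_sign_l ab (primitiveN (ucont_L1 abw Hv) Hu) (ucontN Hv)).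
  by move=> x /H' ->; rewrite ua.
by apply: (primitive_sign_l ab Hu Hv) => x /H' ->; rewrite ua.
Qed.

Lemma admissibleZ L F g c : (forall x, x \in `[0, L] -> 0 <= g x) -> `|c| <= 1 ->
  admissible L F g -> admissible L (fun x s => c * F x s) g.
Proof.
move=> g0 c1 [mF cF gF]; split => [s|x xL s|x s xL].
- exact: (measurable_funM (measurable_cst _) (mF s)).
- by apply: continuousM; [exact: cst_continuous|exact: cF].
- rewrite normrM (le_trans _ (gF x s xL))// -[leRHS]mul1r.
  by rewrite ler_wpM2r.
Qed.

Lemma admissible_near L F g l x s (e : R) : admissible L F g -> x \in `[0, L] ->
  0 < e -> exists2 d : R, 0 < d & forall l' s', `|l - l'| < d -> `|s - s'| < d ->
    `|l * F x s - l' * F x s'| < e.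
Proof.
move=> [_ cF _] xL e0; have cl : (fun l' : R => l') @ l --> l by [].
have /cvgrPdist_lt/(_ _ e0) : (fun z : R * R => z.1 * F x z.2) @ (l, s) --> l * F x s.
  apply: cvgM; first exact: cvg_fst.
  by apply: (cvg_comp _ _ cvg_snd); exact: cF.
move=> /nbhs_ballP[d /= d0 H]; exists d => // l' s' ll ss.
exact: (H (l', s')).
Qed.

Section linear_start.
Variables (L : R) (L_gt0 : 0 < L).

Lemma eu_free N c j : (0 < N)%N -> eu L (fun _ _ => 0) N c j = j%:R * mesh L N * c.
Proof.
move=> N0; have E i : ev L (fun _ _ => 0) N c i = c.
  elim: i => [|i IH]; first by rewrite ev0.
  by rewrite evS IH /cell_itg itg_cst ?mul0r ?subr0// node_le.
by elim: j => [|j IH]; rewrite ?eu0 ?mul0r// euS IH E -natr1 !mulrDl mul1r.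
Qed.

Variables (F : R -> R -> R) (g : R -> R) (al0 : R).
Hypotheses (AF : admissible L F g) (Lg : L1 0 L g)
  (g0 : forall x, x \in `[0, L] -> 0 <= g x) (al0_gt0 : 0 < al0).
Let C := L * expR (L * itg g 0 L).

Let C0 : 0 <= C. Proof. by rewrite mulr_ge0// ?expR_ge0// ltW. Qed.

(* If positivity failed at a parameter value [t = 1] of the family [t * F], it
   would fail for the first time at some [t] where the last value vanishes. *)
Lemma small_slope_positive :
  (forall l u v, 0 <= l <= 1 -> ode 0 L u v (fun x => l * F x (u x)) ->
    u 0 = 0 -> v 0 = al0 ->
    (forall x, x \in `[0, L] -> 0 <= u x <= al0 * C) -> u L != 0) ->
  exists K, forall N, (K <= N)%N ->
    forall j, (0 < j <= N)%N -> 0 < eu L F N al0 j.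
Proof.
move=> H; apply: contrapT => /forallNP H1.
have H2 k : exists N, (k < N)%N /\
    exists2 j, (0 < j <= N)%N & eu L F N al0 j <= 0.
  have /existsNP[N /not_implyP[kN /existsNP[j /not_implyP[jN h]]]] := H1 k.+1.
  by exists N; split => //; exists j => //; rewrite leNgt; exact/negP.
have [N HN] := choice H2.
have kN k : (k < N k)%N by have [] := HN k.
have N0 k : (0 < N k)%N by exact: leq_ltn_trans (kN k).
have H3 k : exists t : R, [/\ 0 <= t <= 1,
    forall j, (j <= N k)%N -> 0 <= eu L (fun x s => t * F x s) (N k) al0 j &
    eu L (fun x s => t * F x s) (N k) al0 (N k) = 0].
  have clam : continuous (fun t : R => t) by move=> t; exact: cvg_id.
  have calp : continuous (fun _ : R => al0) by exact: cst_continuous.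
  have [||t tin [h1 h2]] := discrete_shooting L_gt0 (N0 k) AF Lg g0 clam calp ler01
    (fun _ _ => al0_gt0).
  (* At the parameter 0 the nonlinearity vanishes and the nodal values are those of a line of slope
     [al0]. *)
  - move=> j /andP[j0 _].
    rewrite (_ : (fun x s => 0 * F x s) = (fun _ _ => 0)); last first.
      by apply/funext => x; apply/funext => s; rewrite mul0r.
    rewrite (eu_free _ _ (N0 k)); apply: mulr_gt0 => //.
    by rewrite mulr_gt0 ?ltr0n// (mesh_gt0 L_gt0).
  - have [_ [j jN h]] := HN k; exists j => //.
    rewrite (_ : (fun x s => 1 * F x s) = F)//.
    by apply/funext => x; apply/funext => s; rewrite mul1r.
  - by exists t; split => //; move: tin; rewrite in_itv.
have [t Ht] := choice H3.
have t01 k : `|t k| <= 1.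
  by have [/andP[h1 h2] _ _] := Ht k; rewrite ger0_norm.
(* The same bound must also cover the parameters [t k], which lie in [0, 1]. *)
pose B := al0 * C + 1.
have aC : 0 <= al0 * C by rewrite mulr_ge0// ltW.
have AFk k : admissible L (fun x s => t k * F x s) g by exact: admissibleZ.
have euC k j : (j <= N k)%N -> eu L (fun x s => t k * F x s) (N k) al0 j <= al0 * C.
  move=> jN; apply: (le_trans (ler_norm _)).
  exact: (euler_gronwall L_gt0 (N0 k) (AFk k) Lg g0 (ltW al0_gt0) jN).
have [||||u [v [l [a [[Hode u0 va ub] Hap]]]]] := @euler_limit R L L_gt0 g B N
  (fun k x s => t k * F x s) (fun l x s => l * F x s) (fun=> al0) t Lg g0 kN AFk.
- by move=> k; exact: ltW.
- by move=> k; rewrite (le_trans (t01 k))// lerDr.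
- move=> k j jN; have [_ h _] := Ht k; rewrite h//=.
  by rewrite (le_trans (euC k j jN))// lerDl.
- move=> l x s e xL _ e0; have [d d0 Hd] := admissible_near l s AF xL e0.
  by exists d => //; exists 0%N => k s' _ _; exact: Hd.
have aE : a = al0.
  by apply: eq_eps => e e0; have [k _ []] := Hap e 0%N e0.
have l01 : 0 <= l <= 1.
  apply/andP; split; apply/ler_addgt0Pr => e e0; have [k _ [_ h _]] := Hap e 0%N e0;
    have [/andP[h1 h2] _ _] := Ht k; move: h; rewrite ltr_norml => /andP[h3 h4].
    by move: (t k) h1 h3 h4 => tk h1 h3 h4; lra.
  by move: (t k) h2 h4 => tk h2 h4; lra.
have LL : L \in `[0, L] by rewrite in_itv/= lexx ltW.
have uL : u L = 0.
  apply: eq_eps => e e0; have [k _ [_ _ /(_ L LL)]] := Hap e 0%N e0.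
  have -> : cell L (N k) L = N k.
    by have := cell_node L_gt0 (N k) (N0 k); rewrite nodeN.
  by have [_ _ ->] := Ht k.
have := H l u v l01 Hode u0 (etrans va aE).
rewrite uL eqxx => /(_ _)/negP; apply => // x xL.
have /andP[-> _] /= := ub x xL; apply/ler_addgt0Pr => e e0.
have [k _ [_ _ /(_ x xL)]] := Hap e 0%N e0.
have := euC k _ (cell_le L_gt0 (N0 k) xL).
move: (eu _ _ _ _ _) => w h1; rewrite ltr_norml => /andP[_ h2].
by apply: (le_trans _ (lerD h1 (lexx e))); rewrite -lerBlDl ltW.
Qed.

End linear_start.
(** A solution of slope 1 for the coefficient [l * q], [l] in [0, 1], cannot vanish at [L], or [l]
    would be an eigenvalue below [mu]. Hence the schemes are positive from some number of steps on,
    and [y] is a limit of them. *)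
Lemma linear_comparison (L : R) q (mu : R) : 0 < L -> L1 0 L q ->
  (forall x, x \in `[0, L] -> 0 <= q x) ->
  (forall nu, dirichlet_eigenvalue 0 L q nu -> mu <= nu) -> 1 < mu ->
  exists (y z : R -> R), [/\ ode 0 L y z (fun x => q x * y x),
    forall x, x \in `[0, L] -> 0 <= y x, y 0 = 0 & 0 < y L].
Proof.
move=> L0 Lq q0 Hmu mu1; pose F x s := q x * s.
have AF : admissible L F q.
  split=> [s|x xL s|x s xL].
  - exact: (measurable_funM (L1_meas Lq) (measurable_cst _)).
  - exact: mulrl_continuous.
  - by rewrite normrM ger0_norm ?q0.
have LL : L \in `[0, L] by rewrite in_itv/= lexx ltW.
have H l u v : 0 <= l <= 1 -> ode 0 L u v (fun x => l * F x (u x)) ->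
    u 0 = 0 -> v 0 = 1 -> u L != 0.
  move=> /andP[_ l1] Hode u0 v0; apply/eqP => uL.
  have : mu <= l.
    apply: Hmu; exists u.
      apply: (ode_dirichlet (ltW L0) Hode u0 uL).
      by apply: aeT => x _; rewrite /F mulrA.
    apply: contrapT => h; suff : v 0 = 0 by rewrite v0 => /eqP; rewrite oner_eq0.
    have [_ Hu _] := Hode.
    apply: (primitive_eq0 L0 Hu (ode_ucontv Hode)) => x xL.
    by apply/eqP/negP => /negP ux; apply: h; exists x.
  by move=> h; have := lt_le_trans mu1 (le_trans h l1); rewrite ltxx.
have [|K HK] := small_slope_positive L0 AF Lq q0 (ltr01 : 0 < (1 : R)).
  by move=> l u v l01 Hode u0 v0 _; exact: (H l u v).
pose N k := (K + k).+1; have N0 k : (0 < N k)%N by [].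
have kN k : (k < N k)%N by rewrite ltnS leq_addl.
have pos k j : (j <= N k)%N -> 0 <= eu L F (N k) 1 j.
  case: j => [|j] jN; first by rewrite eu0.
  by apply/ltW/HK => //; exact/leqW/leq_addr.
pose C := L * expR (L * itg q 0 L).
have C0 : 0 <= C by rewrite mulr_ge0 ?expR_ge0// ltW.
have [||||u [v [l [a [[Hode u0 va ub] Hap]]]]] := @euler_limit R L L0 q (C + 1) N
  (fun=> F) (fun l x s => l * F x s) (fun=> 1) (fun=> 1) Lq q0 kN (fun=> AF).
- by move=> k.
- by move=> k; rewrite normr1 lerDr.
- move=> k j jN; rewrite (pos k j jN)/= (le_trans (ler_norm _))//.
  apply: (le_trans (euler_gronwall L0 (N0 k) AF Lq q0 ler01 jN)).
  by rewrite mul1r lerDl.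
- move=> l x s e xL _ e0; have [d d0 Hd] := admissible_near l s AF xL e0.
  exists d => //; exists 0%N => k s' _ _ h1 h2.
  by have := Hd _ _ h1 h2; rewrite mul1r.
have a1 : a = 1 by apply: eq_eps => e e0; have [k _ []] := Hap e 0%N e0.
have l1 : l = 1 by apply: eq_eps => e e0; have [k _ []] := Hap e 0%N e0.
have uL : u L != 0.
  by apply: (H l u v _ Hode u0 (etrans va a1)); rewrite l1 ler01 lexx.
have Eq : (fun x => l * F x (u x)) = (fun x => q x * u x).
  by apply/funext => x; rewrite l1 mul1r.
rewrite Eq in Hode; exists u, v; split => //.
- by move=> x /ub/andP[].
- by rewrite lt_neqAle eq_sym uL/=; have /andP[] := ub L LL.
Qed.

(** [eps] precedes [F] and [r]: the radius on which f lies below [(q + eps) * s] can be chosen only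
    once [eps] is known. *)
Lemma admissible_small_slope (L : R) g q (y z : R -> R) : 0 < L ->
  ode 0 L y z (fun x => q x * y x) -> (forall x, x \in `[0, L] -> 0 <= y x) ->
  y 0 = 0 -> 0 < y L -> L1 0 L q -> (forall x, x \in `[0, L] -> 0 <= q x) ->
  L1 0 L g -> (forall x, x \in `[0, L] -> 0 <= g x) ->
  exists2 eps : R, 0 < eps & forall F (r : R), admissible L F g -> 0 < r ->
    {ae leb, forall x, x \in `[0, L] -> forall s, 0 <= s <= r ->
      F x s <= (q x + eps) * s} ->
    exists2 al : R, 0 < al & exists K, forall N, (K <= N)%N ->
      forall j, (0 < j <= N)%N -> 0 < eu L F N al j.
Proof.
move=> L0 Hy y0 ya yL Lq q0 Lg g0.
have [eps e0 He] := sublinear_trivial L0 Hy y0 ya yL Lg g0 Lq.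
exists eps => // F r AF r0 HF; have [_ _ gF] := AF.
pose C := L * expR (L * itg g 0 L).
have C0 : 0 < C by rewrite mulr_gt0// expR_gt0.
have al0 : 0 < r / C by exact: divr_gt0.
(* With this slope, Gronwall's constant [C] keeps solutions in [0, r], where the comparison with
   [q + eps] holds. *)
exists (r / C) => //; apply: (small_slope_positive L0 AF Lg g0 al0).
move=> l u v /andP[l0 l1] Hode u0 v0; rewrite -/C divfK ?(gt_eqF C0)// => ub.
apply/eqP => uL.
have l1' : `|l| <= 1 by rewrite ger0_norm.
have up x : x \in `[0, L] -> 0 <= u x by move=> /ub/andP[].
have [|||] := He u v _ Hode up u0 uL _ _ 0.
- apply: aeT => x xL; rewrite normrM -[leRHS]mul1r; apply: ler_pM => //.
  by apply: (le_trans (gF _ _ xL)); rewrite ger0_norm ?up.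
- apply: aeS HF => x HF xL; apply: (@le_trans _ _ (l * ((q x + eps) * u x))).
    by rewrite ler_wpM2l// HF// ub.
  rewrite -[leRHS]mul1r ler_wpM2r// mulr_ge0 ?up// addr_ge0 ?q0//.
  exact: ltW.
- by rewrite in_itv/= lexx ltW.
- by move=> _; rewrite v0 => /eqP; rewrite gt_eqF.
Qed.

End small_slopes.

(** * A priori bounds by scaling, and the solution of the truncated problem *)

Section global_shooting.
Context {R : realType} (L : R) (L_gt0 : 0 < L).
Implicit Types (u v p q : R -> R).
Variables (F : R -> R -> R) (g : R -> R).
Hypotheses (AF : admissible L F g) (Lg : L1 0 L g)
  (g0 : forall x, x \in `[0, L] -> 0 <= g x).

Lemma admissible_scale t : 0 < t ->
  admissible L (fun x s => t^-1 * F x (t * s)) g.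
Proof.
move=> t0; have [mF cF gF] := AF; split => [s|x xL s|x s xL].
- exact: (measurable_funM (measurable_cst _) (mF (t * s))).
- apply: cvgM; first exact: cvg_cst.
  apply: (@cvg_comp _ _ _ (fun r => t * r) (F x)); last exact: cF.
  exact: mulrl_continuous.
- rewrite normrM ger0_norm ?invr_ge0 ?(ltW t0)// mulrC ler_pdivrMr//.
  by apply: (le_trans (gF _ _ xL)); rewrite normrM (gtr0_norm t0) mulrCA mulrC.
Qed.

Lemma cell_itg_scale N t j s : 0 < t -> (j < N)%N ->
  cell_itg L (fun x s => t^-1 * F x (t * s)) N j s =
  t^-1 * cell_itg L F N j (t * s).
Proof.
move=> t0 jN; have N0 : (0 < N)%N by exact: leq_ltn_trans jN.
rewrite /cell_itg itgZ//; apply: (L1S _ _ (admissible_L1 AF Lg _)).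
  exact: node_ge0.
exact: node_leL.
Qed.

Lemma euler_scale N t al j : 0 < t -> (j < N)%N ->
  eu L (fun x s => t^-1 * F x (t * s)) N (t^-1 * al) j = t^-1 * eu L F N al j /\
  ev L (fun x s => t^-1 * F x (t * s)) N (t^-1 * al) j = t^-1 * ev L F N al j.
Proof.
move=> t0; elim: j => [|j IH] jN; first by rewrite !eu0 !ev0 mulr0.
have [hu hv] := IH (ltnW jN).
have hu' : eu L (fun x s => t^-1 * F x (t * s)) N (t^-1 * al) j.+1 =
    t^-1 * eu L F N al j.+1.
  by rewrite !euS hu hv mulrDr; congr (_ + _); rewrite mulrCA.
split; first exact: hu'.
rewrite !evS hu' hv mulrBr cell_itg_scale//; congr (_ - _ * cell_itg _ _ _ _ _).
by rewrite mulrA mulfV ?mul1r// gt_eqF.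
Qed.

Lemma eu_scale N t al j : 0 < t -> (j <= N)%N ->
  eu L (fun x s => t^-1 * F x (t * s)) N (t^-1 * al) j = t^-1 * eu L F N al j.
Proof.
move=> t0; case: j => [|j] jN; first by rewrite !eu0 mulr0.
have [hu hv] := euler_scale al t0 jN.
by rewrite !euS hu hv mulrDr; congr (_ + _); rewrite mulrCA.
Qed.

Section linear_at_infinity.
Variable (M : R).
Hypotheses (M0 : 0 < M)
  (FM : forall x s, x \in `[0, L] -> M <= s -> F x s = F x M / M * s).

Lemma linear_coef_le x : x \in `[0, L] -> `|F x M / M| <= g x.
Proof.
move=> xL; have [_ _ gF] := AF; rewrite normrM normfV (gtr0_norm M0).
by rewrite ler_pdivrMr// (le_trans (gF _ _ xL))// gtr0_norm.
Qed.

(** The two terms coincide when [M <= t * s]; otherwise [s <= M / t] and each of them is at most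
    [g x * (M / t)]. *)
Lemma scale_limit x s t : x \in `[0, L] -> 0 < t -> 0 <= s ->
  `|F x M / M * s - t^-1 * F x (t * s)| <= 2 * g x * M / t.
Proof.
move=> xL t0 s0; have [_ _ gF] := AF.
have [h|h] := leP M (t * s).
  rewrite (FM xL h) [t^-1 * _]mulrCA mulKf ?gt_eqF//.
  by rewrite subrr normr0 !mulr_ge0 ?invr_ge0 ?g0 ?ltW.
have sM : s <= M / t by rewrite ler_pdivlMr// mulrC ltW.
apply: (le_trans (ler_normB _ _)).
have h1 : `|F x M / M * s| <= g x * (M / t).
  by rewrite normrM ler_pM ?linear_coef_le// ger0_norm.
have h2 : `|t^-1 * F x (t * s)| <= g x * (M / t).
  rewrite normrM ger0_norm ?invr_ge0 ?(ltW t0)// mulrC mulrA ler_wpM2r//.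
    by rewrite invr_ge0 ltW.
  apply: (le_trans (gF _ _ xL)); rewrite ger0_norm ?mulr_ge0 ?(ltW t0)//.
  by rewrite ler_wpM2l ?g0// ltW.
by apply: (le_trans (lerD h1 h2)); rewrite -!mulrA mulr_natl mulr2n.
Qed.

(* Unbounded discrete solutions would converge, once normalised, to a nonzero
   solution of the equation linearised at infinity. *)
Lemma discrete_bounded :
  (forall u v, ode 0 L u v (fun x => F x M / M * u x) -> u 0 = 0 ->
    (forall x, x \in `[0, L] -> 0 <= u x) ->
    forall x, x \in `[0, L] -> u x = 0) ->
  exists B : R, exists K, forall N al, (K <= N)%N -> 0 <= al ->
    (forall j, (j <= N)%N -> 0 <= eu L F N al j) ->
    forall j, (j <= N)%N -> eu L F N al j <= B.
Proof.
move=> H; apply: contrapT => /forallNP H1.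
(* [z] packs the number of steps, the slope and a node where the discrete solution is maximal. *)
have H2 k : exists z : nat * R * nat, [/\ (k < z.1.1)%N, 0 <= z.1.2,
    forall j, (j <= z.1.1)%N -> 0 <= eu L F z.1.1 z.1.2 j <= eu L F z.1.1 z.1.2 z.2,
    (z.2 <= z.1.1)%N & k.+1%:R < eu L F z.1.1 z.1.2 z.2].
  have /forallNP/(_ k.+1)/existsNP[N /existsNP[al]] := H1 k.+1%:R.
  move=> /not_implyP[kN] /not_implyP[al0] /not_implyP[ge0] /existsNP[j].
  move=> /not_implyP[jN] /negP; rewrite -ltNge => hj.
  have [i _ hi] := @arg_maxP _ R 'I_N.+1 ord0 xpredT (fun i => eu L F N al i) isT.
  have le_max l : (l <= N)%N -> eu L F N al l <= eu L F N al i.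
    by move=> lN; exact: (hi (Ordinal (lN : (l < N.+1)%N)) isT).
  exists (N, al, nat_of_ord i); split => //=.
  - by move=> l lN; rewrite ge0//= le_max.
  - by rewrite -ltnS ltn_ord.
  - exact: lt_le_trans hj (le_max _ jN).
have [z Hz] := choice H2; pose N k := (z k).1.1.
pose t k := eu L F (N k) (z k).1.2 (z k).2.
have kN k : (k < N k)%N by have [] := Hz k.
have N0 k : (0 < N k)%N by exact: leq_ltn_trans (kN k).
have tk k : k.+1%:R < t k by have [] := Hz k.
have t0 k : 0 < t k by apply: lt_trans (tk k); rewrite ltr0n.
pose Fk k x s := (t k)^-1 * F x (t k * s).
have AFk k : admissible L (Fk k) g by exact: admissible_scale.
have [||||u [v [l [a [[Hode u0 va ub] Hap]]]]] := @euler_limit R L L_gt0 g 1 N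
  Fk (fun _ x s => F x M / M * s) (fun k => (t k)^-1 * (z k).1.2) (fun=> 0)
  Lg g0 kN AFk.
- move=> k; have [_ al0 _ _ _] := Hz k.
  by rewrite mulr_ge0// invr_ge0 ltW.
- by move=> k; rewrite normr0.
- move=> k j jN; rewrite /Fk (eu_scale _ (t0 k) jN).
  have [_ _ /(_ j jN)/andP[h1 h2] _ _] := Hz k.
  rewrite mulr_ge0 ?invr_ge0 ?(ltW (t0 k))//=.
  by rewrite mulrC ler_pdivrMr// mul1r.
- move=> l x s e xL s0 e0.
  have G0 : 0 < 2 * (g x + 1) by rewrite mulr_gt0// ltr_wpDl ?g0.
  (* Half of [e] pays for moving [s], the other half for [scale_limit], whose error vanishes because
     [t k > k.+1]. *)
  exists (e / (2 * (g x + 1))); first exact: divr_gt0.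
  exists (Num.truncn (2 * (2 * g x * M) / e)) => k s' kk s'0 _ ss.
  have gM : 0 <= 2 * (2 * g x * M) by rewrite !mulr_ge0 ?g0 ?ltW.
  have h1 : `|F x M / M * (s - s')| <= (g x + 1) * `|s - s'|.
    by rewrite normrM ler_wpM2r// (le_trans (linear_coef_le xL))// lerDl.
  have h2 := scale_limit xL (t0 k) s'0.
  have h3 : (g x + 1) * `|s - s'| < e / 2.
    by rewrite mulrC -ltr_pdivlMr ?ltr_wpDl ?g0// -mulrA -invfM.
  have h4 : 2 * g x * M / t k < e / 2.
    have /andP[_ h] := truncn_itv (divr_ge0 gM (ltW e0)).
    have : 2 * (2 * g x * M) / e < t k.
      by apply: (lt_trans (lt_le_trans h _) (tk k)); rewrite ler_nat.
    rewrite ltr_pdivrMr// => h5; rewrite ltr_pdivrMr// [e / 2 * _]mulrAC ltr_pdivlMr//.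
    by rewrite mulrC [e * _]mulrC.
  rewrite /Fk (_ : F x M / M * s = F x M / M * (s - s') + F x M / M * s'); last first.
    by rewrite -mulrDr subrK.
  rewrite -addrA (le_lt_trans (ler_normD _ _))//.
  by rewrite [e]splitr ltr_leD ?(le_lt_trans h1)// (le_trans h2)// ltW.
have ua := H u v Hode u0 (fun x xL => let: conj h _ := andP (ub x xL) in h).
(* At its maximal node the normalised discrete solution equals 1, yet it should be within 1/2 of the
   zero limit. *)
have half : 0 < 2^-1 :> R by rewrite invr_gt0.
have [k _ [_ _ Hk]] := Hap _ 0%N half.
have [_ _ _ jN _] := Hz k.
have := Hk _ (node_in L_gt0 (N0 k) jN).
rewrite ua ?(node_in L_gt0)// (cell_node L_gt0)// /Fk (eu_scale _ (t0 k) jN).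
rewrite -/(t k) mulVf ?gt_eqF// sub0r normrN normr1.
by rewrite ltNge invf_le1// ler1n.
Qed.

End linear_at_infinity.

(** All slopes used by the shooting are at least [al0]; the bound passes to the limit and keeps it
    away from the trivial solution. *)
Lemma shooting_solution (al0 B : R) K : 0 < al0 ->
  (forall N, (K <= N)%N -> forall j, (0 < j <= N)%N -> 0 < eu L F N al0 j) ->
  (forall N al, (K <= N)%N -> 0 <= al ->
    (forall j, (j <= N)%N -> 0 <= eu L F N al j) ->
    forall j, (j <= N)%N -> eu L F N al j <= B) ->
  exists u v, [/\ ode 0 L u v (fun x => F x (u x)), u 0 = 0, u L = 0,
    al0 <= v 0 & forall x, x \in `[0, L] -> 0 <= u x].
Proof.
move=> al0_gt0 Hpos Hbd.
pose N k := (K + k).+1; have N0 k : (0 < N k)%N by [].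
have kN k : (k < N k)%N by rewrite ltnS leq_addl.
have KN k : (K <= N k)%N by exact/leqW/leq_addr.
have F1 : (fun x s => 1 * F x s) = F.
  by apply/funext => x; apply/funext => s; rewrite mul1r.
have H3 k : exists t : R, [/\ al0 <= t,
    forall j, (j <= N k)%N -> 0 <= eu L F (N k) t j & eu L F (N k) t (N k) = 0].
  have c1 : continuous (fun _ : R => (1 : R)) by exact: cst_continuous.
  have cid : continuous (fun t : R => t) by move=> t; exact: cvg_id.
  have m0 := mesh_gt0 L_gt0 (N0 k).
  (* Makes the first nodal value exceed [B], so that by the a priori bound some nodal value is
     negative. *)
  pose t1 := al0 + (`|B| + 1) / mesh L (N k).
  have t01 : al0 <= t1 by rewrite lerDl divr_ge0 ?(ltW m0)// addr_ge0.
  have := discrete_shooting L_gt0 (N0 k) AF Lg g0 c1 cid t01.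
  rewrite F1; case.
  - by move=> t; rewrite in_itv/= => /andP[h _]; exact: lt_le_trans h.
  - exact: Hpos.
  - apply: contrapT => h.
    have h' j : (j <= N k)%N -> 0 <= eu L F (N k) t1 j.
      case: j => [|j] jN; first by rewrite eu0.
      by rewrite leNgt; apply/negP => uj; apply: h; exists j.+1 => //; exact: ltW.
    have := Hbd _ _ (KN k) (le_trans (ltW al0_gt0) t01) h' 1%N (N0 k).
    rewrite euS eu0 ev0 add0r /t1 mulrDr [_ * (_ / _)]mulrC divfK ?gt_eqF// [_ * al0]mulrC.
    have := ler_norm B; have := mulr_gt0 al0_gt0 m0.
    by move: `|B| (al0 * _) => nB am; lra.
  - move=> t tin [h1 h2]; exists t; split => //.
    by move: tin; rewrite in_itv/= => /andP[].
have [t Ht] := choice H3.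
have t_gt0 k : 0 <= t k by have [h _ _] := Ht k; exact: le_trans (ltW al0_gt0) h.
have uB k j : (j <= N k)%N -> 0 <= eu L F (N k) (t k) j <= B.
  by move=> jN; have [_ h _] := Ht k; rewrite h//= (Hbd _ _ (KN k) (t_gt0 k)).
have [||u [v [l [a [[Hode u0 va ub] Hap]]]]] := @euler_limit R L L_gt0 g B N
  (fun=> F) (fun _ => F) t (fun=> 0) Lg g0 kN (fun=> AF) t_gt0 _ uB.
- move=> k; rewrite normr0.
  by have /andP[h1 h2] := uB 0%N 0%N (leq0n _); exact: le_trans h2.
- move=> l x s e xL _ e0; have [d d0 Hd] := admissible_near 1 s AF xL e0.
  exists d => //; exists 0%N => k s' _ _ _ h2.
  by have := Hd 1 _ _ h2; rewrite !mul1r; apply; rewrite subrr normr0.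
have LL : L \in `[0, L] by rewrite in_itv/= lexx ltW.
exists u, v; split => //.
- apply: eq_eps => e e0; have [k _ [_ _ /(_ L LL)]] := Hap e 0%N e0.
  have -> : cell L (N k) L = N k.
    by have := cell_node L_gt0 (N k) (N0 k); rewrite nodeN.
  by have [_ _ ->] := Ht k.
- rewrite va; apply/ler_addgt0Pr => e e0; have [k _ [h _ _]] := Hap e 0%N e0.
  have [h1 _ _] := Ht k; apply: (le_trans h1).
  by rewrite -lerBlDl ltW// (le_lt_trans _ h)// distrC ler_norm.
- by move=> x /ub/andP[].
Qed.

End global_shooting.

(** * Truncation of the nonlinearity *)

Section linear_extension.
Context {R : realType}.
Implicit Types (h : R -> R) (M s c d e q : R).

(* The extrapolation beyond [M] is linear so that [h (t * s) / t] converges as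
   [t] goes to infinity. *)
Definition linear_extension M h s :=
  h (Num.max 0 (Num.min s M)) * (Num.max s M / M).

Lemma linear_extension_continuous M h : 0 < M ->
  {within `[0, +oo[, continuous h} -> continuous (linear_extension M h).
Proof.
move=> M0 /subspace_continuousP ch s.
pose c s' : R := Num.max 0 (Num.min s' M).
have c0 s' : `[0, +oo[%classic (c s') by rewrite /= in_itv/= andbT le_max lexx.
have c0' : {for s, continuous (cst (0 : R))} by exact: cvg_cst.
have cM : {for s, continuous (cst (M : R))} by exact: cvg_cst.
have ci : {for s, continuous (@idfun R)} by exact: cvg_id.
have cc : c @ s --> c s := continuous_max c0' (continuous_min ci cM).
apply: cvgM.
  have cw : c @ s --> within `[0, +oo[ (nbhs (c s)).
    move=> A hA; have H : \forall s' \near s, `[0, +oo[%classic (c s') -> A (c s').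
      exact: (cc _ hA).
    change (\forall s' \near s, A (c s')).
    by apply: filterS H => s'; apply; exact: c0.
  exact: (cvg_comp c h cw (ch _ (c0 s))).
exact: (cvgMl (continuous_max ci cM)).
Qed.

Lemma linear_extension_id M h s : 0 < M -> 0 <= s <= M ->
  linear_extension M h s = h s.
Proof.
move=> M0 /andP[s0 sM]; rewrite /linear_extension (min_idPl sM) (max_idPr s0).
by rewrite (max_idPr sM) divff ?gt_eqF// mulr1.
Qed.

Lemma linear_extension_linear M h s : 0 < M -> M <= s ->
  linear_extension M h s = h M / M * s.
Proof.
move=> M0 Ms; rewrite /linear_extension (min_idPr Ms) (max_idPr (ltW M0)).
by rewrite (max_idPl Ms) mulrA mulrAC.
Qed.

Lemma linear_extension_le0 M h s : 0 < M -> h 0 = 0 -> s <= 0 ->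
  linear_extension M h s = 0.
Proof.
move=> M0 h0 s0; rewrite /linear_extension (min_idPl (le_trans s0 (ltW M0))).
by rewrite (max_idPl s0) h0 mul0r.
Qed.

(** Below [d] the slope bound [c] applies; between [d] and [M] one has [C <= C / d * s]; beyond [M]
    the slope is at most [C / M <= C / d]. *)
Lemma linear_extension_norm_le M h c d (C : R) s : 0 < d -> d <= M -> h 0 = 0 ->
  0 <= c -> 0 <= C -> (forall s, 0 < s < d -> `|h s| <= c * s) ->
  (forall s, 0 <= s <= M -> `|h s| <= C) ->
  `|linear_extension M h s| <= (c + C / d) * `|s|.
Proof.
move=> d0 dM h0 c0 C0 H1 H2; have M0 := lt_le_trans d0 dM.
have Cd : 0 <= C / d by exact: divr_ge0 C0 (ltW d0).
have [s0|s0] := leP s 0.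
  by rewrite linear_extension_le0// normr0 mulr_ge0// addr_ge0.
rewrite (gtr0_norm s0) mulrDl.
have [sM|Ms] := leP s M.
  rewrite linear_extension_id ?(ltW s0)//; have [sd|ds] := ltP s d.
    by apply: (le_trans (H1 s _)); rewrite ?s0// lerDl mulr_ge0// ltW.
  apply: (le_trans (H2 s _)); first by rewrite (ltW s0).
  apply: (@le_trans _ _ (C / d * s)); last by rewrite lerDr mulr_ge0// ltW.
  by rewrite -mulrA ler_peMr// mulrC ler_pdivlMr// mul1r.
rewrite (linear_extension_linear _ M0 (ltW Ms)) normrM (gtr0_norm s0).
apply: (@le_trans _ _ (C / d * s)); last by rewrite lerDr mulr_ge0// ltW.
rewrite ler_wpM2r ?(ltW s0)// normrM normfV (gtr0_norm M0).
apply: ler_pM => //; first by rewrite invr_ge0 ltW.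
  by apply: H2; rewrite lexx (ltW M0).
by rewrite lef_pV2.
Qed.

Lemma linear_extension_ge0 M h s : 0 < M -> (forall s, 0 <= s -> 0 <= h s) ->
  0 <= linear_extension M h s.
Proof.
move=> M0 h0; rewrite mulr_ge0 ?h0 ?le_max ?lexx// divr_ge0 ?(ltW M0)//.
by rewrite le_max (ltW M0) orbT.
Qed.

Lemma linear_extension_npos M h s : 0 < M -> (forall s, 0 <= s -> h s <= 0) ->
  linear_extension M h s <= 0.
Proof.
move=> M0 h0; rewrite mulr_le0_ge0 ?h0 ?le_max ?lexx// divr_ge0 ?(ltW M0)//.
by rewrite le_max (ltW M0) orbT.
Qed.

(** The term [S * q] absorbs the range [s < S], where only the sign of [h] is known. The estimate is
    uniform in [M]. *)
Lemma linear_extension_superlinear M h q e (S : R) s : 0 < S -> S <= M -> 0 <= q -> 0 <= e ->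
  (forall s, 0 <= s -> 0 <= h s) -> (forall s, S <= s -> (q - e) <= h s / s) ->
  0 <= s -> (q - e) * s - S * q <= linear_extension M h s.
Proof.
move=> S0 SM q0 e0 h0 H s0; have M0 := lt_le_trans S0 SM.
have Sq : 0 <= S * q by rewrite mulr_ge0// ltW.
have [Ms|sM] := leP M s.
  rewrite linear_extension_linear// lerBlDr (le_trans (ler_wpM2r s0 (H M SM)))//.
  by rewrite lerDl.
have [Ss|sS] := leP S s.
  rewrite linear_extension_id ?s0 ?(ltW sM)//.
  have s_gt0 := lt_le_trans S0 Ss.
  by have := H s Ss; rewrite ler_pdivlMr// => h1; rewrite lerBlDr (le_trans h1)// lerDl.
apply: (le_trans _ (linear_extension_ge0 s M0 h0)).
rewrite subr_le0 mulrBl (@le_trans _ _ (q * s))//; first by rewrite gerBl mulr_ge0.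
by rewrite mulrC ler_wpM2r// ltW.
Qed.

End linear_extension.

Section truncation.
Context {R : realType}.
Implicit Types (u v p q : R -> R) (f : R -> R -> R) (a b : R).

Lemma at_right0_ball (U : set R) : 0^'+ U ->
  exists2 d : R, 0 < d & forall s, 0 < s < d -> U s.
Proof.
move=> /nbhs_ballP[d /= d0 H]; exists d => // s /andP[s0 sd].
by apply: (H s _ s0); rewrite -ball_normE /ball_/= sub0r normrN gtr0_norm.
Qed.

(** [superlinear_bound] is used twice: with constant 0 it annihilates nonnegative solutions of the
    equation linearised at infinity, with the threshold [S] it bounds those of the truncated one. *)
Lemma truncated_superlinear a b f q (mu : R) : a <= b -> L1_nonneg `[a, b] q ->
  unif_liminf_ge +oo%R `[a, b] f q -> dirichlet_eigenvalue a b q mu -> mu < 1 ->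
  {ae leb, forall x, x \in `[a, b] -> forall s, 0 <= s -> 0 <= f x s} ->
  a < b /\ exists2 S : R, 0 < S & forall M u v p, S <= M ->
    ode a b u v p -> (forall x, x \in `[a, b] -> 0 <= u x) ->
    ({ae leb, forall x, x \in `[a, b] -> p x = f x M / M * u x} ->
      forall x, x \in `[a, b] -> u x = 0) /\
    ({ae leb, forall x, x \in `[a, b] -> p x = linear_extension M (f x) (u x)} ->
      forall x, x \in `[a, b] -> u x <= M).
Proof.
move=> ab [Lq q0] Hf Hmu mu1 f0.
have ab' : a < b.
  rewrite lt_neqAle ab andbT; apply/eqP => E.
  have [phi [_ _ pa _] [x]] := Hmu; rewrite -E in_itv/= -eq_le => /eqP <-.
  by rewrite pa eqxx.
split => //.
have [eps e0 [K K0 HK]] := superlinear_bound ab' Lq q0 Hmu mu1.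
have [U [S0 [_ HU]] HfU] := Hf eps e0.
pose S := Num.max 0 S0 + 1.
have S_gt0 : 0 < S by rewrite ltr_wpDl// le_max lexx.
have SU s : S <= s -> U s.
  by move=> Ss; apply: HU; rewrite (lt_le_trans _ Ss)// ltr_pwDr// le_max lexx orbT.
(* Large enough to dominate both the threshold [S] and the a priori bound [K * S]. *)
exists (S * (K + 1)); first by rewrite mulr_gt0// ltr_wpDl.
move=> M u v p SM Hode u0.
have SM' : S <= M by apply: le_trans SM; rewrite ler_peMr ?lerDr// ltW.
have M0 := lt_le_trans S_gt0 SM'.
split => Hp x xab.
  apply/eqP; rewrite eq_le u0// andbT.
  have := HK 0 u v p (lexx 0) Hode u0; rewrite mulr0; apply => //.
    apply: aeS2 Hp f0 => t Hp f0 tab; rewrite Hp// mulr_ge0 ?u0//.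
    by rewrite divr_ge0 ?(ltW M0)// f0// ltW.
  apply: aeS2 Hp HfU => t Hp Ht tab.
  by rewrite Hp// mul0r subr0 ler_wpM2r ?u0// Ht//; exact: SU.
have hb : u x <= K * S.
  apply: (HK S u v p (ltW S_gt0) Hode u0) => //.
    apply: aeS2 Hp f0 => t Hp f0 tab; rewrite Hp//.
    by apply: linear_extension_ge0 => // s s0; exact: f0.
  have h3 : {ae leb, forall x, (x \in `[a, b] -> forall s, 0 <= s -> 0 <= f x s) /\
      (x \in `[a, b] -> forall s, U s -> q x - eps <= f x s / s)}.
    by apply: aeS2 f0 HfU.
  apply: aeS2 Hp h3 => t Hp [ft Ut] tab; rewrite Hp//.
  apply: (linear_extension_superlinear S_gt0 SM' _ (ltW e0)).
  - exact: q0.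
  - exact: ft.
  - by move=> s Ss; apply: Ut => //; exact: SU.
  - exact: u0.
apply: (le_trans hb); apply: le_trans SM.
by rewrite mulrC ler_wpM2l ?(ltW S_gt0)// lerDl.
Qed.

Lemma ae_neq (c : R) : {ae leb, forall x : R, x != c}.
Proof.
exists [set c; c]; split; [| exact: leb_pair|].
  by apply: lmeas; apply: measurableU; exact: measurable_set1.
by move=> x /= /negP; rewrite negbK => /eqP ->; left.
Qed.

Lemma lebesgue_measurable_ae (D : set R) (h k : R -> R) :
  lebesgue_measurable_fun D h -> {ae leb, forall x, D x -> h x = k x} ->
  lebesgue_measurable_fun D k.
Proof.
move=> /measurable_EFinP mh hk; apply/measurable_EFinP.
apply: (ae_measurable_fun (completed_lebesgue_measure_is_complete (R := R)) _ mh).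
by apply: aeS hk => x hk Dx; rewrite /= hk.
Qed.

(* [u] attains its maximum inside the intervals, at an endpoint, or in a gap;
   in a gap [u] is convex, hence bounded by its value at the left end. *)
Lemma bound_outside_gaps (L M : R) n (a b : 'I_n -> R) u v p : 0 < L -> 0 <= M ->
  ode 0 L u v p -> u 0 = 0 -> u L = 0 ->
  (forall i, [/\ 0 <= a i, a i <= b i & b i <= L]) ->
  (forall i x, x \in `[a i, b i] -> u x <= M) ->
  {ae leb, forall x, x \in `[0, L] -> ~ (exists i, x \in `[a i, b i]) -> p x <= 0} ->
  forall x, x \in `[0, L] -> u x <= M.
Proof.
move=> L0 M0 Hode u0 uL ab_sub uM pneg.
have [c cL cmax] := ucont_max (ltW L0) (ode_ucontu (ltW L0) Hode).
suff : u c <= M by move=> h x xL; exact: le_trans (cmax x xL) h.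
have [Lp Hu Hv] := Hode; have cv := ode_ucontv Hode.
have [->|c0] := eqVneq c 0; first by rewrite u0.
have [->|c1] := eqVneq c L; first by rewrite uL.
have [[i ci]|nc] := pselect (exists i, c \in `[a i, b i]); first exact: uM ci.
move: (cL); rewrite in_itv/= => /andP[c_ge0 c_leL].
have vc : v c = 0.
  by apply: (interior_max Hu cv _ cmax); rewrite in_itv/= !lt_neqAle eq_sym c0 c_ge0 c1.
pose l := \big[Num.max/0]_(i | b i <= c) b i.
have [[l0 lc] ul] : (0 <= l /\ l <= c) /\ u l <= M.
  apply: (big_ind (fun z => (0 <= z /\ z <= c) /\ u z <= M)).
  - by rewrite u0.
  - by move=> y z Hy Hz; rewrite /Num.max; case: ifP.
  - move=> i bc; have [h1 h2 _] := ab_sub i; split; first by rewrite (le_trans h1).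
    by apply: (uM i); rewrite in_itv/= h2 lexx.
have gap x : l < x -> x <= c -> ~ (exists i, x \in `[a i, b i]).
  move=> lx xc [i]; rewrite in_itv/= => /andP[ax xb].
  have [bc|cb] := leP (b i) c.
    have : b i <= l by exact: le_bigmax_cond.
    by move=> /(le_trans xb); rewrite leNgt lx.
  by apply: nc; exists i; rewrite in_itv/= (le_trans ax xc) ltW.
(* Between [l], the last right end before [c] or 0, and [c] the slope is nondecreasing and reaches 0
   at the maximum point [c]; hence [u] is nonincreasing there and [u c <= u l]. *)
have v_le0 x : l <= x -> x <= c -> v x <= 0.
  move=> lx xc; have x0 := le_trans l0 lx.
  have := Hv x c x0 xc c_leL; rewrite vc sub0r (itgN (L1S x0 c_leL Lp)) => /oppr_inj ->.
  rewrite -(_ : itg (fun=> 0) x c = 0); last by rewrite itg_cst// mul0r.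
  apply: le_itg; [exact: L1S x0 c_leL Lp|exact: L1_cst|].
  apply: aeS2 pneg (ae_neq l) => t pn tl; rewrite in_itv/= => /andP[xt tc].
  apply: pn; first by rewrite in_itv/= (le_trans x0 xt) (le_trans tc).
  by apply: gap => //; rewrite lt_neqAle eq_sym tl (le_trans lx).
apply: le_trans ul; rewrite -subr_le0 (Hu l c l0 lc c_leL).
rewrite -(_ : itg (fun=> 0) l c = 0); last by rewrite itg_cst// mul0r.
apply: le_itg; [exact: L1S l0 c_leL (ucont_L1 (ltW L0) cv)|exact: L1_cst|].
by apply: aeT => t; rewrite in_itv/= => /andP[lt tc]; exact: v_le0.
Qed.

Lemma norm_le_of_quotient (s r c d : R) : 0 < s -> 0 <= c -> 0 <= d ->
  - c - 1 <= r / s -> r / s <= d + 1 -> `|r| <= (c + d + 1) * s.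
Proof.
move=> s0 c0 d0; rewrite ler_pdivlMr// ler_pdivrMr// ler_norml => h1 h2.
have := mulr_ge0 c0 (ltW s0); have := mulr_ge0 d0 (ltW s0).
by move=> *; apply/andP; split; lra.
Qed.

End truncation.

(** * Existence of a positive solution *)

Theorem theorem3p1 (R : realType) (L : R) (L_gt0 : 0 < L) (f : R -> R -> R)
  (f_car : L1_caratheodory L f)
  (f_star : {ae leb, forall x, x \in `[0, L] -> f x 0 = 0})
  (f_0minus : exists2 q : R -> R, L1_nonneg `[0, L] q &
     unif_liminf_ge 0^'+ `[0, L] f (fun x => - q x))
  (f_0plus : exists q : R -> R,
     [/\ L1_nonneg `[0, L] q, not_ae_zero `[0, L] q,
         unif_limsup_le 0^'+ `[0, L] f q &
         exists2 mu, first_eigenvalue 0 L q mu & 1 < mu])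
  (n : nat) (n_gt0 : (0 < n)%N) (a b : 'I_n -> R)
  (ab_sub : forall i, [/\ 0 <= a i, a i <= b i & b i <= L])
  (ab_disj : trivIset setT (fun i => [set` `[a i, b i]]))
  (f_pos : {ae leb, forall x, (exists i, x \in `[a i, b i]) ->
     forall s, 0 <= s -> 0 <= f x s})
  (f_neg : {ae leb, forall x, x \in `[0, L] ->
     ~ (exists i, x \in `[a i, b i]) -> forall s, 0 <= s -> f x s <= 0})
  (f_infty : forall i, exists q : R -> R,
     [/\ L1_nonneg `[a i, b i] q, not_ae_zero `[a i, b i] q,
         unif_liminf_ge +oo%R `[a i, b i] f q &
         exists2 mu, first_eigenvalue (a i) (b i) q mu & mu < 1]) :
  exists u : R -> R,
    [/\ dirichlet_solution 0 L f u,
        forall x, x \in `[0, L] -> 0 <= u x &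
        forall x, x \in `]0, L[ -> 0 < u x].
Proof.
have L0 := ltW L_gt0.
have HS i : exists S : R, a i < b i /\ 0 < S /\ forall M u v p, S <= M ->
    ode (a i) (b i) u v p -> (forall x, x \in `[a i, b i] -> 0 <= u x) ->
    ({ae leb, forall x, x \in `[a i, b i] -> p x = f x M / M * u x} ->
      forall x, x \in `[a i, b i] -> u x = 0) /\
    ({ae leb, forall x, x \in `[a i, b i] -> p x = linear_extension M (f x) (u x)} ->
      forall x, x \in `[a i, b i] -> u x <= M).
  have [_ ab _] := ab_sub i; have [q [Lq _ Hq [mu [Hmu _] mu1]]] := f_infty i.
  have [|ab' [S S0 H]] := truncated_superlinear ab Lq Hq Hmu mu1.
    by apply: aeS f_pos => x f_pos xi; apply: f_pos; exists i.
  by exists S.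
have [S {}HS] := choice HS.
(* The sum is a convenient upper bound of all the thresholds [S i]. *)
pose M := \sum_i S i.
have S0 i : 0 <= S i by have [_ [h _]] := HS i; exact: ltW.
have SM i : S i <= M by rewrite /M (bigD1 i)//= lerDl sumr_ge0.
have M0 : 0 < M.
  by have [_ [h _]] := HS (Ordinal n_gt0); exact: lt_le_trans h (SM _).
have [f_meas f_cont /(_ M M0)[gam [Lgam gam0] f_gam]] := f_car.
have [qm [Lqm qm0] /(_ 1 ltr01)[U1 /at_right0_ball[d1 d10 HU1] f_U1]] := f_0minus.
have [q0 [[Lq0 q00] _ Hq0 [mu [_ Hmu] mu1]]] := f_0plus.
have [U2 /at_right0_ball[d2 d20 HU2] f_U2] := Hq0 1 ltr01.
pose d := Num.min (Num.min d1 d2) M.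
have d0 : 0 < d by rewrite !lt_min d10 d20 M0.
have dM : d <= M by rewrite ge_min lexx orbT.
(* The two conditions at 0, with tolerance 1, bound [f x s] by [c x * s] for [s < d]; [g] is then
   the coefficient of [linear_extension_norm_le]. *)
pose c x := qm x + q0 x + 1.
pose g x := c x + d^-1 * gam x.
have c0 x : x \in `[0, L] -> 0 <= c x.
  by move=> xL; rewrite !addr_ge0 ?qm0 ?q00.
have g0 x : x \in `[0, L] -> 0 <= g x.
  by move=> xL; rewrite addr_ge0 ?c0// mulr_ge0 ?gam0// invr_ge0 ltW.
have Lg : L1 0 L g by exact: L1D (L1D (L1D Lqm Lq0) (L1_cst _ _ _)) (L1Z _ Lgam).
have [y [z [Hy y0 ya yL]]] := linear_comparison L_gt0 Lq0 q00 Hmu mu1.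
have [eps e0 Hslope] := admissible_small_slope L_gt0 Hy y0 ya yL Lq0 q00 Lg g0.
(* Second use of the upper condition at 0, now with a tolerance that depends on [g]. *)
have [U3 /at_right0_ball[d3 d30 HU3] f_U3] := Hq0 eps e0.
(* [f] is replaced by [0] on a null set, so that the bounds of [admissible] hold
   at every [x]. *)
pose good x := [/\ {within `[0, +oo[, continuous (f x)}, f x 0 = 0,
  forall s, 0 < s < d -> `|f x s| <= c x * s &
  forall s, 0 <= s <= M -> `|f x s| <= gam x].
have Hgood : {ae leb, forall x, x \in `[0, L] -> good x}.
  have h1 : {ae leb, forall x, x \in `[0, L] ->
      {within `[0, +oo[, continuous (f x)} /\ f x 0 = 0}.
    by apply: aeS2 f_cont f_star => x h1 h2 xL; split; [exact: h1|exact: h2].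
  have h2 : {ae leb, forall x, x \in `[0, L] ->
      forall s, 0 < s < d -> `|f x s| <= c x * s}.
    apply: aeS2 f_U1 f_U2 => x k1 k2 xL s /andP[s0].
    rewrite !lt_min => /andP[/andP[s1 s2] _].
    have := k1 xL s (HU1 s _); rewrite s0 s1 => /(_ isT) h3.
    have := k2 xL s (HU2 s _); rewrite s0 s2 => /(_ isT) h4.
    exact: (norm_le_of_quotient s0 (qm0 x xL) (q00 x xL) h3 h4).
  have h3 : {ae leb, forall x, x \in `[0, L] ->
      (forall s, 0 < s < d -> `|f x s| <= c x * s) /\
      (forall s, 0 <= s <= M -> `|f x s| <= gam x)}.
    by apply: aeS2 h2 f_gam => x k2 k3 xL; split; [exact: k2|exact: k3].
  apply: aeS2 h1 h3 => x k1 k3 xL.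
  by have [? ?] := k1 xL; have [? ?] := k3 xL.
pose F x s := if `[< good x >] then linear_extension M (f x) s else 0.
have FE x s : good x -> F x s = linear_extension M (f x) s.
  by move=> gx; rewrite /F asboolT.
have Fid x s : good x -> 0 <= s <= M -> F x s = f x s.
  by move=> gx sM; rewrite FE// linear_extension_id.
have AF : admissible L F g.
  split => [s|x xL|x s xL].
  - have cs : 0 <= Num.max 0 (Num.min s M) by rewrite le_max lexx.
    apply: (lebesgue_measurable_ae (h := fun x => linear_extension M (f x) s)).
      exact: (measurable_funM (f_meas _ cs) (measurable_cst _)).
    by apply: aeS Hgood => x gx /gx {}gx; rewrite FE.
  - have [gx|gx] := pselect (good x).
      rewrite (_ : F x = linear_extension M (f x)); last first.
        by apply/funext => s; exact: FE.
      by have [cx _ _ _] := gx; exact: linear_extension_continuous.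
    rewrite (_ : F x = cst 0); first exact: cst_continuous.
    by apply/funext => s; rewrite /F asboolF.
  - have [gx|gx] := pselect (good x); last first.
      by rewrite /F asboolF// normr0 mulr_ge0 ?g0.
    have [_ fx0 h1 h2] := gx; rewrite FE// /g [d^-1 * _]mulrC.
    exact: (linear_extension_norm_le _ d0 dM fx0 (c0 x xL) (gam0 x xL) h1 h2).
have FM x s : x \in `[0, L] -> M <= s -> F x s = F x M / M * s.
  move=> _ Ms; rewrite /F; case: asboolP => _; last by rewrite mul0r mul0r.
  rewrite linear_extension_linear// linear_extension_id//.
  by rewrite (ltW M0) lexx.
have sub i x : x \in `[a i, b i] -> x \in `[0, L].
  have [ha _ hb] := ab_sub i.
  by rewrite !in_itv/= => /andP[ax xb]; rewrite (le_trans ha)// (le_trans xb).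
(* Below [d3] the comparison with [q0 + eps] holds, up to [M] the truncation agrees with f; halving
   makes the first bound strict. *)
have [||al0 al00 [K1 HK1]] := Hslope F (Num.min d3 M / 2) AF.
- by rewrite divr_gt0// lt_min d30.
- apply: aeS2 f_U3 Hgood => x h1 gx xL s /andP[s_ge0 sr].
  have [sd sM] : s < d3 /\ s <= M.
    have m0 : 0 < Num.min d3 M by rewrite lt_min d30.
    have : s < Num.min d3 M.
      by apply: (le_lt_trans sr); rewrite ltr_pdivrMr// ltr_pMr// ltr1n.
    by rewrite lt_min => /andP[h3 /ltW h4].
  rewrite Fid ?s_ge0 ?sM//; last exact: gx.
  have [s_le0|s_gt0] := leP s 0.
    have -> : s = 0 by apply/eqP; rewrite eq_le s_le0.
    by have [_ -> _ _] := gx xL; rewrite mulr0.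
  by have := h1 xL s (HU3 s _); rewrite s_gt0 sd ler_pdivrMr// => /(_ isT).
have [C C0 HC] := ode_gronwall L0 Lg g0.
have [|B [K2 HK2]] := discrete_bounded L_gt0 AF Lg g0 M0 FM.
  move=> u v Hode u0 u_ge0.
  pose i := Ordinal n_gt0; have [ab [_ /(_ M)Hi]] := HS i.
  have [ha _ hb] := ab_sub i.
  have [Hi0 _] := Hi u v _ (SM i) (odeS ha hb Hode) (fun x xi => u_ge0 x (sub i x xi)).
  have ui : forall x, x \in `[a i, b i] -> u x = 0.
    apply: Hi0; apply: aeS Hgood => x gx xi; rewrite Fid ?lexx ?(ltW M0)//.
    exact: gx (sub i x xi).
  (* At an interior point of an interval where [u] vanishes the slope vanishes too, and Gronwall's
     lemma spreads this to [0, L]. *)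
  pose m := (a i + b i) / 2.
  have mi : m \in `]a i, b i[ by rewrite in_itv/= !(midf_lt ab).
  have mi' : m \in `[a i, b i] by exact: subset_itv_oo_cc mi.
  have um := ui m mi'.
  have [_ Hu _] := Hode.
  have vm : v m = 0.
    apply: (interior_min (primitiveS ha hb Hu) (ucontS ha hb (ode_ucontv Hode)) mi).
    by move=> x xi; rewrite um u_ge0// (sub i).
  move=> x xL; have := HC u v _ Hode _ x m xL (sub i m mi').
  rewrite um vm normr0 addr0 mulr0 => h.
  have {}h : `|u x| + `|v x| <= 0.
    apply: h; apply: aeT => t tL; rewrite normrM ler_wpM2r//.
    exact: (linear_coef_le AF M0 tL).
  apply/eqP; rewrite -normr_le0 (le_trans _ h)// lerDl//.
have [u [v [Hode u0 uL v0 u_ge0]]] := shooting_solution (K := maxn K1 K2) L_gt0 AF Lg g0 al00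
  (fun N h => HK1 N (leq_trans (leq_maxl _ _) h))
  (fun N al h => HK2 N al (leq_trans (leq_maxr _ _) h)).
have uM : forall x, x \in `[0, L] -> u x <= M.
  apply: (bound_outside_gaps L_gt0 (ltW M0) Hode u0 uL ab_sub).
    move=> i; have [_ [_ Hi]] := HS i; have [ha _ hb] := ab_sub i.
    have [_ Hi1] := Hi M u v _ (SM i) (odeS ha hb Hode) (fun x xi => u_ge0 x (sub i x xi)).
    by apply: Hi1; apply: aeS Hgood => x gx xi; rewrite FE//; exact: gx (sub i x xi).
  apply: aeS f_neg => x fx xL xi; rewrite /F; case: asboolP => // _.
  by apply: linear_extension_npos => //; exact: fx.
exists u; split => //.
  apply: (ode_dirichlet L0 Hode u0 uL); apply: aeS Hgood => x gx xL.
  by rewrite Fid ?u_ge0 ?uM//; exact: gx.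
move=> x xL; have xL' : x \in `[0, L] by exact: subset_itv_oo_cc xL.
rewrite lt_neqAle u_ge0// andbT eq_sym; apply/eqP => ux.
have [_ Hu _] := Hode.
have vx : v x = 0.
  apply: (interior_min Hu (ode_ucontv Hode) xL).
  by move=> t tL; rewrite ux u_ge0.
have z0 : (0 : R) \in `[0, L] by rewrite in_itv/= lexx.
have := HC u v _ Hode _ 0 x z0 xL'; rewrite ux vx u0 normr0 addr0 mulr0 add0r.
move=> h; have {}h : `|v 0| <= 0.
  by apply: h; apply: aeT => t tL; have [_ _ gF] := AF; exact: gF.
by have := lt_le_trans (lt_le_trans al00 v0) (le_trans (ler_norm _) h); rewrite ltxx.
Qed.
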